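(* If the Wiener index of an undirected weighted graph on $N$ nodes and $M$ edges can be computed in $f(N,M)$ time, then the minimum weight $k$-cycle problem in $N$-node, $M$-edge directed graphs can be solved in $\tilde{O}(f(N,M)+M)$ time.
   Context: The Wiener index of a graph $G=(V,E)$ is $\mathbb{W}(G)=\sum_{v\in V}\sum_{u\in V} d(v,u)$, where $d(v,u)$ is the shortest path distance. Minimum weight $k$-cycle ($k$ a constant): given a directed graph with integer edge weights, find a simple directed cycle on exactly $k$ vertices of minimum total weight. $\tilde{O}$ hides polylogarithmic factors.
   Formalization: The time bound f(N,M) is assumed nondecreasing in N and in M; otherwise f is unconstrained at pairs (N,M) for which no connected simple undirected graph exists (M < N-1 or M > N(N-1)/2) and the claim fails there. *)

(* Defs.v *)
From Stdlib Require Import ZArith List.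
Import ListNotations.

(* A program uses finitely many registers and finitely many arrays, all of
   them holding integers.  [exec B] is stuck as soon as an instruction
   produces a value outside [-B, B]; word length O(log n) is expressed by
   taking B polynomial in the size parameters (see [solves]). *)
Inductive binop := Add | Sub | Mul | Div | Mod | And | Or | Xor | Shl | Shr.

Definition eval_op (o : binop) : Z -> Z -> Z :=
  match o with
  | Add => Z.add | Sub => Z.sub | Mul => Z.mul
  | Div => Z.div | Mod => Z.modulo
  | And => Z.land | Or => Z.lor | Xor => Z.lxor
  | Shl => Z.shiftl | Shr => Z.shiftr
  end.

Inductive cmd :=
| Skip
| Const (x : nat) (z : Z)              (* x := z *)
| Op (o : binop) (x y z : nat)         (* x := y o z *)
| Read (x a y : nat)                   (* x := a[y] *)
| Write (a x y : nat)                  (* a[x] := y *)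
| Seq (c1 c2 : cmd)
| If (x y : nat) (c1 c2 : cmd)         (* branches on x < y *)
| While (x y : nat) (c : cmd).         (* loops as long as x < y *)

Record state := State { reg : nat -> Z; arr : nat -> Z -> Z }.

Definition set_reg (s : state) (x : nat) (v : Z) : state :=
  State (fun y => if Nat.eqb y x then v else reg s y) (arr s).

Definition set_arr (s : state) (a : nat) (i v : Z) : state :=
  State (reg s)
        (fun b j => if (Nat.eqb b a && Z.eqb j i)%bool then v else arr s b j).

(* [exec B c s t s']: started in s, the program c halts in s' after t steps.
   Every elementary instruction and every test costs one step. *)
Inductive exec (B : Z) : cmd -> state -> nat -> state -> Prop :=
| exec_skip s :
    exec B Skip s 1 s
| exec_const x z s :
    (Z.abs z <= B)%Z ->
    exec B (Const x z) s 1 (set_reg s x z)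
| exec_op o x y z s :
    (Z.abs (eval_op o (reg s y) (reg s z)) <= B)%Z ->
    exec B (Op o x y z) s 1 (set_reg s x (eval_op o (reg s y) (reg s z)))
| exec_read x a y s :
    exec B (Read x a y) s 1 (set_reg s x (arr s a (reg s y)))
| exec_write a x y s :
    exec B (Write a x y) s 1 (set_arr s a (reg s x) (reg s y))
| exec_seq c1 c2 s t1 s1 t2 s2 :
    exec B c1 s t1 s1 -> exec B c2 s1 t2 s2 ->
    exec B (Seq c1 c2) s (t1 + t2) s2
| exec_if_true x y c1 c2 s t s' :
    (reg s x < reg s y)%Z -> exec B c1 s t s' ->
    exec B (If x y c1 c2) s (S t) s'
| exec_if_false x y c1 c2 s t s' :
    (reg s y <= reg s x)%Z -> exec B c2 s t s' ->
    exec B (If x y c1 c2) s (S t) s'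
| exec_while_true x y c s t1 s1 t2 s2 :
    (reg s x < reg s y)%Z -> exec B c s t1 s1 ->
    exec B (While x y c) s1 t2 s2 ->
    exec B (While x y c) s (S (t1 + t2)) s2
| exec_while_false x y c s :
    (reg s y <= reg s x)%Z ->
    exec B (While x y c) s 1 s.

(* The vertices are 0, ..., order - 1 and an edge is ((u, v), w).  In an
   undirected graph each edge is listed once, in either orientation. *)
Record wgraph := WGraph { order : nat; edges : list (nat * nat * Z) }.

Definition nedges (G : wgraph) : nat := length (edges G).

Definition sumZ (l : list Z) : Z := fold_right Z.add 0%Z l.

Definition weights_le (G : wgraph) (W : nat) : Prop :=
  forall a w, In (a, w) (edges G) -> (Z.abs w <= Z.of_nat W)%Z.

Definition simple_digraph (G : wgraph) : Prop :=
  (forall u v w, In (u, v, w) (edges G) -> u < order G /\ v < order G /\ u <> v)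
  /\ NoDup (map fst (edges G)).

Definition simple_graph (G : wgraph) : Prop :=
  simple_digraph G /\
  (forall u v w w', In (u, v, w) (edges G) -> ~ In (v, u, w') (edges G)).

Definition nonneg_weights (G : wgraph) : Prop :=
  forall a w, In (a, w) (edges G) -> (0 <= w)%Z.

Definition adj (G : wgraph) (u v : nat) (w : Z) : Prop :=
  In (u, v, w) (edges G) \/ In (v, u, w) (edges G).

Inductive walk (G : wgraph) : nat -> nat -> Z -> Prop :=
| walk_nil u : u < order G -> walk G u u 0
| walk_cons u v x w l : adj G u v w -> walk G v x l -> walk G u x (w + l).

Definition connected (G : wgraph) : Prop :=
  forall u v, u < order G -> v < order G -> exists l, walk G u v l.

Definition is_dist (G : wgraph) (u v : nat) (d : Z) : Prop :=
  walk G u v d /\ forall l, walk G u v l -> (d <= l)%Z.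

Definition is_wiener_index (G : wgraph) (x : Z) : Prop :=
  exists d : nat -> nat -> Z,
    (forall u v, u < order G -> v < order G -> is_dist G u v (d u v)) /\
    x = sumZ (map (fun v => sumZ (map (fun u => d v u) (seq 0 (order G))))
                  (seq 0 (order G))).

(* arcs [v1; ...; vk] = [(v1, v2); ...; (vk, v1)] *)
Definition arcs (c : list nat) : list (nat * nat) :=
  combine c (tl c ++ firstn 1 c).

Definition is_kcycle (G : wgraph) (k : nat) (c : list nat) (w : Z) : Prop :=
  length c = k /\ NoDup c /\
  exists ws, Forall2 (fun a x => In (a, x) (edges G)) (arcs c) ws /\ w = sumZ ws.

Definition is_min_kcycle (G : wgraph) (k : nat) (c : list nat) : Prop :=
  exists w, is_kcycle G k c w /\
            forall c' w', is_kcycle G k c' w' -> (w <= w')%Z.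

(* Input: the numbers of vertices and of edges in registers 0 and 1, the edge
   list in arrays 0, 1 (endpoints) and 2 (weights); everything else is 0. *)
Definition init (G : wgraph) : state :=
  let e (i : Z) := nth_error (edges G) (Z.to_nat i) in
  let get (g : nat * nat * Z -> Z) (i : Z) :=
    if (i <? 0)%Z then 0%Z
    else match e i with Some x => g x | None => 0%Z end in
  State
    (fun x => match x with
              | 0 => Z.of_nat (order G)
              | 1 => Z.of_nat (nedges G)
              | _ => 0%Z
              end)
    (fun a => match a with
              | 0 => get (fun x => Z.of_nat (fst (fst x)))
              | 1 => get (fun x => Z.of_nat (snd (fst x)))
              | 2 => get snd
              | _ => fun _ => 0%Z
              end).

(* P solves, on the graphs satisfying [valid], the problem with correct final
   states [spec], within [time N M W] steps on graphs with N vertices, M edges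
   and weights of absolute value at most W, using words of O(log (N + W)) bits;
   as usual, the weights thus fit into O(1) words. *)
Definition solves (P : cmd) (valid : wgraph -> Prop)
    (spec : wgraph -> state -> Prop) (time : nat -> nat -> nat -> nat) : Prop :=
  exists a : nat, forall (G : wgraph) (W : nat), valid G -> weights_le G W ->
    exists t s',
      exec (Z.of_nat ((order G + W + 2) ^ a)) P (init G) t s' /\
      t <= time (order G) (nedges G) W /\
      spec G s'.

(* Distances are finite exactly on connected graphs, and well defined because
   the weights are nonnegative. *)
Definition wiener_instance (G : wgraph) : Prop :=
  simple_graph G /\ nonneg_weights G /\ connected G.

Definition wiener_output (G : wgraph) (s : state) : Prop :=
  is_wiener_index G (reg s 0).

(* Register 0 tells whether there is a k-cycle; if so, the first k entries of
   array 0 are the successive vertices of one of minimum weight. *)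
Definition kcycle_output (k : nat) (G : wgraph) (s : state) : Prop :=
  (reg s 0 = 1%Z /\
   exists c, is_min_kcycle G k c /\
             forall i, i < k -> arr s 0 (Z.of_nat i) = Z.of_nat (nth i c 0))
  \/
  (reg s 0 = 0%Z /\ ~ exists c w, is_kcycle G k c w).

Definition wiener_computable_in (f : nat -> nat -> nat) : Prop :=
  exists P, solves P wiener_instance wiener_output (fun N M _ => f N M).

(* Soft-O: a factor polylogarithmic in N and in the largest weight W (hence
   polylogarithmic in N when the weights are polynomial in N) is hidden. *)
Definition min_kcycle_solvable_in_softO
    (k : nat) (g : nat -> nat -> nat) : Prop :=
  exists (P : cmd) (C d : nat),
    solves P simple_digraph (kcycle_output k)
      (fun N M W => C * g N M * Nat.log2 (N + W + 2) ^ d).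

Definition monotone2 (f : nat -> nat -> nat) : Prop :=
  forall N N' M M', N <= N' -> M <= M' -> f N M <= f N' M'.

(* Main.v *)
From Stdlib Require Import ZArith List Lia Bool FinFun Classical_Prop.
Import ListNotations.
Require Import Defs.

(* A k-cycle is found through the Wiener indices of polylogarithmically many undirected graphs.
   Fix a modulus, a residue r_i for every position i < k of the cycle and residues for the
   indices of its edges; layer i consists of the vertices congruent to r_i, with a second copy
   of layer 0 as layer k.  Since the common multiples of 1, ..., U are at least 2^(U-1), some
   modulus of polylogarithmic size separates the vertices of any given cycle; conversely the
   layers are disjoint, so every closed layered walk is a k-cycle.

   Every layer edge is given a weight of at least BIG, so an undirected path from a vertex v
   of layer 0 to its copy v' in layer k is either a layered walk or too heavy.  A hub adjacent
   to all vertices makes every distance at most (k+1) BIG, and an edge of weight tau joins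
   each v to v'.  Varying tau in [k BIG, (k+1) BIG] then only affects the distances d(v, v'),
   which are the minimum of tau and the cost of a cycle through v: the Wiener index grows at
   the maximal rate in tau exactly as long as no cycle is cheaper than tau.  Binary search on
   tau yields the minimum.  The costs carry the names of the vertices in their low-order
   digits, so that the minimum determines a cycle.

   The residue classes are chosen so fine that the graphs have at most N vertices and M edges,
   unless M is bounded; hence a call costs f(N, M) + O(1).  To run the Wiener program many
   times, its arrays are shifted to a fresh zero region at every call. *)

(* [f] is only assumed monotone: no bound of the form [f (2 * N) M <= C * f N M] is available, so a
   gadget may not exceed the input even by a constant factor. Hence the splitting on both sides,
   vertices modulo a multiple of [c] and edge indices modulo [c]: small layers alone would leave too
   many edges. Nor has the budget a term in [N], so vertices without edges are discarded first,
   which leaves at most [2 * M] of them.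

   A Wiener index is a single number in which most distances are unknown. It is therefore compared
   with the index of the same gadget at tau equal to [k] BIG, where every d(v, v') equals tau
   whatever the input; the subtraction cancels all other pairs. No gadget can grow faster than the
   maximal rate, so the tests of all gadgets can be added up and one deficit is still visible.
   Running through all residues, rather than drawing them at random, keeps the reduction
   deterministic. *)
Declare Scope prog_scope.
Notation "c1 ;; c2" := (Seq c1 c2) (at level 61, right associativity) : prog_scope.
Local Open Scope prog_scope.

(** * Weakest preconditions with a time bound *)

(** Halting is part of the claim, and [t] is an upper bound rather than the exact cost, so that
    branches of different lengths can share one bound. *)
Definition wp (B : Z) (c : cmd) (t : nat) (Q : state -> Prop) (s : state) : Prop :=
  exists t' s', exec B c s t' s' /\ t' <= t /\ Q s'.

Lemma wp_skip B t Q s : Q s -> wp B Skip (S t) Q s.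
Proof. intros H. exists 1, s. split; [constructor | split; [lia | exact H]]. Qed.

Lemma wp_const B x z t Q s :
  (Z.abs z <= B)%Z -> Q (set_reg s x z) -> wp B (Const x z) (S t) Q s.
Proof. intros Hz H. eexists 1, _. split; [now constructor | split; [lia | exact H]]. Qed.

Lemma wp_op v B o x y z t Q s :
  eval_op o (reg s y) (reg s z) = v -> (Z.abs v <= B)%Z -> Q (set_reg s x v) ->
  wp B (Op o x y z) (S t) Q s.
Proof. intros <- Hv H. eexists 1, _. split; [now constructor | split; [lia | exact H]]. Qed.

Lemma wp_read v B x a y t Q s :
  arr s a (reg s y) = v -> Q (set_reg s x v) -> wp B (Read x a y) (S t) Q s.
Proof. intros <- H. eexists 1, _. split; [constructor | split; [lia | exact H]]. Qed.

Lemma wp_write i v B a x y t Q s :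
  reg s x = i -> reg s y = v -> Q (set_arr s a i v) -> wp B (Write a x y) (S t) Q s.
Proof. intros <- <- H. eexists 1, _. split; [constructor | split; [lia | exact H]]. Qed.

Lemma wp_seq t1 t2 B c1 c2 Q s :
  wp B c1 t1 (wp B c2 t2 Q) s -> wp B (c1 ;; c2) (t1 + t2) Q s.
Proof.
  intros (t1' & s1 & H1 & L1 & t2' & s2 & H2 & L2 & HQ).
  exists (t1' + t2'), s2. split; [eapply exec_seq; eassumption | split; [lia | exact HQ]].
Qed.

Lemma wp_if B x y c1 c2 t Q s :
  ((reg s x < reg s y)%Z -> wp B c1 t Q s) ->
  ((reg s y <= reg s x)%Z -> wp B c2 t Q s) ->
  wp B (If x y c1 c2) (S t) Q s.
Proof.
  intros H1 H2. destruct (Z.lt_ge_cases (reg s x) (reg s y)) as [h | h].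
  - destruct (H1 h) as (t' & s' & He & Hl & HQ).
    exists (S t'), s'. split; [now apply exec_if_true | split; [lia | exact HQ]].
  - destruct (H2 h) as (t' & s' & He & Hl & HQ).
    exists (S t'), s'. split; [now apply exec_if_false | split; [lia | exact HQ]].
Qed.

Lemma wp_conseq t1 (Q1 : state -> Prop) B c t Q s :
  wp B c t1 Q1 s -> t1 <= t -> (forall s', Q1 s' -> Q s') -> wp B c t Q s.
Proof.
  intros (t' & s' & He & Hl & H1) Ht HQ. exists t', s'.
  split; [exact He | split; [lia | now apply HQ]].
Qed.

Lemma wp_le t1 B c t Q s : wp B c t1 Q s -> t1 <= t -> wp B c t Q s.
Proof. intros H Ht. now apply (wp_conseq t1 Q). Qed.

Lemma exec_le B B' c s t s' : (B <= B')%Z -> exec B c s t s' -> exec B' c s t s'.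
Proof.
  intros HB H; induction H;
    [> constructor | constructor; lia | constructor; lia | constructor | constructor
     | eapply exec_seq | apply exec_if_true | apply exec_if_false
     | eapply exec_while_true | apply exec_while_false]; eassumption.
Qed.

Fixpoint writes (c : cmd) (r : nat) : bool :=
  match c with
  | Skip | Write _ _ _ => false
  | Const x _ | Op _ x _ _ | Read x _ _ => Nat.eqb r x
  | Seq c1 c2 | If _ _ c1 c2 => writes c1 r || writes c2 r
  | While _ _ c => writes c r
  end.

Fixpoint writesa (c : cmd) (a : nat) : bool :=
  match c with
  | Write b _ _ => Nat.eqb a b
  | Seq c1 c2 | If _ _ c1 c2 => writesa c1 a || writesa c2 a
  | While _ _ c => writesa c a
  | _ => false
  end.

(** The write sets are computed from the program text. A loop invariant then only has to mention
    what the body changes; everything else is recovered by evaluating [writes] or [writesa]. *)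
Definition frame (c : cmd) (s s' : state) : Prop :=
  (forall r, writes c r = false -> reg s' r = reg s r) /\
  (forall a, writesa c a = false -> forall j, arr s' a j = arr s a j).

Lemma frame_refl c s : frame c s s.
Proof. split; reflexivity. Qed.

Lemma frame_trans c s1 s2 s3 : frame c s1 s2 -> frame c s2 s3 -> frame c s1 s3.
Proof.
  intros [H1 H2] [H3 H4]. split; intros.
  - rewrite H3 by assumption. now apply H1.
  - rewrite H4 by assumption. now apply H2.
Qed.

Lemma exec_frame B c s t s' : exec B c s t s' -> frame c s s'.
Proof.
  intros H; induction H; cbn.
  all: try (apply frame_refl).
  all: try (split; cbn; intros r Hr; [now rewrite Hr | reflexivity]).
  - split; cbn; [reflexivity | intros b Hb j; now rewrite Hb].
  - destruct IHexec1 as [A1 A2], IHexec2 as [A3 A4].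
    split; cbn; intros r Hr.
    + apply orb_false_iff in Hr. rewrite A3, A1; tauto.
    + intros j. apply orb_false_iff in Hr. rewrite A4, A2; tauto.
  - destruct IHexec as [A1 A2].
    split; cbn; intros r Hr; apply orb_false_iff in Hr; [apply A1 | apply A2]; tauto.
  - destruct IHexec as [A1 A2].
    split; cbn; intros r Hr; apply orb_false_iff in Hr; [apply A1 | apply A2]; tauto.
  - exact (frame_trans _ _ _ _ IHexec1 IHexec2).
Qed.

Lemma wp_frame B c t Q s :
  wp B c t Q s -> wp B c t (fun s' => Q s' /\ frame c s s') s.
Proof.
  intros (t' & s' & He & Hl & HQ). exists t', s'. repeat split; auto;
  now apply (exec_frame _ _ _ _ _ He).
Qed.

(** [q] bounds the rounds that may still follow, and the loop may stop before [q] reaches zero.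
    Binary search needs this freedom, since its number of rounds depends on the rounding; loops with
    a known count use [wp_for]. *)
Lemma wp_while B x y c tb (I : nat -> state -> Prop) (Q : state -> Prop) p s0 :
  I p s0 ->
  (forall q s, q <= p -> I q s -> frame c s0 s ->
     ((reg s y <= reg s x)%Z /\ Q s) \/
     ((reg s x < reg s y)%Z /\ exists q', q = S q' /\ wp B c tb (I q') s)) ->
  wp B (While x y c) (p * S tb + 1) (fun s => Q s /\ frame c s0 s) s0.
Proof.
  intros H0 Hstep.
  assert (G : forall q s, q <= p -> I q s -> frame c s0 s ->
    wp B (While x y c) (q * S tb + 1) (fun s => Q s /\ frame c s0 s) s).
  { induction q as [q IH] using lt_wf_ind; intros s Hq HI Hf.
    destruct (Hstep q s Hq HI Hf) as [[Hle HQ] | [Hlt (q' & -> & Hw)]].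
    - exists 1, s. split; [now apply exec_while_false | split; [lia | auto]].
    - apply wp_frame in Hw. destruct Hw as (t1 & s1 & He & Hl & HI' & Hf').
      destruct (IH q' (Nat.lt_succ_diag_r q') s1 ltac:(lia) HI'
                  (frame_trans _ _ _ _ Hf Hf')) as (t2 & s2 & He2 & Hl2 & HQ2).
      exists (S (t1 + t2)), s2. split; [eapply exec_while_true; eassumption | split; [lia | exact HQ2]]. }
  apply G; auto using frame_refl.
Qed.

Lemma wp_for B x y c tb n (I : nat -> state -> Prop) s0 :
  I 0 s0 ->
  (forall i s, i < n -> I i s -> frame c s0 s ->
     (reg s x < reg s y)%Z /\ wp B c tb (I (S i)) s) ->
  (forall s, I n s -> frame c s0 s -> (reg s y <= reg s x)%Z) ->
  wp B (While x y c) (n * S tb + 1) (fun s => I n s /\ frame c s0 s) s0.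
Proof.
  intros H0 Hs Hn.
  apply wp_while with (I := fun q s => I (n - q) s /\ q <= n).
  - rewrite Nat.sub_diag. auto.
  - intros q s _ [HI Hq] Hf. destruct q as [| q].
    + rewrite Nat.sub_0_r in HI. left. split; auto.
    + right. destruct (Hs (n - S q) s ltac:(lia) HI Hf) as [A Hw]. split; [exact A |].
      exists q. split; [reflexivity |].
      eapply wp_conseq; [exact Hw | lia |]. intros s' HI'.
      replace (n - q) with (S (n - S q)) by lia. split; [exact HI' | lia].
Qed.

(** * Separating distinct numbers by a small modulus *)

Fixpoint binom (n j : nat) : Z :=
  match n, j with
  | _, 0 => 1%Z
  | 0, S _ => 0%Z
  | S n', S j' => (binom n' j' + binom n' (S j'))%Z
  end.

Lemma binom_gt n j : n < j -> binom n j = 0%Z.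
Proof.
  revert j; induction n as [| n IH]; intros [| j] Hj; try lia; [reflexivity |].
  cbn. rewrite !IH by lia. lia.
Qed.

Lemma binom_pos n j : j <= n -> (0 < binom n j)%Z.
Proof.
  revert j; induction n as [| n IH]; intros [| j] Hj; cbn; try lia.
  pose proof (IH j ltac:(lia)). destruct (Nat.eq_dec j n) as [-> | Hne].
  - rewrite (binom_gt n (S n)) by lia. lia.
  - pose proof (IH (S j) ltac:(lia)). lia.
Qed.

Lemma binom_absorb n j :
  (Z.of_nat (S j) * binom (S n) (S j) = Z.of_nat (S n) * binom n j)%Z.
Proof.
  revert j; induction n as [| n IH]; intros j.
  - destruct j; [reflexivity |]. rewrite !binom_gt by lia. lia.
  - change (binom (S (S n)) (S j)) with (binom (S n) j + binom (S n) (S j))%Z.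
    destruct j as [| j].
    + specialize (IH 0). cbn [binom] in *. destruct n; cbn [binom] in *; lia.
    + pose proof (IH (S j)) as H1. pose proof (IH j) as H2.
      change (binom (S n) (S j)) with (binom n j + binom n (S j))%Z in *.
      nia.
Qed.

Lemma binom_shift n j :
  (Z.of_nat (S j) * binom n (S j) = (Z.of_nat n - Z.of_nat j) * binom n j)%Z.
Proof.
  pose proof (binom_absorb n j) as H.
  change (binom (S n) (S j)) with (binom n j + binom n (S j))%Z in H. nia.
Qed.

(* Leibniz's harmonic triangle: [1 / ((n+2) binom (n+1) (j+1))] is the difference of
   [1 / ((n+1) binom n j)] and [1 / ((n+2) binom (n+1) j)], so divisibility of [D] propagates
   along the rows. *)
Lemma leibniz_dvd (D : Z) (U : nat) :
  (forall m, 1 <= m <= U -> (Z.of_nat m | D)%Z) ->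
  forall j n, j <= n < U -> (Z.of_nat (S n) * binom n j | D)%Z.
Proof.
  intros HD. induction j as [| j IH]; intros n Hn.
  - destruct n; cbn [binom]; rewrite Z.mul_1_r; apply HD; lia.
  - destruct n as [| n]; [lia |].
    destruct (IH (S n) ltac:(lia)) as [qa Ha]. destruct (IH n ltac:(lia)) as [qe He].
    exists (qe - qa)%Z.
    pose proof (binom_pos (S n) j ltac:(lia)) as Pa.
    pose proof (binom_pos n j ltac:(lia)) as Pe.
    pose proof (binom_shift (S n) j) as S1.
    pose proof (binom_shift n j) as S2.
    pose proof (binom_absorb n j) as S3.
    set (x := binom (S n) j) in *. set (y := binom n j) in *.
    set (z := binom (S n) (S j)) in *.
    assert (E : ((Z.of_nat (S n) - Z.of_nat j) * x = Z.of_nat (S n) * y)%Z) by lia.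
    set (a := (Z.of_nat (S (S n)) * x)%Z) in *.
    set (e := (Z.of_nat (S n) * y)%Z) in *.
    set (b := (Z.of_nat (S (S n)) * z)%Z) in *.
    assert (K : (a * e = b * (a - e))%Z).
    { assert (a - e = Z.of_nat (S j) * x)%Z as -> by (unfold a; nia).
      rewrite <- S3. unfold a, b. ring. }
    assert (0 < a)%Z by (unfold a; nia). assert (0 < e)%Z by (unfold e; nia).
    apply (Z.mul_reg_r _ _ (a * e)); [nia |].
    replace ((qe - qa) * b * (a * e))%Z with (qe * e * b * a - qa * a * b * e)%Z by ring.
    rewrite <- He, <- Ha. rewrite K. ring.
Qed.

Fixpoint row_sum (n m : nat) : Z :=
  match m with 0 => 0%Z | S m' => (row_sum n m' + binom n m')%Z end.

Lemma row_sum_S n m : row_sum (S n) (S m) = (row_sum n m + row_sum n (S m))%Z.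
Proof.
  induction m as [| m IH]; [destruct n; reflexivity |].
  change (row_sum (S n) (S (S m))) with (row_sum (S n) (S m) + binom (S n) (S m))%Z.
  rewrite IH. cbn [row_sum binom]. lia.
Qed.

Lemma row_sum_pow n : row_sum n (S n) = (2 ^ Z.of_nat n)%Z.
Proof.
  induction n as [| n IH]; [reflexivity |].
  rewrite row_sum_S. cbn [row_sum] in *. rewrite (binom_gt n (S n)) by lia.
  rewrite Nat2Z.inj_succ, Z.pow_succ_r by lia. lia.
Qed.

Lemma row_sum_le n m (A : Z) :
  (forall j, j < m -> (binom n j <= A)%Z) -> (row_sum n m <= Z.of_nat m * A)%Z.
Proof.
  induction m as [| m IH]; intros H; cbn [row_sum]; [lia |].
  specialize (IH ltac:(intros; apply H; lia)). specialize (H m ltac:(lia)). lia.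
Qed.

(** By [leibniz_dvd], each of the [U + 1] binomials in row [U] is at most [D / (U + 1)], so their
    sum [2 ^ U] is at most [D]. This is an elementary substitute for estimates on the distribution
    of primes. *)
Lemma common_multiple_ge (D : Z) (U : nat) :
  (0 < D)%Z -> (forall m, 1 <= m <= S U -> (Z.of_nat m | D)%Z) -> (2 ^ Z.of_nat U <= D)%Z.
Proof.
  intros P HD. rewrite <- row_sum_pow.
  assert (H : forall j, j <= U -> (Z.of_nat (S U) * binom U j <= D)%Z).
  { intros j Hj. apply Z.divide_pos_le; [exact P |].
    apply leibniz_dvd with (U := S U); auto; lia. }
  assert (Q : (row_sum U (S U) <= Z.of_nat (S U) * (D / Z.of_nat (S U)))%Z).
  { apply row_sum_le. intros j Hj. apply Z.div_le_lower_bound; [lia |]. apply H; lia. }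
  pose proof (Z.mul_div_le D (Z.of_nat (S U)) ltac:(lia)). lia.
Qed.

(** The value 1 on the diagonal keeps the product over all ordered pairs nonzero. *)
Definition gap (p : nat * nat) : Z :=
  if Nat.eqb (fst p) (snd p) then 1%Z else Z.abs (Z.of_nat (fst p) - Z.of_nat (snd p)).

Definition prodZ (l : list Z) : Z := fold_right Z.mul 1%Z l.

Lemma prodZ_bounds (A : Z) l :
  (1 <= A)%Z -> (forall x, In x l -> (1 <= x <= A)%Z) ->
  (1 <= prodZ l <= A ^ Z.of_nat (length l))%Z.
Proof.
  intros HA. induction l as [| x l IH]; intros H; [cbn; lia |].
  cbn [prodZ fold_right length]. fold (prodZ l).
  specialize (IH ltac:(intros; apply H; now right)).
  specialize (H x ltac:(now left)).
  rewrite Nat2Z.inj_succ, Z.pow_succ_r by lia. nia.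
Qed.

Lemma prodZ_dvd x l : In x l -> (x | prodZ l)%Z.
Proof.
  induction l as [| y l IH]; cbn; [easy |]. intros [-> | H].
  - apply Z.divide_factor_l.
  - apply Z.divide_mul_r. auto.
Qed.

(** A modulus that does not divide the product of all differences divides none of them. For a list
    of length [k] the product is at most 2 to the power [L * (k * k)], whereas a positive number
    divisible by everything up to [L * (k * k) + 2] is at least twice as large. *)
Lemma separating_modulus (L : nat) (c : list nat) (U : nat) :
  (forall u, In u c -> u < 2 ^ L) -> L * (length c * length c) + 2 <= U ->
  exists m, 1 <= m <= U /\
    forall u v, In u c -> In v c -> u <> v -> u mod m <> v mod m.
Proof.
  intros Hc HU.
  set (D := prodZ (map gap (list_prod c c))).
  assert (HD : (1 <= D <= 2 ^ Z.of_nat (L * (length c * length c)))%Z).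
  { assert (E : (2 ^ Z.of_nat (L * (length c * length c))
              = (2 ^ Z.of_nat L) ^ Z.of_nat (length (map gap (list_prod c c))))%Z).
    { rewrite length_map, length_prod, Nat2Z.inj_mul, Z.pow_mul_r by lia. reflexivity. }
    rewrite E. apply prodZ_bounds.
    - pose proof (Z.pow_pos_nonneg 2 (Z.of_nat L)). lia.
    - intros x Hx. apply in_map_iff in Hx. destruct Hx as ((u, v) & <- & Hp).
      apply in_prod_iff in Hp. destruct Hp as [Hu Hv].
      apply Hc in Hu, Hv. unfold gap; cbn [fst snd].
      pose proof (Z.pow_pos_nonneg 2 (Z.of_nat L)).
      assert (Z.of_nat (2 ^ L) = 2 ^ Z.of_nat L)%Z by (now rewrite Nat2Z.inj_pow).
      destruct (Nat.eqb_spec u v); lia. }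
  assert (K : exists m, 1 <= m <= U /\ ~ (Z.of_nat m | D)%Z).
  { assert (dec : forall U', (exists m, 1 <= m <= U' /\ ~ (Z.of_nat m | D)%Z) \/
       (forall m, 1 <= m <= U' -> (Z.of_nat m | D)%Z)).
    { induction U' as [| U' IH]; [right; lia |].
      destruct IH as [(m & Hm & Hd) | IH]; [left; exists m; split; [lia | auto] |].
      destruct (Znumtheory.Zdivide_dec (Z.of_nat (S U')) D) as [Hd | Hd].
      - right. intros m Hm. destruct (Nat.eq_dec m (S U')) as [-> |]; [exact Hd |].
        apply IH; lia.
      - left. exists (S U'). split; [lia | exact Hd]. }
    destruct (dec U) as [H | H]; [exact H | exfalso].
    pose proof (common_multiple_ge D (S (L * (length c * length c))) ltac:(lia)
      ltac:(intros; apply H; lia)) as Hge.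
    rewrite Nat2Z.inj_succ, Z.pow_succ_r in Hge by lia. lia. }
  destruct K as (m & Hm & Hd). exists m. split; [exact Hm |].
  intros u v Hu Hv Huv E. apply Hd.
  apply Z.divide_trans with (gap (u, v)).
  - unfold gap; cbn [fst snd]. destruct (Nat.eqb_spec u v); [contradiction |].
    apply Z.divide_abs_r.
    exists (Z.of_nat (u / m) - Z.of_nat (v / m))%Z.
    pose proof (Nat.div_mod_eq u m). pose proof (Nat.div_mod_eq v m). nia.
  - apply prodZ_dvd, in_map, in_prod; assumption.
Qed.

(** * Finite sums *)

Definition sum_upto (F : nat -> Z) (N : nat) : Z := sumZ (map F (seq 0 N)).

Lemma sumZ_app l1 l2 : sumZ (l1 ++ l2) = (sumZ l1 + sumZ l2)%Z.
Proof. unfold sumZ. induction l1; cbn in *; lia. Qed.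

Lemma sum_upto_S F N : sum_upto F (S N) = (sum_upto F N + F N)%Z.
Proof. unfold sum_upto. rewrite seq_S, map_app, sumZ_app. cbn. lia. Qed.

Lemma sum_upto_ext F G N :
  (forall i, i < N -> F i = G i) -> sum_upto F N = sum_upto G N.
Proof.
  induction N as [| N IH]; intros H; [reflexivity |].
  rewrite !sum_upto_S, IH, H by (intros; try apply H; lia). reflexivity.
Qed.

Lemma sum_upto_le F G N :
  (forall i, i < N -> (F i <= G i)%Z) -> (sum_upto F N <= sum_upto G N)%Z.
Proof.
  induction N as [| N IH]; intros H; [cbn; lia |].
  rewrite !sum_upto_S. specialize (IH ltac:(intros; apply H; lia)).
  specialize (H N ltac:(lia)). lia.
Qed.

Lemma sum_upto_lt F G N j :
  (forall i, i < N -> (F i <= G i)%Z) -> j < N -> (F j < G j)%Z ->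
  (sum_upto F N < sum_upto G N)%Z.
Proof.
  induction N as [| N IH]; intros H Hj Hlt; [lia |].
  rewrite !sum_upto_S. destruct (Nat.eq_dec j N) as [-> | Hne].
  - pose proof (sum_upto_le F G N ltac:(intros; apply H; lia)). lia.
  - specialize (IH ltac:(intros; apply H; lia) ltac:(lia) Hlt).
    specialize (H N ltac:(lia)). lia.
Qed.

Lemma sum_upto_sub F G N :
  sum_upto (fun i => F i - G i)%Z N = (sum_upto F N - sum_upto G N)%Z.
Proof. induction N as [| N IH]; [reflexivity |]. rewrite !sum_upto_S, IH. lia. Qed.

Lemma sum_upto_scale a F N :
  sum_upto (fun i => F i * a)%Z N = (sum_upto F N * a)%Z.
Proof. induction N as [| N IH]; [reflexivity |]. rewrite !sum_upto_S, IH. lia. Qed.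

Lemma sum_upto_const a N : sum_upto (fun _ => a) N = (Z.of_nat N * a)%Z.
Proof. induction N as [| N IH]; [reflexivity |]. rewrite !sum_upto_S, IH. lia. Qed.

Lemma sum_upto_point (a : nat) N :
  sum_upto (fun i => if Nat.eqb a i then 1 else 0)%Z N = (if Nat.ltb a N then 1 else 0)%Z.
Proof.
  induction N as [| N IH]; [reflexivity |]. rewrite !sum_upto_S, IH.
  destruct (Nat.ltb_spec a N), (Nat.ltb_spec a (S N)), (Nat.eqb_spec a N); lia.
Qed.

(** * Walks *)

Lemma walk_app G u v x l1 l2 : walk G u v l1 -> walk G v x l2 -> walk G u x (l1 + l2).
Proof.
  intros H. revert x l2; induction H; intros y l2 Hy; [exact Hy |].
  rewrite <- Z.add_assoc. econstructor; eauto.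
Qed.

Lemma adj_sym G u v w : adj G u v w -> adj G v u w.
Proof. unfold adj; tauto. Qed.

Lemma walk_edge G u v w : adj G u v w -> v < order G -> walk G u v w.
Proof.
  intros H Hv. replace w with (w + 0)%Z by lia. econstructor; [exact H | now constructor].
Qed.

Lemma walk_sym G u v l :
  (forall x y w, adj G x y w -> x < order G) -> walk G u v l -> walk G v u l.
Proof.
  intros HG. induction 1.
  - now constructor.
  - rewrite Z.add_comm. eapply walk_app; [eassumption |].
    apply walk_edge; [now apply adj_sym | now apply HG in H].
Qed.

Lemma walk_nonneg G u v l :
  (forall x y w, adj G x y w -> (0 <= w)%Z) -> walk G u v l -> (0 <= l)%Z.
Proof. intros HG. induction 1; [lia |]. apply HG in H. lia. Qed.

Lemma is_dist_unique G u v d d' : is_dist G u v d -> is_dist G u v d' -> d = d'.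
Proof. intros [H1 H2] [H3 H4]. apply H2 in H3. apply H4 in H1. lia. Qed.

Lemma mul_add_inj (b i i' p p' : nat) :
  p < b -> p' < b -> i * b + p = i' * b + p' -> i = i' /\ p = p'.
Proof. intros. apply (Nat.div_mod_unique b); lia. Qed.

(** * The gadget graph *)

Section Gadget.
Variables (k n0 : nat) (Z0 : Z) (LE : list (nat * nat * Z)).
Notation BIG := (2 * Z0)%Z.
Definition hub : nat := (k + 1) * n0.
(** A spoke weighs half of [(k + 1) * BIG], so the detour through the hub joins any two vertices at
    cost at most [(k + 1) * BIG]. The factor 2 in [BIG] makes this half an integer. *)
Definition star : list (nat * nat * Z) :=
  map (fun x => (x, hub, Z.of_nat (k + 1) * Z0)%Z) (seq 0 hub).
Definition direct (tau : Z) : list (nat * nat * Z) :=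
  map (fun v => (v, v + k * n0, tau)) (seq 0 n0).
Definition gadget (tau : Z) : wgraph := WGraph (S hub) (star ++ direct tau ++ LE).
Notation tau0 := (Z.of_nat k * BIG)%Z.

Hypothesis hk : 0 < k.
Hypothesis hZ0 : (0 < Z0)%Z.
Hypothesis hLE : forall x y w, In (x, y, w) LE ->
  exists i p q, i < k /\ p < n0 /\ q < n0 /\ x = i * n0 + p /\ y = (i + 1) * n0 + q
    /\ (BIG <= w)%Z.

Inductive fwd : nat -> nat -> nat -> Z -> Prop :=
| fwd_nil x : fwd 0 x x 0
| fwd_cons j x y z w l : In (x, y, w) LE -> fwd j y z l -> fwd (S j) x z (w + l).

Lemma fwd_ge j x y l : fwd j x y l -> (Z.of_nat j * BIG <= l)%Z.
Proof. induction 1; [lia |]. apply hLE in H. destruct H as (? & ? & ? & H). lia. Qed.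

Definition mate (x y : nat) : Prop := x < n0 /\ y = k * n0 + x.

Lemma gadget_adj tau x y w : adj (gadget tau) x y w ->
  (x < hub /\ y = hub \/ y < hub /\ x = hub) /\ w = (Z.of_nat (k + 1) * Z0)%Z \/
  (mate x y \/ mate y x) /\ w = tau \/
  In (x, y, w) LE \/ In (y, x, w) LE.
Proof.
  unfold adj, gadget, mate; cbn [edges]. rewrite !in_app_iff.
  assert (S1 : forall a b z, In (a, b, z) star ->
    a < hub /\ b = hub /\ z = (Z.of_nat (k + 1) * Z0)%Z).
  { intros a b z H. apply in_map_iff in H. destruct H as (x' & H & Hx).
    apply in_seq in Hx. inversion H; subst. lia. }
  assert (S2 : forall a b z, In (a, b, z) (direct tau) ->
    a < n0 /\ b = k * n0 + a /\ z = tau).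
  { intros a b z H. apply in_map_iff in H. destruct H as (x' & H & Hx).
    apply in_seq in Hx. inversion H; subst. lia. }
  intros [[H | [H | H]] | [H | [H | H]]]; try (apply S1 in H); try (apply S2 in H); tauto.
Qed.

Lemma gadget_star_adj tau x : x < hub -> adj (gadget tau) x hub (Z.of_nat (k + 1) * Z0).
Proof.
  intros H. left. cbn. apply in_app_iff. left. apply in_map_iff. exists x.
  split; [reflexivity |]. apply in_seq. lia.
Qed.

Lemma gadget_direct_adj tau v : v < n0 -> adj (gadget tau) v (k * n0 + v) tau.
Proof.
  intros H. left. cbn. rewrite !in_app_iff. right; left. apply in_map_iff. exists v.
  split; [f_equal; f_equal; lia |]. apply in_seq. lia.
Qed.

Lemma LE_lt x y w : In (x, y, w) LE -> x < y < hub.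
Proof.
  intros H. apply hLE in H. unfold hub.
  destruct H as (i & p & q & Hi & Hp & Hq & -> & -> & _). nia.
Qed.

Lemma gadget_adj_lt tau x y w : adj (gadget tau) x y w -> x < S hub.
Proof.
  intros H. apply gadget_adj in H. unfold mate in H.
  destruct H as [[H _] | [[H _] | [H | H]]].
  - lia.
  - unfold hub. nia.
  - apply LE_lt in H. lia.
  - apply LE_lt in H. lia.
Qed.

Lemma gadget_adj_ge tau x y w :
  (tau0 <= tau)%Z -> adj (gadget tau) x y w -> (BIG <= w)%Z.
Proof.
  intros Ht H. apply gadget_adj in H.
  destruct H as [[_ ->] | [[_ ->] | [H | H]]]; try nia;
  apply hLE in H; destruct H as (? & ? & ? & H); lia.
Qed.

Lemma gadget_hub_walk tau x y : x < S hub -> y < S hub ->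
  exists l, walk (gadget tau) x y l /\ (l <= Z.of_nat (k + 1) * BIG)%Z.
Proof.
  intros Hx Hy.
  assert (A : forall z, z < S hub ->
    exists l, walk (gadget tau) z hub l /\ (l <= Z.of_nat (k + 1) * Z0)%Z).
  { intros z Hz. destruct (Nat.eq_dec z hub) as [-> | Hne].
    - exists 0%Z. split; [constructor; cbn; lia | nia].
    - exists (Z.of_nat (k + 1) * Z0 + 0)%Z. split; [| lia].
      econstructor; [apply gadget_star_adj; lia | constructor; cbn; lia]. }
  destruct (A x Hx) as (l1 & W1 & H1). destruct (A y Hy) as (l2 & W2 & H2).
  exists (l1 + l2)%Z. split; [| lia]. eapply walk_app; [exact W1 |].
  apply walk_sym; [| exact W2]. intros ? ? ? Ha. now apply gadget_adj_lt in Ha.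
Qed.

Lemma gadget_connected tau : connected (gadget tau).
Proof.
  intros x y Hx Hy. destruct (gadget_hub_walk tau x y Hx Hy) as (l & H & _). eauto.
Qed.

Section Threshold.
Variable tau : Z.
Hypothesis htau : (tau0 <= tau <= Z.of_nat (k + 1) * BIG)%Z.

Let edge_nonneg x y w : adj (gadget tau) x y w -> (0 <= w)%Z.
Proof. intros H. apply gadget_adj_ge in H; lia. Qed.

(* Every edge weighs at least [BIG], so a walk ending in layer [k] either advances one layer
   per edge or is too heavy to matter. *)
Lemma gadget_walk_to_top x y l v :
  walk (gadget tau) x y l -> v < n0 -> y = k * n0 + v ->
  (x = hub -> Z.of_nat (k + 1) * Z0 <= l)%Z /\
  (forall i p, i <= k -> p < n0 -> x = i * n0 + p ->
     fwd (k - i) x y l \/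
     ((if Nat.eqb i 0 then tau else (Z.of_nat k - Z.of_nat i + 1) * BIG) <= l)%Z).
Proof.
  intros H Hv Hy. induction H as [x Hx | x z y w l Ha Hw IH].
  - split.
    + intros ->. unfold hub in Hy. nia.
    + intros i p Hi Hp E. left. subst x.
      assert (i = k) as -> by (apply (mul_add_inj n0 i k p v); lia).
      rewrite Nat.sub_diag. constructor.
  - specialize (IH Hy). destruct IH as [IH1 IH2].
    pose proof (walk_nonneg _ _ _ _ edge_nonneg Hw) as Hl.
    pose proof (gadget_adj_ge tau x z w ltac:(lia) Ha) as Hge.
    apply gadget_adj in Ha. split.
    + intros ->. destruct Ha as [[_ ->] | [[[[]|[]] _] | [H | H]]].
      * lia.
      * unfold hub in *. nia.
      * unfold hub in *. nia.
      * apply LE_lt in H. lia.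
      * apply LE_lt in H. lia.
    + intros i p Hi Hp E.
      destruct Ha as [[[[? ->]|[? ->]] ->] | [[[[]|[]] ->] | [H | H]]].
      (* Two spokes together weigh [(k + 1) * BIG], which is at least [tau]. *)
      * right. specialize (IH1 eq_refl).
        destruct (Nat.eqb_spec i 0); nia.
      * unfold hub in *. nia.
      * assert (i = 0) as -> by (apply (mul_add_inj n0 i 0 p x); lia).
        right. cbn. lia.
      * assert (i = k) as -> by (apply (mul_add_inj n0 i k p z); lia).
        right. destruct (Nat.eqb_spec k 0); nia.
      * pose proof H as H'. apply hLE in H'.
        destruct H' as (i' & p' & q & Hi' & Hp' & Hq & -> & -> & _).
        assert (i' = i) as -> by (apply (mul_add_inj n0 i' i p' p); lia).
        destruct (IH2 (i + 1) q ltac:(lia) Hq eq_refl) as [IH | IH].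
        -- left. replace (k - i) with (S (k - (i + 1))) by lia. econstructor; eauto.
        -- right. destruct (Nat.eqb_spec (i + 1) 0); [lia |].
           destruct (Nat.eqb_spec i 0); nia.
      * pose proof H as H'. apply hLE in H'.
        destruct H' as (i' & p' & q & Hi' & Hp' & Hq & -> & -> & _).
        assert (i = i' + 1) as -> by (apply (mul_add_inj n0 i (i' + 1) p q); lia).
        right. destruct (Nat.eqb_spec (i' + 1) 0); [lia |].
        destruct (IH2 i' p' ltac:(lia) Hp' eq_refl) as [IH | IH].
        (* A step back from layer [i' + 1] to layer [i'] leaves [k - i'] layers to climb, so the
           walk has at least [k - i' + 1] edges, one more than the bound asks for. *)
        -- apply fwd_ge in IH. rewrite Nat2Z.inj_sub in IH by lia. nia.
        -- destruct (Nat.eqb_spec i' 0); nia.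
Qed.

Lemma gadget_mate_walk v l : v < n0 -> walk (gadget tau) v (k * n0 + v) l ->
  fwd k v (k * n0 + v) l \/ (tau <= l)%Z.
Proof.
  intros Hv H. destruct (gadget_walk_to_top _ _ _ v H Hv eq_refl) as [_ A].
  specialize (A 0 v ltac:(lia) Hv eq_refl). now rewrite Nat.sub_0_r in A.
Qed.

Lemma fwd_walk j x y l : fwd j x y l -> y < S hub -> walk (gadget tau) x y l.
Proof.
  induction 1; intros Hy; [now constructor |].
  econstructor; [| auto]. left. cbn. rewrite !in_app_iff. auto.
Qed.

End Threshold.

Lemma gadget_edge_cases tau x y w : adj (gadget tau) x y w ->
  (forall tau', adj (gadget tau') x y w) \/ ((mate x y \/ mate y x) /\ w = tau).
Proof.
  intros H. unfold adj, gadget in *. cbn [edges] in *.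
  assert (S2 : forall a b z, In (a, b, z) (direct tau) -> mate a b /\ z = tau).
  { intros a b z Hd. apply in_map_iff in Hd. destruct Hd as (x' & Hd & Hx).
    apply in_seq in Hx. inversion Hd; subst. unfold mate. lia. }
  rewrite !in_app_iff in H.
  destruct H as [[H | [H | H]] | [H | [H | H]]]; try (apply S2 in H); try tauto;
  left; intros tau'; rewrite !in_app_iff; tauto.
Qed.

(** Only the direct edges depend on the threshold, so the same sequence of vertices is a walk for
    both values. Distances can thus only grow with the threshold. *)
Lemma gadget_walk_raise tau tau' x y l : (tau' <= tau)%Z -> walk (gadget tau) x y l ->
  exists l', walk (gadget tau') x y l' /\ (l' <= l)%Z.
Proof.
  intros Ht. induction 1 as [x Hx | x z y w l Ha Hw (l' & W' & H')].
  - exists 0%Z. split; [now constructor | lia].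
  - destruct (gadget_edge_cases _ _ _ _ Ha) as [A | [[A | A] ->]].
    + exists (w + l')%Z. split; [econstructor; eauto | lia].
    + exists (tau' + l')%Z. split; [| lia]. destruct A as [A ->].
      econstructor; [apply gadget_direct_adj; exact A | exact W'].
    + exists (tau' + l')%Z. split; [| lia]. destruct A as [A ->].
      econstructor; [apply adj_sym, gadget_direct_adj; exact A | exact W'].
Qed.

(* A walk lighter than the detour through the hub has no room for a direct edge together
   with another edge. *)
Lemma gadget_walk_cheap x y l : walk (gadget tau0) x y l ->
  (l < Z.of_nat (k + 1) * BIG)%Z ->
  (forall tau', walk (gadget tau') x y l) \/ mate x y \/ mate y x.
Proof.
  assert (nn : forall a b z, adj (gadget tau0) a b z -> (0 <= z)%Z).
  { intros a b z H. apply gadget_adj_ge in H; lia. }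
  induction 1 as [x Hx | x z y w l Ha Hw IH]; intros Hl.
  - left. intros. now constructor.
  - pose proof (walk_nonneg _ _ _ _ nn Hw) as Hl0.
    pose proof (gadget_adj_ge tau0 x z w ltac:(lia) Ha) as Hge.
    assert (E : forall a b m, walk (gadget tau0) a b m -> (m < BIG)%Z -> a = b).
    { intros a b m Hm. destruct Hm as [| ? ? ? ? ? Ha' Hm']; [reflexivity |].
      pose proof (walk_nonneg _ _ _ _ nn Hm').
      apply gadget_adj_ge in Ha'; [lia |]. lia. }
    destruct (gadget_edge_cases _ _ _ _ Ha) as [A | [A ->]].
    + destruct (IH ltac:(lia)) as [B | [[B ->] | [B ->]]].
      * left. intros. econstructor; eauto.
      * apply gadget_mate_walk in Hw; [| nia | exact B].
        destruct Hw as [Hw | Hw]; [apply fwd_ge in Hw |]; nia.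
      * apply walk_sym in Hw; [| intros ? ? ? H'; now apply gadget_adj_lt in H'].
        apply gadget_mate_walk in Hw; [| nia | exact B].
        destruct Hw as [Hw | Hw]; [apply fwd_ge in Hw |]; nia.
    + assert (z = y) as <- by (apply (E _ _ _ Hw); nia). tauto.
Qed.

Variable tau : Z.
Hypothesis htau : (tau0 <= tau <= Z.of_nat (k + 1) * BIG)%Z.
Variables d d0 : nat -> nat -> Z.
Hypothesis hd : forall u v, u < S hub -> v < S hub -> is_dist (gadget tau) u v (d u v).
Hypothesis hd0 : forall u v, u < S hub -> v < S hub -> is_dist (gadget tau0) u v (d0 u v).

(** Either the distance at [tau0] is below the cost of the hub detour, and then [gadget_walk_cheap]
    gives a walk without direct edges, which survives at every threshold; or the detour itself is
    shortest, and it does not depend on the threshold. *)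
Lemma gadget_dist_other x y : x < S hub -> y < S hub -> ~ mate x y -> ~ mate y x ->
  d x y = d0 x y.
Proof.
  intros Hx Hy N1 N2. destruct (hd x y Hx Hy) as [H1 H2].
  destruct (hd0 x y Hx Hy) as [H3 H4]. apply Z.le_antisymm.
  - destruct (Z.lt_ge_cases (d0 x y) (Z.of_nat (k + 1) * BIG)) as [Hl | Hl].
    + destruct (gadget_walk_cheap _ _ _ H3 Hl) as [A | [A | A]]; [auto | easy | easy].
    + destruct (gadget_hub_walk tau x y Hx Hy) as (l & W & H). apply H2 in W. lia.
  - destruct (gadget_walk_raise tau tau0 _ _ _ ltac:(lia) H1) as (l' & W & H).
    apply H4 in W. lia.
Qed.

Lemma mate_lt x y : mate x y -> x < S hub /\ y < S hub.
Proof. intros [H ->]. unfold hub. nia. Qed.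

Let dist_sym t e x y : x < S hub -> y < S hub ->
  (forall u v, u < S hub -> v < S hub -> is_dist (gadget t) u v (e u v)) ->
  e x y = e y x.
Proof.
  intros Hx Hy He. apply (is_dist_unique (gadget t) x y); [auto |].
  destruct (He y x Hy Hx) as [H1 H2].
  assert (lt : forall a b z, adj (gadget t) a b z -> a < order (gadget t))
    by (intros ? ? ? H'; now apply gadget_adj_lt in H').
  split; [now apply walk_sym | intros; apply H2; now apply walk_sym].
Qed.

(** A layered walk to the top has [k] edges of weight at least [BIG], so at [tau0] the direct edge
    is never beaten. The reference value therefore carries no information about cycles. *)
Lemma gadget_dist0_mate x y : mate x y -> d0 x y = tau0.
Proof.
  intros H. pose proof (mate_lt _ _ H) as [Hx Hy]. destruct H as [H ->].
  destruct (hd0 x _ Hx Hy) as [H1 H2]. apply Z.le_antisymm.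
  - apply H2, walk_edge; [now apply gadget_direct_adj | exact Hy].
  - apply gadget_mate_walk in H1; [| lia | exact H].
    destruct H1 as [H1 | H1]; [apply fwd_ge in H1 |]; lia.
Qed.

Lemma gadget_dist_mate_le x y : mate x y -> (d x y <= tau)%Z.
Proof.
  intros H. pose proof (mate_lt _ _ H) as [Hx Hy]. destruct H as [H ->].
  destruct (hd x _ Hx Hy) as [H1 H2].
  apply H2, walk_edge; [now apply gadget_direct_adj | exact Hy].
Qed.

Definition mateb (x y : nat) : bool :=
  if x <? n0 then k * n0 + x =? y
  else if k * n0 <=? x then (if x <? hub then x - k * n0 =? y else false) else false.

Lemma mateb_spec x y : mateb x y = true <-> mate x y \/ mate y x.
Proof.
  unfold mateb, mate, hub.
  destruct (Nat.ltb_spec x n0); [rewrite Nat.eqb_eq; nia |].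
  destruct (Nat.leb_spec (k * n0) x); [| split; [easy | nia]].
  destruct (Nat.ltb_spec x ((k + 1) * n0)); [rewrite Nat.eqb_eq; nia | split; [easy | nia]].
Qed.

Lemma sum_upto_range a b N : a <= b ->
  sum_upto (fun x => if Nat.leb a x then if Nat.ltb x b then 1 else 0 else 0)%Z N
  = (Z.of_nat (Nat.min N b) - Z.of_nat (Nat.min N a))%Z.
Proof.
  intros Hab. induction N as [| N IH]; [cbn; lia |]. rewrite sum_upto_S, IH.
  destruct (Nat.leb_spec a N), (Nat.ltb_spec N b); lia.
Qed.

(** The [n0] pairs count once in each order; since [k] is positive, the bottom and top layers are
    disjoint. *)
Lemma mateb_count :
  sum_upto (fun x => sum_upto (fun y => if mateb x y then 1 else 0)%Z (S hub)) (S hub)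
  = (2 * Z.of_nat n0)%Z.
Proof.
  (* The double negation turns a sum of two indicators into a difference, the shape that
     [sum_upto_sub] splits. *)
  rewrite (sum_upto_ext _ (fun x => (if Nat.leb 0 x then if Nat.ltb x n0 then 1 else 0 else 0)
    - - (if Nat.leb (k * n0) x then if Nat.ltb x hub then 1 else 0 else 0))%Z).
  - rewrite sum_upto_sub.
    rewrite (sum_upto_ext (fun i => - _)%Z
      (fun x => (if Nat.leb (k * n0) x then if Nat.ltb x hub then 1 else 0 else 0) * -1)%Z)
      by (intros; lia).
    rewrite sum_upto_scale, !sum_upto_range by (unfold hub; nia).
    unfold hub. nia.
  - intros x Hx. unfold mateb. cbn [Nat.leb].
    destruct (Nat.ltb_spec x n0).
    + rewrite sum_upto_point.
      destruct (Nat.ltb_spec (k * n0 + x) (S hub)); [| unfold hub in *; nia].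
      destruct (Nat.leb_spec (k * n0) x); [nia | lia].
    + destruct (Nat.leb_spec (k * n0) x); [| rewrite sum_upto_const; lia].
      destruct (Nat.ltb_spec x hub); [| rewrite sum_upto_const; lia].
      rewrite sum_upto_point.
      destruct (Nat.ltb_spec (x - k * n0) (S hub)); lia.
Qed.

Let total e := sum_upto (fun x => sum_upto (fun y => e x y) (S hub)) (S hub).

Lemma gadget_diff_le x y : x < S hub -> y < S hub ->
  (d x y - d0 x y <= (if mateb x y then 1 else 0) * (tau - tau0))%Z.
Proof.
  intros Hx Hy. pose proof (mateb_spec x y) as M. destruct (mateb x y).
  - destruct (proj1 M eq_refl) as [H | H].
    + rewrite (gadget_dist0_mate _ _ H). pose proof (gadget_dist_mate_le _ _ H). lia.
    + rewrite (dist_sym _ _ x y Hx Hy hd), (dist_sym _ _ x y Hx Hy hd0).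
      rewrite (gadget_dist0_mate _ _ H). pose proof (gadget_dist_mate_le _ _ H). lia.
  - rewrite gadget_dist_other; [lia | assumption | assumption | |];
      intros H; now assert (false = true) by tauto.
Qed.

Let total_diff : total d = (total d0 +
   sum_upto (fun x => sum_upto (fun y => d x y - d0 x y) (S hub)) (S hub))%Z.
Proof.
  unfold total. rewrite (sum_upto_ext (fun x => sum_upto (fun y => d x y - d0 x y)%Z (S hub))
    (fun x => sum_upto (fun y => d x y) (S hub) - sum_upto (fun y => d0 x y) (S hub))%Z).
  - rewrite sum_upto_sub. lia.
  - intros. apply sum_upto_sub.
Qed.

Let total_mates :
  sum_upto (fun x => sum_upto
    (fun y => (if mateb x y then 1 else 0) * (tau - tau0))%Z (S hub)) (S hub)
  = (2 * Z.of_nat n0 * (tau - tau0))%Z.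
Proof.
  rewrite <- mateb_count, <- sum_upto_scale. apply sum_upto_ext. intros.
  apply sum_upto_scale.
Qed.

Lemma gadget_total_le : (total d - total d0 <= 2 * Z.of_nat n0 * (tau - tau0))%Z.
Proof.
  rewrite total_diff, <- total_mates.
  match goal with |- (?a + ?b - ?a <= _)%Z => replace (a + b - a)%Z with b by lia end.
  apply sum_upto_le. intros. apply sum_upto_le. intros. now apply gadget_diff_le.
Qed.

Lemma gadget_total_eq :
  (forall v l, v < n0 -> fwd k v (k * n0 + v) l -> (tau <= l)%Z) ->
  (total d - total d0 = 2 * Z.of_nat n0 * (tau - tau0))%Z.
Proof.
  intros Hf. rewrite total_diff, <- total_mates.
  match goal with |- (?a + ?b - ?a = _)%Z => replace (a + b - a)%Z with b by lia end.
  apply sum_upto_ext. intros x Hx. apply sum_upto_ext. intros y Hy.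
  pose proof (mateb_spec x y) as M.
  assert (K : forall a b, mate a b -> d a b = tau).
  { intros a b H. apply Z.le_antisymm; [now apply gadget_dist_mate_le |].
    pose proof (mate_lt _ _ H) as [Ha Hb]. destruct H as [H ->].
    destruct (hd a _ Ha Hb) as [H1 _].
    apply gadget_mate_walk in H1; [| exact htau | exact H].
    destruct H1 as [H1 | H1]; [exact (Hf _ _ H H1) | exact H1]. }
  destruct (mateb x y).
  - destruct (proj1 M eq_refl) as [H | H].
    + rewrite (gadget_dist0_mate _ _ H), (K _ _ H). lia.
    + rewrite (dist_sym _ _ x y Hx Hy hd), (dist_sym _ _ x y Hx Hy hd0).
      rewrite (gadget_dist0_mate _ _ H), (K _ _ H). lia.
  - rewrite gadget_dist_other; [lia | assumption | assumption | |];
      intros H; now assert (false = true) by tauto.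
Qed.

(** The mate pair of the cheap walk falls short of its maximal increase, and by [gadget_diff_le] no
    other pair can make up for it. *)
Lemma gadget_total_lt v l :
  v < n0 -> fwd k v (k * n0 + v) l -> (l < tau)%Z ->
  (total d - total d0 < 2 * Z.of_nat n0 * (tau - tau0))%Z.
Proof.
  intros Hv Hf Hl. rewrite total_diff, <- total_mates.
  match goal with |- (?a + ?b - ?a < _)%Z => replace (a + b - a)%Z with b by lia end.
  assert (H : mate v (k * n0 + v)) by (split; auto).
  pose proof (mate_lt _ _ H) as [Hx Hy].
  apply sum_upto_lt with v; [| exact Hx |].
  - intros. apply sum_upto_le. intros. now apply gadget_diff_le.
  - apply sum_upto_lt with (k * n0 + v); [| exact Hy |].
    + intros. now apply gadget_diff_le.
    + rewrite (proj2 (mateb_spec v (k * n0 + v))) by auto.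
      rewrite (gadget_dist0_mate _ _ H).
      destruct (hd v _ Hx Hy) as [_ H2].
      specialize (H2 l (fwd_walk tau _ _ _ _ Hf Hy)). lia.
Qed.

End Gadget.

(** * Encoding the parameters in one number *)

Lemma digits_exist (D : nat) (g : nat -> nat) k :
  (forall i, i < k -> g i < D) ->
  exists a, a < D ^ k /\ forall i, i < k -> (a / D ^ i) mod D = g i.
Proof.
  revert g; induction k as [| k IH]; intros g Hg.
  - exists 0. cbn. split; [lia | intros; lia].
  - destruct (IH (fun i => g (S i)) ltac:(intros; apply Hg; lia)) as (a & Ha & Hd).
    pose proof (Hg 0 ltac:(lia)) as H0.
    exists (g 0 + D * a). split; [cbn; nia |].
    intros [| i] Hi.
    + cbn [Nat.pow]. rewrite Nat.div_1_r, (Nat.mul_comm D a), Nat.Div0.mod_add. now apply Nat.mod_small.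
    + rewrite <- Hd by lia. cbn [Nat.pow].
      rewrite <- Nat.Div0.div_div, (Nat.mul_comm D a), Nat.div_add by lia.
      rewrite (Nat.div_small (g 0)) by exact H0. reflexivity.
Qed.

Lemma list_sum_map_le {A} (f g : A -> nat) l :
  (forall i, f i <= g i) -> list_sum (map f l) <= list_sum (map g l).
Proof.
  intros H. unfold list_sum. induction l as [| i l IH]; cbn; [lia |].
  specialize (H i). lia.
Qed.

Lemma list_sum_map_add {A} (f g : A -> nat) l :
  list_sum (map (fun i => f i + g i) l) = list_sum (map f l) + list_sum (map g l).
Proof. unfold list_sum. induction l as [| i l IH]; cbn; lia. Qed.

Lemma list_sum_map_const {A} (a : nat) (l : list A) :
  list_sum (map (fun _ => a) l) = length l * a.
Proof. unfold list_sum. induction l as [| i l IH]; cbn; lia. Qed.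

(** For [h < c], the number of integers below [m] congruent to [h] is [(m + (c - 1 - h)) / c]; this
    is the inductive step of that count, as an upper bound. *)
Lemma residue_count_step (c h m : nat) : 0 < c ->
  (m + (c - 1 - h)) / c + (if m mod c =? h then 1 else 0) <= (S m + (c - 1 - h)) / c.
Proof.
  intros Hc. destruct (Nat.eqb_spec (m mod c) h) as [E | E].
  - pose proof (Nat.mod_upper_bound m c ltac:(lia)). pose proof (Nat.div_mod_eq m c).
    rewrite <- (Nat.div_unique (m + (c - 1 - h)) c (m / c) (c - 1)) by nia.
    rewrite <- (Nat.div_unique (S m + (c - 1 - h)) c (m / c + 1) 0) by nia. lia.
  - rewrite Nat.add_0_r. apply Nat.Div0.div_le_mono. lia.
Qed.

(** * Layered graphs of a digraph and the threshold test for cheap cycles *)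

Section Layering.
Variables (k c U n : nat) (W0 : Z) (E : list (nat * nat * Z)).

(** [lV] bounds every modulus [lmu j], hence all residues. One digit in base [lD] packs a vertex
    residue with an edge residue, and a code below [lQ] consists of a modulus and one such digit for
    each layer. *)
Definition lV : nat := c * U.
Definition lD : nat := lV * c.
Definition lQ : nat := U * lD ^ k.
Definition ln0 : nat := n / c + 1.
Definition lY : nat := n + 1.
Definition lX : Z := Z.of_nat (lY ^ k).
(** The weights of a [k]-cycle, shifted by [W0] to be nonnegative, sum to at most [2 * k * W0], and
    the vertex names fill less than one unit of [lX]. So the cost of a cycle beyond its [k] edge
    offsets [2 * lZ0] stays below [lZ0]. *)
Definition lZ0 : Z := ((2 * Z.of_nat k * W0 + 1) * lX)%Z.
(** The modulus [j mod U + 1] is responsible for separation, which survives multiplication by [c]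
    ([mod_mul_neq]). The factor [c] makes the layers small: quotients by [lmu j] are below
    [n / c + 1]. *)
Definition lmu (j : nat) : nat := c * (j mod U + 1).
Definition digit (j i : nat) : nat := (j / U / lD ^ i) mod lD.
Definition res (j i : nat) : nat := digit j i mod lV.
Definition hres (j i : nat) : nat := digit j i / lV.

(** Zero stands for no layer. When several layers ask for the same residue the last one wins, so a
    vertex has at most one layer under every code, even a useless one. *)
Fixpoint layf (r : nat -> nat) (i y : nat) : nat :=
  match i with
  | 0 => 0
  | S i' => if y =? r i' then S i' else layf r i' y
  end.

Definition lay (j : nat) : nat -> nat := layf (res j) k.

(** The target must lie in layer [S i mod k] but is numbered in layer [S i]: for the last step these
    are layer 0 and its copy, layer [k]. The summand [u * lY ^ i] writes the name of the source into
    digit [i] of the cost. *)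
Definition ledge (j e : nat) : list (nat * nat * Z) :=
  match nth_error E e with
  | None => []
  | Some (u, v, w) =>
      match lay j (u mod lmu j) with
      | 0 => []
      | S i =>
          if (lay j (v mod lmu j) =? S i mod k + 1) && (hres j i =? e mod c)
          then [(i * ln0 + u / lmu j, S i * ln0 + v / lmu j,
                 (2 * lZ0 + ((w + W0) * lX + Z.of_nat (u * lY ^ i)))%Z)]
          else []
      end
  end.

Definition layered (j m : nat) : list (nat * nat * Z) := flat_map (ledge j) (seq 0 m).

Lemma layered_S j m : layered j (S m) = layered j m ++ ledge j m.
Proof. unfold layered. rewrite seq_S, flat_map_app. cbn. now rewrite app_nil_r. Qed.

Definition ledge_spec j e x y z u v w i : Prop :=
  nth_error E e = Some (u, v, w) /\ lay j (u mod lmu j) = S i /\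
  lay j (v mod lmu j) = S i mod k + 1 /\ hres j i = e mod c /\
  x = i * ln0 + u / lmu j /\ y = S i * ln0 + v / lmu j /\
  z = (2 * lZ0 + ((w + W0) * lX + Z.of_nat (u * lY ^ i)))%Z.

Lemma in_ledge j e x y z : In (x, y, z) (ledge j e) <->
  exists u v w i, ledge_spec j e x y z u v w i.
Proof.
  unfold ledge, ledge_spec. split.
  - destruct (nth_error E e) as [[[u v] w] |] eqn:En; [| easy].
    destruct (lay j (u mod lmu j)) as [| i] eqn:El; [easy |].
    destruct (Nat.eqb_spec (lay j (v mod lmu j)) (S i mod k + 1)) as [E1 | E1]; [| easy].
    destruct (Nat.eqb_spec (hres j i) (e mod c)) as [E2 | E2]; [| easy].
    cbn [andb]. intros [H | []]. inversion H; subst.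
    exists u, v, w, i. repeat split; auto.
  - intros (u & v & w & i & En & El & E1 & E2 & -> & -> & ->).
    rewrite En, El, E1, E2, !Nat.eqb_refl. now left.
Qed.

Lemma in_layered j m x y z : In (x, y, z) (layered j m) <->
  exists e u v w i, e < m /\ ledge_spec j e x y z u v w i.
Proof.
  unfold layered. rewrite in_flat_map. split.
  - intros (e & He & H). apply in_seq in He. apply in_ledge in H.
    destruct H as (u & v & w & i & H). exists e, u, v, w, i. split; [lia | exact H].
  - intros (e & u & v & w & i & He & H). exists e. split; [apply in_seq; lia |].
    apply in_ledge. eauto.
Qed.

Lemma layf_inv r i y i' : layf r i y = S i' -> i' < i /\ r i' = y.
Proof.
  induction i as [| i IH]; cbn; [easy |].
  destruct (Nat.eqb_spec y (r i)) as [-> | Hne]; intros H.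
  - injection H as <-. auto.
  - apply IH in H. destruct H. split; [lia | assumption].
Qed.

Lemma layf_inj r i i' : i' < i -> (forall i1, i1 < i -> r i1 = r i' -> i1 = i') ->
  layf r i (r i') = S i'.
Proof.
  induction i as [| i IH]; intros Hi Hr; [lia |]. cbn.
  destruct (Nat.eqb_spec (r i') (r i)) as [He | Hne].
  - f_equal. apply Hr; [lia | now symmetry].
  - apply IH; [| intros; apply Hr; auto]. enough (i' <> i) by lia. congruence.
Qed.

Lemma lay_le j y : lay j y <= k.
Proof.
  destruct (lay j y) as [| i] eqn:H; [lia |]. apply layf_inv in H. lia.
Qed.

Hypothesis hk : 0 < k.
Hypothesis hc : 0 < c.
Hypothesis hU : 0 < U.
Hypothesis hW0 : (0 <= W0)%Z.
Hypothesis hG : simple_digraph (WGraph n E).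
Hypothesis hW : forall a w, In (a, w) E -> (Z.abs w <= W0)%Z.

Lemma lX_pos : (0 < lX)%Z.
Proof. unfold lX, lY. pose proof (Nat.pow_nonzero (n + 1) k). lia. Qed.

Lemma lZ0_pos : (0 < lZ0)%Z.
Proof. unfold lZ0. pose proof lX_pos. nia. Qed.

Lemma lmu_pos j : 0 < lmu j.
Proof. unfold lmu. nia. Qed.

Lemma label_lt j u : u < n -> u / lmu j < ln0.
Proof.
  intros Hu. unfold ln0, lmu.
  rewrite <- Nat.Div0.div_div.
  pose proof (Nat.Div0.div_le_mono u n c ltac:(lia)).
  pose proof (Nat.Div0.div_le_upper_bound (u / c) (j mod U + 1) (u / c) ltac:(nia)).
  lia.
Qed.

Lemma edge_lt u v w : In (u, v, w) E -> u < n /\ v < n /\ u <> v.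
Proof. apply hG. Qed.

Lemma lay_vertex j u i : lay j (u mod lmu j) = S i ->
  i < k /\ u = u / lmu j * lmu j + res j i.
Proof.
  intros H. apply layf_inv in H. destruct H as [H1 H2]. split; [exact H1 |].
  rewrite H2. pose proof (Nat.div_mod_eq u (lmu j)). lia.
Qed.

Lemma step_weight_bounds u i w : u < n -> i < k -> (Z.abs w <= W0)%Z ->
  (0 <= (w + W0) * lX + Z.of_nat (u * lY ^ i) <= lZ0)%Z.
Proof.
  intros Hu Hi Hw. unfold lZ0. pose proof lX_pos.
  assert (Z.of_nat (u * lY ^ i) <= lX)%Z.
  { unfold lX. apply inj_le.
    replace k with (i + 1 + (k - i - 1)) by lia.
    rewrite !Nat.pow_add_r, Nat.pow_1_r.
    assert (1 <= lY ^ (k - i - 1)) by (pose proof (Nat.pow_nonzero lY (k - i - 1)); unfold lY in *; lia).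
    unfold lY in *. nia. }
  split; [nia |]. nia.
Qed.

Lemma layered_spec j m x y z : In (x, y, z) (layered j m) ->
  exists i p q, i < k /\ p < ln0 /\ q < ln0 /\ x = i * ln0 + p /\ y = (i + 1) * ln0 + q
    /\ (2 * lZ0 <= z <= 3 * lZ0)%Z.
Proof.
  intros H. apply in_layered in H.
  destruct H as (e & u & v & w & i & He & En & El & _ & _ & -> & -> & ->).
  apply nth_error_In in En. pose proof (hW _ _ En) as Hw.
  apply edge_lt in En. destruct En as (Hu & Hv & _).
  apply lay_vertex in El. destruct El as [Hi _].
  exists i, (u / lmu j), (v / lmu j).
  repeat split; auto using label_lt; try lia;
  pose proof (step_weight_bounds u i w Hu Hi Hw); lia.
Qed.

Lemma layered_edge j m x y z : In (x, y, z) (layered j m) ->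
  exists i p q, i < k /\ p < ln0 /\ q < ln0 /\ x = i * ln0 + p /\ y = (i + 1) * ln0 + q
    /\ (2 * lZ0 <= z)%Z.
Proof.
  intros H. apply layered_spec in H. destruct H as (i & p & q & H).
  exists i, p, q. repeat split; try tauto; lia.
Qed.

(** The layer of its source leaves an edge at most one copy, and layer [i] admits only the edges
    whose index is congruent to [hres j i]. So each layer contributes at most [m / c + 1] edges. *)
Lemma length_layered j m : length (layered j m) <= k * (m / c + 1).
Proof.
  assert (L1 : forall e, length (ledge j e) <=
    list_sum (map (fun i => if e mod c =? hres j i then 1 else 0) (seq 0 k))).
  { intros e. unfold ledge. destruct (nth_error E e) as [[[u v] w] |]; [| cbn; lia].
    destruct (lay j (u mod lmu j)) as [| i] eqn:El; [cbn; lia |].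
    destruct (_ =? S i mod k + 1); [| cbn; lia].
    destruct (Nat.eqb_spec (hres j i) (e mod c)) as [E2 | E2]; [| cbn; lia].
    cbn [andb length]. apply layf_inv in El. destruct El as [Hi _].
    replace k with (i + S (k - i - 1)) by lia.
    rewrite seq_app, map_app, list_sum_app. cbn. rewrite E2, Nat.eqb_refl. lia. }
  assert (L2 : length (layered j m) <=
    list_sum (map (fun i => (m + (c - 1 - hres j i)) / c) (seq 0 k))).
  { induction m as [| m IH]; [cbn; lia |].
    rewrite layered_S, length_app. specialize (L1 m).
    eapply Nat.le_trans; [apply (Nat.add_le_mono _ _ _ _ IH L1) |].
    rewrite <- list_sum_map_add. apply list_sum_map_le. intros i.
    now apply residue_count_step. }
  eapply Nat.le_trans; [exact L2 |].
  replace k with (length (seq 0 k)) at 2 by apply length_seq. rewrite <- list_sum_map_const.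
  apply list_sum_map_le. intros i. rewrite <- Nat.div_add by lia.
  apply Nat.Div0.div_le_mono. lia.
Qed.

Lemma vertex_eq j u u' : u / lmu j = u' / lmu j -> u mod lmu j = u' mod lmu j -> u = u'.
Proof.
  intros H1 H2. rewrite (Nat.div_mod_eq u (lmu j)), (Nat.div_mod_eq u' (lmu j)). congruence.
Qed.

Lemma lay_inj j y y' i : lay j y = S i -> lay j y' = S i -> y = y'.
Proof. intros H1 H2. apply layf_inv in H1, H2. destruct H1, H2. congruence. Qed.

(** The endpoints reveal the layer and both quotients, and the layer reveals the residues. So the
    original arc can be recovered and, the digraph being simple, also its index. *)
Lemma layered_nodup j m : NoDup (map fst (layered j m)).
Proof.
  induction m as [| m IH]; [constructor |].
  rewrite layered_S, map_app.
  assert (L : ledge j m = [] \/ exists a, ledge j m = [a]).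
  { unfold ledge. destruct (nth_error E m) as [[[u v] w] |]; [| auto].
    destruct (lay j (u mod lmu j)) as [| i]; [auto |].
    destruct (_ && _); eauto. }
  destruct L as [L | [((x, y), z) L]]; rewrite L; cbn; [now rewrite app_nil_r |].
  apply NoDup_app; [exact IH | constructor; [easy | constructor] |].
  intros (x', y') Hin [H | []]. injection H as <- <-.
  apply in_map_iff in Hin. destruct Hin as (((x', y'), z') & H & Hin).
  cbn in H. injection H as -> ->.
  apply in_layered in Hin. destruct Hin as (e & u' & v' & w' & i' & He & Sp').
  assert (Hin : In (x, y, z) (ledge j m)) by (rewrite L; now left).
  apply in_ledge in Hin. destruct Hin as (u & v & w & i & Sp).
  destruct Sp as (En & El & El' & _ & Ex & Ey & _).
  destruct Sp' as (En' & Fl & Fl' & _ & Ex' & Ey' & _).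
  pose proof (edge_lt _ _ _ (nth_error_In _ _ En)) as (Hu & Hv & _).
  pose proof (edge_lt _ _ _ (nth_error_In _ _ En')) as (Hu' & Hv' & _).
  destruct (mul_add_inj ln0 i i' (u / lmu j) (u' / lmu j)) as [<- Hq];
    [now apply label_lt | now apply label_lt | congruence |].
  destruct (mul_add_inj ln0 (S i) (S i) (v / lmu j) (v' / lmu j)) as [_ Hq'];
    [now apply label_lt | now apply label_lt | congruence |].
  assert (u = u') as <- by (apply (vertex_eq j); [assumption | eapply lay_inj; eassumption]).
  assert (v = v') as <-.
  { apply (vertex_eq j); [assumption |].
    rewrite Nat.add_1_r in El', Fl'. eapply lay_inj; eassumption. }
  destruct hG as [_ ND]. cbn in ND.
  assert (e = m); [| lia].
  apply (proj1 (NoDup_nth_error (map fst E)) ND).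
  - rewrite length_map. apply nth_error_Some. congruence.
  - rewrite !nth_error_map, En, En'. reflexivity.
Qed.

Notation Hg j := (gadget k ln0 lZ0 (layered j (length E))).

Lemma gadget_edges_ordered j tau x y z : In (x, y, z) (edges (Hg j tau)) ->
  x < y < S (hub k ln0).
Proof.
  cbn. rewrite !in_app_iff. intros [H | [H | H]].
  - apply in_map_iff in H. destruct H as (v & H & Hv). apply in_seq in Hv.
    inversion H; subst. lia.
  - apply in_map_iff in H. destruct H as (v & H & Hv). apply in_seq in Hv.
    inversion H; subst. unfold hub. nia.
  - apply (LE_lt _ _ _ _ hk (layered_edge j (length E))) in H. lia.
Qed.

Lemma gadget_simple j tau : simple_graph (Hg j tau).
Proof.
  split; [split |].
  - intros u v w H. apply gadget_edges_ordered in H. cbn. lia.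
  - cbn. rewrite !map_app.
    assert (S0 : forall (F : nat -> nat) (w : Z) m,
      NoDup (map fst (map (fun x => (x, F x, w)) (seq 0 m)))).
    { intros F w m. rewrite map_map. cbn.
      apply FinFun.Injective_map_NoDup; [| apply seq_NoDup].
      intros a b H. now injection H. }
    apply NoDup_app; [apply S0 | apply NoDup_app; [apply S0 | apply layered_nodup |] |].
    + intros (x, y) H1 H2. apply in_map_iff in H1, H2.
      destruct H1 as (((x1, y1), z1) & H & H1). cbn in H. injection H as -> ->.
      destruct H2 as (((x2, y2), z2) & H & H2). cbn in H. injection H as -> ->.
      apply in_map_iff in H1. destruct H1 as (v & H & Hv). apply in_seq in Hv.
      inversion H; subst x y z1.
      apply in_layered in H2.
      destruct H2 as (e & u' & v' & w' & i & He & En & El & El' & _ & Ex & Ey & _).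
      pose proof (edge_lt _ _ _ (nth_error_In _ _ En)) as (Hu & Hv' & Hne).
      pose proof (label_lt j u' Hu). pose proof (label_lt j v' Hv').
      destruct (mul_add_inj ln0 0 i v (u' / lmu j)) as [<- E1]; [lia | lia | lia |].
      (* A layered edge climbs one layer and a direct edge climbs [k]. They can coincide only for
         [k = 1], and then the original arc would be a loop. *)
      destruct (mul_add_inj ln0 k 1 v (v' / lmu j)) as [E3 E2]; [lia | lia | lia |].
      apply Hne, (vertex_eq j); [congruence |].
      rewrite E3 in El'. cbn in El'. eapply lay_inj; eassumption.
    + intros (x, y) H1 H2. rewrite in_app_iff in H2.
      apply in_map_iff in H1. destruct H1 as (((x1, y1), z1) & H & H1).
      cbn in H. injection H as -> ->.
      apply in_map_iff in H1. destruct H1 as (v & H & Hv). inversion H; subst x y z1.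
      destruct H2 as [H2 | H2]; apply in_map_iff in H2;
        destruct H2 as (((x2, y2), z2) & H' & H2); cbn in H'; injection H' as -> ->.
      * apply in_map_iff in H2. destruct H2 as (v' & H' & Hv'). apply in_seq in Hv'.
        inversion H'; subst. unfold hub in *. nia.
      * apply (LE_lt _ _ _ _ hk (layered_edge j (length E))) in H2. lia.
  - intros u v w w' H1 H2. apply gadget_edges_ordered in H1, H2. lia.
Qed.

Lemma gadget_weights j tau a w :
  (Z.of_nat k * (2 * lZ0) <= tau <= Z.of_nat (k + 1) * (2 * lZ0))%Z ->
  In (a, w) (edges (Hg j tau)) -> (0 <= w <= Z.of_nat (k + 1) * (2 * lZ0))%Z.
Proof.
  pose proof lZ0_pos. intros Ht. destruct a as [x y]. cbn [edges gadget].
  rewrite !in_app_iff.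
  intros [H' | [H' | H']].
  - apply in_map_iff in H'. destruct H' as (v & H' & _). injection H' as _ _ <-. nia.
  - apply in_map_iff in H'. destruct H' as (v & H' & _). injection H' as _ _ <-. nia.
  - apply layered_spec in H'. destruct H' as (i & p & q & H'). nia.
Qed.

Lemma gadget_instance j tau :
  (Z.of_nat k * (2 * lZ0) <= tau <= Z.of_nat (k + 1) * (2 * lZ0))%Z ->
  wiener_instance (Hg j tau).
Proof.
  intros Ht. split; [apply gadget_simple |]. split.
  - intros a w H. apply gadget_weights in H; [lia | exact Ht].
  - exact (gadget_connected _ _ _ _ hk lZ0_pos (layered_edge j (length E)) tau).
Qed.

(** This is a layered walk told in terms of the original vertices. The argument [z] is the vertex
    after the last one, so that [hd z us'] is the successor at every position, the closing arc
    included. *)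
Fixpoint lchain (j i : nat) (us : list nat) (z : nat) (ws : list Z) : Prop :=
  match us, ws with
  | [], [] => True
  | u :: us', w :: ws' =>
      lay j (u mod lmu j) = S i /\
      (exists e, nth_error E e = Some (u, hd z us', w) /\ hres j i = e mod c) /\
      lchain j (S i) us' z ws'
  | _, _ => False
  end.

Fixpoint ctot (i : nat) (us : list nat) (ws : list Z) : Z :=
  match us, ws with
  | u :: us', w :: ws' =>
      ((w + W0) * lX + Z.of_nat (u * lY ^ i) + ctot (S i) us' ws')%Z
  | _, _ => 0%Z
  end.

Notation Fwd j := (fwd (layered j (length E))).

(** Layer [k] copies layer 0, so label [v] there names the vertex [v * lmu j + res j 0]. Writing
    [res j (i mod k)] makes the same formula valid at the top, where the list is empty and [hd]
    returns the closing vertex. *)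
Lemma lchain_of_fwd j m x y l : Fwd j m x y l ->
  forall i p v, i + m = k -> p < ln0 -> v < ln0 -> x = i * ln0 + p -> y = k * ln0 + v ->
  exists us ws, length us = m /\ lchain j i us (v * lmu j + res j 0) ws /\
    hd (v * lmu j + res j 0) us = p * lmu j + res j (i mod k) /\
    l = (Z.of_nat m * (2 * lZ0) + ctot i us ws)%Z.
Proof.
  induction 1 as [x | m x y z w l Hin _ IH]; intros i p v Hi Hp Hv Ex Ey.
  - exists [], []. rewrite Nat.add_0_r in Hi. subst i.
    assert (p = v) as -> by (apply (mul_add_inj ln0 k k p v); congruence).
    cbn. rewrite Nat.Div0.mod_same. repeat split.
  - apply in_layered in Hin.
    destruct Hin as (e & u & v' & w' & i' & He & En & El & El' & Eh & Ex' & Ey' & Ew).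
    pose proof (edge_lt _ _ _ (nth_error_In _ _ En)) as (Hu & Hv' & _).
    destruct (mul_add_inj ln0 i' i (u / lmu j) p) as [-> Eu];
      [now apply label_lt | exact Hp | congruence |].
    destruct (IH (S i) (v' / lmu j) v) as (us & ws & Hl & Hch & Hhd & ->);
      [lia | now apply label_lt | exact Hv | exact Ey' | exact Ey |].
    rewrite Nat.add_1_r in El'.
    pose proof (lay_vertex j v' _ El') as [_ Ev'].
    rewrite <- Ev' in Hhd.
    pose proof (lay_vertex j u _ El) as [Hik Eu'].
    exists (u :: us), (w' :: ws). cbn [length lchain hd ctot]. repeat split.
    + congruence.
    + exact El.
    + exists e. rewrite Hhd. auto.
    + exact Hch.
    + rewrite Nat.mod_small by exact Hik. rewrite <- Eu. exact Eu'.
    + rewrite Ew. lia.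
Qed.

Lemma fwd_of_lchain j us : forall i z ws, lchain j i us z ws -> i + length us = k ->
  lay j (z mod lmu j) = 1 ->
  Fwd j (length us) (i * ln0 + hd z us / lmu j) (k * ln0 + z / lmu j)
    (Z.of_nat (length us) * (2 * lZ0) + ctot i us ws)%Z.
Proof.
  induction us as [| u us IH]; intros i z [| w ws] H Hi Hz; try easy.
  - cbn in *. rewrite Nat.add_0_r in Hi. subst i. constructor.
  - cbn [lchain length hd ctot] in *. destruct H as (El & (e & En & Eh) & Hch).
    specialize (IH (S i) z ws Hch ltac:(lia) Hz).
    replace (Z.of_nat (S (length us)) * (2 * lZ0) +
      ((w + W0) * lX + Z.of_nat (u * lY ^ i) + ctot (S i) us ws))%Z with
      ((2 * lZ0 + ((w + W0) * lX + Z.of_nat (u * lY ^ i))) +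
       (Z.of_nat (length us) * (2 * lZ0) + ctot (S i) us ws))%Z by lia.
    econstructor; [| exact IH].
    apply in_layered. exists e, u, (hd z us), w, i.
    split; [apply nth_error_Some; congruence |].
    repeat split; auto.
    destruct us as [| u' us].
    + cbn in *. rewrite Nat.add_1_r in Hi. rewrite Hi, Nat.Div0.mod_same. exact Hz.
    + cbn in *. destruct ws; [easy |]. destruct Hch as [Hl _]. rewrite Hl.
      rewrite Nat.mod_small by lia. lia.
Qed.

Definition kcyc (us : list nat) (ws : list Z) : Prop :=
  length us = k /\ NoDup us /\ Forall2 (fun a x => In (a, x) E) (arcs us) ws.

Fixpoint chain (us : list nat) (z : nat) (ws : list Z) : Prop :=
  match us, ws with
  | [], [] => True
  | u :: us', w :: ws' => In (u, hd z us', w) E /\ chain us' z ws'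
  | _, _ => False
  end.

Lemma chain_arcs us z : forall ws,
  Forall2 (fun a x => In (a, x) E) (combine us (tl us ++ [z])) ws <-> chain us z ws.
Proof.
  induction us as [| u us IH]; intros ws.
  - cbn. split; intros H; [inversion H; subst; exact I | destruct ws; [constructor | easy]].
  - replace (combine (u :: us) (tl (u :: us) ++ [z]))
      with ((u, hd z us) :: combine us (tl us ++ [z])) by (destruct us; reflexivity).
    split.
    + intros H. inversion H; subst. cbn. split; [assumption | now apply IH].
    + destruct ws as [| w ws]; [easy |]. cbn. intros [H1 H2].
      constructor; [exact H1 | now apply IH].
Qed.

Lemma kcyc_chain us ws :
  kcyc us ws <-> length us = k /\ NoDup us /\ chain us (hd 0 us) ws.
Proof.
  unfold kcyc, arcs. destruct us as [| u us].
  - split; intros [H _]; cbn in H; lia.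
  - rewrite <- chain_arcs. reflexivity.
Qed.

Lemma lchain_chain j us : forall i z ws, lchain j i us z ws -> chain us z ws.
Proof.
  induction us as [| u us IH]; intros i z [| w ws] H; cbn in *; try easy.
  destruct H as (_ & (e & En & _) & H). split; [now apply nth_error_In in En | eauto].
Qed.

Lemma lchain_layer j us : forall i z ws, lchain j i us z ws ->
  forall u, In u us -> exists t, i <= t /\ lay j (u mod lmu j) = S t.
Proof.
  induction us as [| u us IH]; intros i z [| w ws] H; cbn in *; try easy.
  destruct H as (El & _ & H). intros u' [<- | Hin]; [eauto |].
  destruct (IH _ _ _ H u' Hin) as (t & Ht & E'). exists t. split; [lia | exact E'].
Qed.

(** The layers strictly increase along the chain and no vertex lies in two layers. This is why a
    closed layered walk of any gadget is simple, without any check. *)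
Lemma lchain_nodup j us : forall i z ws, lchain j i us z ws -> NoDup us.
Proof.
  induction us as [| u us IH]; intros i z [| w ws] H; cbn in *; try easy; [constructor |].
  destruct H as (El & _ & H). constructor; [| eauto].
  intros Hin. destruct (lchain_layer _ _ _ _ _ H _ Hin) as (t & Ht & E'). rewrite El in E'.
  injection E'. lia.
Qed.

Lemma cycle_of_fwd j v l : v < ln0 -> Fwd j k v (k * ln0 + v) l ->
  exists us ws, kcyc us ws /\ l = (Z.of_nat k * (2 * lZ0) + ctot 0 us ws)%Z.
Proof.
  intros Hv H.
  destruct (lchain_of_fwd _ _ _ _ _ H 0 v v) as (us & ws & Hl & Hch & Hhd & ->);
    [lia | exact Hv | exact Hv | reflexivity | reflexivity |].
  exists us, ws. split; [| reflexivity]. apply kcyc_chain.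
  repeat split; [exact Hl | now apply lchain_nodup in Hch |].
  apply lchain_chain in Hch.
  rewrite Nat.Div0.mod_0_l in Hhd.
  destruct us as [| u us]; [cbn in Hl; lia |]. cbn [hd] in *.
  rewrite <- Hhd in Hch. exact Hch.
Qed.

Lemma chain_indices us : forall z ws, chain us z ws ->
  exists es, length es = length us /\
  forall t, t < length us -> nth_error E (nth t es 0) =
    Some (nth t us 0, hd z (skipn (S t) us), nth t ws 0%Z).
Proof.
  induction us as [| u us IH]; intros z [| w ws] H; cbn in H; try easy.
  - exists []. split; [reflexivity | cbn; lia].
  - destruct H as [H1 H2]. destruct (IH _ _ H2) as (es & Hl & He).
    apply In_nth_error in H1. destruct H1 as (e & H1).
    exists (e :: es). split; [cbn; congruence |].
    intros [| t] Ht; cbn in *; [exact H1 | apply He; lia].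
Qed.

Lemma lchain_of_indices j us : forall i z ws, length ws = length us ->
  (forall t, t < length us -> lay j (nth t us 0 mod lmu j) = S (i + t) /\
     exists e, nth_error E e = Some (nth t us 0, hd z (skipn (S t) us), nth t ws 0%Z)
       /\ hres j (i + t) = e mod c) ->
  lchain j i us z ws.
Proof.
  induction us as [| u us IH]; intros i z [| w ws] Hl H; cbn in Hl; try easy.
  cbn [lchain]. pose proof (H 0 ltac:(cbn; lia)) as H0. cbn in H0.
  rewrite Nat.add_0_r in H0. destruct H0 as [A B]. split; [exact A |]. split; [exact B |].
  apply IH; [lia |]. intros t Ht. specialize (H (S t) ltac:(cbn; lia)).
  rewrite <- Nat.add_succ_comm in H. exact H.
Qed.

Lemma chain_length us : forall z ws, chain us z ws -> length ws = length us.
Proof.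
  induction us as [| u us IH]; intros z [| w ws] H; cbn in *; try easy.
  f_equal. now apply (IH z), H.
Qed.

Lemma chain_lt us : forall z ws, chain us z ws -> forall u, In u us -> u < n.
Proof.
  induction us as [| u us IH]; intros z [| w ws] H; cbn in *; try easy.
  intros u' [<- | Hin]; [| exact (IH z ws (proj2 H) u' Hin)].
  destruct H as [H _]. now apply edge_lt in H.
Qed.

Lemma mod_mul_neq a b m : 0 < m -> a mod m <> b mod m -> a mod (c * m) <> b mod (c * m).
Proof.
  intros Hm H E'. apply H.
  assert (K : forall x, (x mod (c * m)) mod m = x mod m).
  { intros x. rewrite (Nat.mul_comm c m), Nat.Div0.mod_mul_r, Nat.mul_comm,
      Nat.Div0.mod_add. apply Nat.Div0.mod_mod. }
  now rewrite <- (K a), <- (K b), E'.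
Qed.

Variable L : nat.
Hypothesis hL : n + 1 <= 2 ^ L.
Hypothesis hUL : L * (k * k) + 2 <= U.

(** A separating modulus gives the vertices of the cycle distinct residues, so assigning residue [i]
    of the cycle to layer [i] is consistent. As all codes below [lQ] are tried, one of them makes
    exactly these choices for vertices and edges. *)
Lemma fwd_of_cycle us ws : kcyc us ws ->
  exists j v, j < lQ /\ v < ln0 /\
    Fwd j k v (k * ln0 + v) (Z.of_nat k * (2 * lZ0) + ctot 0 us ws)%Z.
Proof.
  intros H. apply kcyc_chain in H. destruct H as (Hl & Hnd & Hch).
  pose proof (chain_lt _ _ _ Hch) as Hlt.
  destruct (separating_modulus L us U) as (m & Hm & Hsep).
  { intros u Hu. apply Hlt in Hu. lia. }
  { now rewrite Hl. }
  destruct (chain_indices _ _ _ Hch) as (es & Hle & Hes).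
  assert (HV : 0 < lV) by (unfold lV; nia).
  assert (Hg : forall i, i < k -> nth i us 0 mod (c * m) + lV * (nth i es 0 mod c) < lD).
  { intros i _. unfold lD.
    pose proof (Nat.mod_upper_bound (nth i us 0) (c * m) ltac:(nia)).
    pose proof (Nat.mod_upper_bound (nth i es 0) c ltac:(lia)).
    assert (c * m <= lV) by (unfold lV; nia). nia. }
  destruct (digits_exist lD (fun i => nth i us 0 mod (c * m) + lV * (nth i es 0 mod c)) k Hg)
    as (a & Ha & Hd).
  (* [m - 1] because [lmu] adds the 1 back: the moduli run from 1 to [U], the remainders of [j] from
     0 to [U - 1]. *)
  set (j := (m - 1) + a * U).
  assert (Hj1 : j / U = a) by (symmetry; apply (Nat.div_unique _ _ _ (m - 1)); lia).
  assert (Hj2 : j mod U = m - 1) by (symmetry; apply (Nat.mod_unique _ _ a); lia).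
  assert (Hmu : lmu j = c * m) by (unfold lmu; rewrite Hj2; f_equal; lia).
  assert (Hlt' : forall i, nth i us 0 mod (c * m) < lV).
  { intros i. pose proof (Nat.mod_upper_bound (nth i us 0) (c * m) ltac:(nia)).
    assert (c * m <= lV) by (unfold lV; nia). lia. }
  assert (Hr : forall i, i < k -> res j i = nth i us 0 mod lmu j).
  { intros i Hi. unfold res, digit. rewrite Hj1, Hd, Hmu by exact Hi.
    rewrite (Nat.mul_comm lV), Nat.Div0.mod_add. apply Nat.mod_small, Hlt'. }
  assert (Hh : forall i, i < k -> hres j i = nth i es 0 mod c).
  { intros i Hi. unfold hres, digit. rewrite Hj1, Hd by exact Hi.
    rewrite (Nat.mul_comm lV), Nat.div_add by lia. rewrite Nat.div_small by apply Hlt'. lia. }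
  assert (Hlay : forall i, i < k -> lay j (nth i us 0 mod lmu j) = S i).
  { intros i Hi. rewrite <- Hr by exact Hi. apply layf_inj; [exact Hi |].
    intros i1 Hi1. rewrite !Hr, Hmu by assumption. intros E'.
    destruct (Nat.eq_dec (nth i1 us 0) (nth i us 0)) as [E2 | E2].
    - apply (proj1 (NoDup_nth us 0) Hnd); [lia | lia | exact E2].
    - exfalso. apply (mod_mul_neq (nth i1 us 0) (nth i us 0) m); [lia | | exact E'].
      apply Hsep; [apply nth_In; lia | apply nth_In; lia | exact E2]. }
  destruct us as [| u us]; [cbn in Hl; lia |].
  exists j, (u / lmu j). split; [unfold j, lQ; nia |].
  split; [apply label_lt, Hlt; now left |].
  assert (Hlc : lchain j 0 (u :: us) u ws).
  { apply lchain_of_indices; [now apply chain_length in Hch |].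
    intros t Ht. split; [apply Hlay; lia |].
    exists (nth t es 0). split; [exact (Hes t Ht) | apply Hh; lia]. }
  pose proof (fwd_of_lchain j (u :: us) 0 u ws Hlc) as F.
  rewrite Hl in F. cbn [hd] in F. rewrite Nat.mul_0_l, Nat.add_0_l in F.
  apply F; [reflexivity |]. apply (Hlay 0 hk).
Qed.

(** No code exceeds its share [2 * ln0 * (tau - tau0)], so the sum attains the maximum only if every
    code does. A cheap cycle is seen by at least one code, and a code that sees a cheap layered walk
    yields a cycle. *)
Theorem threshold_test tau (wi wi0 : nat -> Z) :
  (Z.of_nat k * (2 * lZ0) <= tau <= Z.of_nat (k + 1) * (2 * lZ0))%Z ->
  (forall j, j < lQ -> is_wiener_index (Hg j tau) (wi j)) ->
  (forall j, j < lQ -> is_wiener_index (Hg j (Z.of_nat k * (2 * lZ0))) (wi0 j)) ->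
  (sum_upto wi lQ - sum_upto wi0 lQ
     < 2 * Z.of_nat lQ * Z.of_nat ln0 * (tau - Z.of_nat k * (2 * lZ0)))%Z <->
  exists us ws, kcyc us ws /\ (Z.of_nat k * (2 * lZ0) + ctot 0 us ws < tau)%Z.
Proof.
  intros Ht Hwi Hwi0. set (tau0 := (Z.of_nat k * (2 * lZ0))%Z) in *.
  rewrite <- sum_upto_sub.
  replace (2 * Z.of_nat lQ * Z.of_nat ln0 * (tau - tau0))%Z
    with (sum_upto (fun _ => 2 * Z.of_nat ln0 * (tau - tau0))%Z lQ)
    by (rewrite sum_upto_const; lia).
  assert (Hle : forall j, j < lQ -> (wi j - wi0 j <= 2 * Z.of_nat ln0 * (tau - tau0))%Z).
  { intros j Hj. destruct (Hwi j Hj) as (d & Hd & ->). destruct (Hwi0 j Hj) as (d0 & Hd0 & ->).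
    apply (gadget_total_le k ln0 lZ0 (layered j (length E)) hk lZ0_pos
             (layered_edge j (length E)) tau Ht d d0 Hd Hd0). }
  split.
  - intros Hlt.
    (* If no code has a layered walk cheaper than [tau], every summand is maximal, against the
       strict inequality. *)
    assert (D : (exists j v l, j < lQ /\ v < ln0 /\ Fwd j k v (k * ln0 + v) l /\ (l < tau)%Z) \/
      ~ (exists j v l, j < lQ /\ v < ln0 /\ Fwd j k v (k * ln0 + v) l /\ (l < tau)%Z))
      by apply classic.
    destruct D as [(j & v & l & Hj & Hv & Hf & Hl) | D].
    + destruct (cycle_of_fwd j v l Hv Hf) as (us & ws & Hc & ->). eauto.
    + exfalso. revert Hlt. apply Z.le_ngt, Z.eq_le_incl. symmetry.
      apply sum_upto_ext. intros j Hj.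
      destruct (Hwi j Hj) as (d & Hd & ->). destruct (Hwi0 j Hj) as (d0 & Hd0 & ->).
      apply (gadget_total_eq k ln0 lZ0 (layered j (length E)) hk lZ0_pos
             (layered_edge j (length E)) tau Ht d d0 Hd Hd0).
      intros v l Hv Hf. apply Z.nlt_ge. intros Hl. apply D. exists j, v, l. auto.
  - intros (us & ws & Hc & Hlt).
    destruct (fwd_of_cycle us ws Hc) as (j & v & Hj & Hv & Hf).
    apply sum_upto_lt with j; [exact Hle | exact Hj |].
    destruct (Hwi j Hj) as (d & Hd & ->). destruct (Hwi0 j Hj) as (d0 & Hd0 & ->).
    apply (gadget_total_lt k ln0 lZ0 (layered j (length E)) hk lZ0_pos
             (layered_edge j (length E)) tau Ht d d0 Hd Hd0 v _ Hv Hf Hlt).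
Qed.

Fixpoint code (us : list nat) : nat :=
  match us with [] => 0 | u :: us' => u + lY * code us' end.

Lemma ctot_code us : forall i ws, length ws = length us ->
  ctot i us ws = ((sumZ ws + Z.of_nat (length us) * W0) * lX
                  + Z.of_nat (lY ^ i * code us))%Z.
Proof.
  induction us as [| u us IH]; intros i [| w ws] Hl; cbn in Hl; try easy.
  - cbn. lia.
  - cbn [ctot code length]. rewrite IH by lia. change (sumZ (w :: ws)) with (w + sumZ ws)%Z.
    cbn [Nat.pow]. nia.
Qed.

Lemma code_lt us : (forall u, In u us -> u < n) -> code us < lY ^ length us.
Proof.
  induction us as [| u us IH]; intros H; [cbn; lia |].
  specialize (IH ltac:(intros; apply H; now right)). specialize (H u ltac:(now left)).
  cbn [code length Nat.pow]. unfold lY in *. nia.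
Qed.

Lemma code_digit us : (forall u, In u us -> u < n) ->
  forall i, i < length us -> (code us / lY ^ i) mod lY = nth i us 0.
Proof.
  induction us as [| u us IH]; intros H i Hi; [cbn in Hi; lia |].
  assert (Hu : u < lY) by (specialize (H u ltac:(now left)); unfold lY; lia).
  destruct i as [| i]; cbn [code nth].
  - cbn [Nat.pow]. rewrite Nat.div_1_r, (Nat.mul_comm lY), Nat.Div0.mod_add.
    now apply Nat.mod_small.
  - rewrite <- IH by (cbn in Hi; intros; try apply H; try (now right); lia).
    cbn [Nat.pow]. rewrite <- Nat.Div0.div_div, (Nat.mul_comm lY), Nat.div_add by lia.
    rewrite (Nat.div_small u) by exact Hu. reflexivity.
Qed.

(* Strict because the digits are at most [lY - 2]; the search needs the slack to tell the
   largest code from the absence of a cycle. *)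
Lemma code_lt_pred us : 0 < length us -> (forall u, In u us -> u < n) ->
  code us + 1 < lY ^ length us.
Proof.
  destruct us as [| u us]; cbn [length]; intros Hl H; [lia |].
  pose proof (code_lt us ltac:(intros; apply H; now right)) as IH.
  specialize (H u ltac:(now left)). cbn [code Nat.pow]. unfold lY in *. nia.
Qed.

Lemma sum_weights us : forall z ws, chain us z ws ->
  (Z.abs (sumZ ws) <= Z.of_nat (length us) * W0)%Z.
Proof.
  induction us as [| u us IH]; intros z [| w ws] H; cbn in H; try easy.
  destruct H as [H1 H2]. apply IH in H2. apply hW in H1.
  change (sumZ (w :: ws)) with (w + sumZ ws)%Z. cbn [length]. lia.
Qed.

(** Division of the cost by [lX] separates the shifted weight from the names. Minimal cost thus
    means minimal weight, ties being broken by the code [b], whose digits are the vertices. *)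
Lemma kcyc_total us ws : kcyc us ws ->
  exists b : nat, (Z.of_nat b < lX)%Z /\
    ctot 0 us ws = ((sumZ ws + Z.of_nat k * W0) * lX + Z.of_nat b)%Z /\
    (0 <= ctot 0 us ws < lZ0 - 1)%Z /\
    forall i, i < k -> (b / lY ^ i) mod lY = nth i us 0.
Proof.
  intros H. apply kcyc_chain in H. destruct H as (Hl & _ & Hch).
  pose proof (chain_lt _ _ _ Hch) as Hlt. pose proof (code_lt us Hlt) as Hb.
  pose proof (sum_weights _ _ _ Hch) as Hs. rewrite Hl in *.
  assert (Et : ctot 0 us ws = ((sumZ ws + Z.of_nat k * W0) * lX + Z.of_nat (code us))%Z).
  { rewrite ctot_code by now apply chain_length in Hch. rewrite Hl. cbn [Nat.pow]. lia. }
  exists (code us). rewrite Et. unfold lZ0.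
  pose proof (code_lt_pred us ltac:(lia) Hlt) as Hb'. rewrite Hl in Hb'.
  assert (Z.of_nat (code us) + 1 < lX)%Z by (unfold lX; lia).
  pose proof lX_pos. repeat split; [lia | nia | nia |].
  intros i Hi. apply code_digit; [exact Hlt | lia].
Qed.

End Layering.

(** * Running the given program repeatedly *)

(* Register [r] of the simulated program is register [48 + r], array [a] is array [10 + a];
   array indices are shifted by register 22, so that every run finds arrays full of zeros.
   Register 36 is scratch. *)
Fixpoint sim (c : cmd) : cmd :=
  match c with
  | Skip => Skip
  | Const x z => Const (48 + x) z
  | Op o x y z => Op o (48 + x) (48 + y) (48 + z)
  | Read x a y => Op Add 36 22 (48 + y) ;; Read (48 + x) (10 + a) 36
  | Write a x y => Op Add 36 22 (48 + x) ;; Write (10 + a) 36 (48 + y)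
  | Seq c1 c2 => Seq (sim c1) (sim c2)
  | If x y c1 c2 => If (48 + x) (48 + y) (sim c1) (sim c2)
  | While x y c => While (48 + x) (48 + y) (sim c)
  end.

Fixpoint nregs (c : cmd) : nat :=
  match c with
  | Skip => 0
  | Const x _ => S x
  | Op _ x y z => S (Nat.max x (Nat.max y z))
  | Read x _ y | Write _ x y => S (Nat.max x y)
  | Seq c1 c2 => Nat.max (nregs c1) (nregs c2)
  | If x y c1 c2 => Nat.max (S (Nat.max x y)) (Nat.max (nregs c1) (nregs c2))
  | While x y c => Nat.max (S (Nat.max x y)) (nregs c)
  end.

(** [exec] does not check a value obtained by [Read], so [sim_arr_le] must keep all cells bounded in
    order that indices computed from them stay in the window. Beyond the window [sim_fresh]
    guarantees zeros for the next run; below it, leftovers of earlier runs are allowed. *)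
Record simulates (b off : Z) (nr : nat) (s r : state) : Prop := {
  sim_reg : forall x, x < nr -> reg r (48 + x) = reg s x;
  sim_reg_le : forall x, x < nr -> (Z.abs (reg s x) <= b)%Z;
  sim_arr : forall a j, (Z.abs j <= b)%Z -> arr r (10 + a) (off + j)%Z = arr s a j;
  sim_arr_le : forall a j, (Z.abs (arr s a j) <= b)%Z;
  sim_off : reg r 22 = off;
  sim_fresh : forall a j, (off + b < j)%Z -> arr r (10 + a) j = 0%Z
}.

Lemma simulates_set_reg b off nr s r x v :
  simulates b off nr s r -> (Z.abs v <= b)%Z ->
  simulates b off nr (set_reg s x v) (set_reg r (48 + x) v).
Proof.
  intros [H1 H2 H3 H4 H5 H6] Hv. constructor; auto.
  - intros y Hy. specialize (H1 y Hy). cbn in *. destruct (y =? x); auto.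
  - intros y Hy. specialize (H2 y Hy). cbn in *. destruct (y =? x); auto.
Qed.

Lemma simulates_scratch b off nr s r v :
  simulates b off nr s r -> simulates b off nr s (set_reg r 36 v).
Proof. intros [H1 H2 H3 H4 H5 H6]. constructor; auto. Qed.

Lemma simulates_set_arr b off nr s r a i v :
  simulates b off nr s r -> (Z.abs v <= b)%Z -> (Z.abs i <= b)%Z ->
  simulates b off nr (set_arr s a i v) (set_arr r (10 + a) (off + i) v).
Proof.
  intros [H1 H2 H3 H4 H5 H6] Hv Hi. constructor; auto.
  - intros a' j Hj. specialize (H3 a' j Hj). cbn in *.
    destruct (a' =? a); cbn; [| exact H3].
    destruct (Z.eqb_spec (off + j) (off + i)), (Z.eqb_spec j i); auto; lia.
  - intros a' j. specialize (H4 a' j). cbn in *. destruct (_ && _)%bool; auto.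
  - intros a' j Hj. specialize (H6 a' j Hj). cbn in *.
    destruct (a' =? a); cbn; [| exact H6].
    destruct (Z.eqb_spec j (off + i)); [lia | exact H6].
Qed.

Lemma sim_exec b B off nr c s t s' : (0 <= off)%Z -> (off + b <= B)%Z ->
  exec b c s t s' -> nregs c <= nr -> forall r, simulates b off nr s r ->
  exists t' r', exec B (sim c) r t' r' /\ t' <= 2 * t /\ simulates b off nr s' r'.
Proof.
  intros Hoff HB H.
  induction H; intros Hn r R; cbn [sim nregs] in *.
  - exists 1, r. split; [constructor | split; [lia | exact R]].
  - exists 1. eexists. split; [constructor; lia | split; [lia |]].
    now apply simulates_set_reg.
  - exists 1. eexists.
    rewrite <- (sim_reg _ _ _ _ _ R y), <- (sim_reg _ _ _ _ _ R z) in * by lia.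
    split; [constructor; lia | split; [lia |]]. now apply simulates_set_reg.
  - exists (1 + 1). pose proof (sim_reg_le _ _ _ _ _ R y ltac:(lia)) as Hy.
    pose proof (sim_reg _ _ _ _ _ R y ltac:(lia)) as Ey.
    pose proof (sim_off _ _ _ _ _ R) as Eo.
    eexists. split; [eapply exec_seq; [| apply exec_read] |].
    + apply exec_op. cbn [eval_op]. rewrite Ey, Eo. lia.
    + split; [lia |]. cbn [reg arr set_reg Nat.eqb eval_op]. rewrite Ey, Eo.
      rewrite (sim_arr _ _ _ _ _ R) by exact Hy.
      apply simulates_set_reg; [now apply simulates_scratch | apply (sim_arr_le _ _ _ _ _ R)].
  - exists (1 + 1). pose proof (sim_reg_le _ _ _ _ _ R x ltac:(lia)) as Hx.
    pose proof (sim_reg_le _ _ _ _ _ R y ltac:(lia)) as Hy.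
    pose proof (sim_reg _ _ _ _ _ R x ltac:(lia)) as Ex.
    pose proof (sim_reg _ _ _ _ _ R y ltac:(lia)) as Ey.
    pose proof (sim_off _ _ _ _ _ R) as Eo.
    eexists. split; [eapply exec_seq; [| apply exec_write] |].
    + apply exec_op. cbn [eval_op]. rewrite Ex, Eo. lia.
    + split; [lia |].
      replace (reg (set_reg r 36 (eval_op Add (reg r 22) (reg r (48 + x)))) 36)
        with (off + reg s x)%Z by (cbn [reg set_reg Nat.eqb eval_op]; congruence).
      replace (reg (set_reg r 36 (eval_op Add (reg r 22) (reg r (48 + x)))) (48 + y))
        with (reg s y) by (symmetry; exact Ey).
      apply simulates_set_arr; auto. now apply simulates_scratch.
  - destruct (IHexec1 ltac:(lia) r R) as (t1' & r1 & E1 & L1 & R1).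
    destruct (IHexec2 ltac:(lia) r1 R1) as (t2' & r2 & E2 & L2 & R2).
    exists (t1' + t2'), r2. split; [eapply exec_seq; eassumption | split; [lia | exact R2]].
  - destruct (IHexec ltac:(lia) r R) as (t1' & r1 & E1 & L1 & R1).
    rewrite <- (sim_reg _ _ _ _ _ R x), <- (sim_reg _ _ _ _ _ R y) in * by lia.
    exists (S t1'), r1. split; [now apply exec_if_true | split; [lia | exact R1]].
  - destruct (IHexec ltac:(lia) r R) as (t1' & r1 & E1 & L1 & R1).
    rewrite <- (sim_reg _ _ _ _ _ R x), <- (sim_reg _ _ _ _ _ R y) in * by lia.
    exists (S t1'), r1. split; [now apply exec_if_false | split; [lia | exact R1]].
  - destruct (IHexec1 ltac:(lia) r R) as (t1' & r1 & E1 & L1 & R1).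
    destruct (IHexec2 Hn r1 R1) as (t2' & r2 & E2 & L2 & R2).
    rewrite <- (sim_reg _ _ _ _ _ R x), <- (sim_reg _ _ _ _ _ R y) in * by lia.
    exists (S (t1' + t2')), r2.
    split; [eapply exec_while_true; eassumption | split; [lia | exact R2]].
  - rewrite <- (sim_reg _ _ _ _ _ R x), <- (sim_reg _ _ _ _ _ R y) in * by lia.
    exists 1, r. split; [now apply exec_while_false | split; [lia | exact R]].
Qed.

(** There is no upper limit on [j]: besides the edges written so far, this records that all later
    windows are still empty. *)
Definition loaded (b off : Z) (es : list (nat * nat * Z)) (r : state) : Prop :=
  forall a j, (- b <= j)%Z ->
    arr r (10 + a) (off + j)%Z = arr (init (WGraph 0 es)) a j.

Definition lookup (g : nat * nat * Z -> Z) (es : list (nat * nat * Z)) (j : Z) : Z :=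
  if (j <? 0)%Z then 0%Z
  else match nth_error es (Z.to_nat j) with Some x => g x | None => 0%Z end.

Lemma lookup_snoc g es e j :
  lookup g (es ++ [e]) j = if (j =? Z.of_nat (length es))%Z then g e else lookup g es j.
Proof.
  unfold lookup. destruct (Z.ltb_spec j 0).
  - destruct (Z.eqb_spec j (Z.of_nat (length es))); [lia | reflexivity].
  - destruct (Z.eqb_spec j (Z.of_nat (length es))) as [-> | Hne].
    + rewrite Nat2Z.id, nth_error_app2, Nat.sub_diag by lia. reflexivity.
    + destruct (Nat.lt_ge_cases (Z.to_nat j) (length es)).
      * now rewrite nth_error_app1.
      * rewrite !(proj2 (nth_error_None _ _)); [reflexivity | lia |].
        rewrite length_app. cbn. lia.
Qed.

Lemma lookup_beyond g es j : (Z.of_nat (length es) <= j)%Z -> lookup g es j = 0%Z.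
Proof.
  intros H. unfold lookup. destruct (Z.ltb_spec j 0); [reflexivity |].
  rewrite (proj2 (nth_error_None _ _)); [reflexivity | lia].
Qed.

Lemma lookup_cases g es j : lookup g es j = 0%Z \/ exists e, In e es /\ lookup g es j = g e.
Proof.
  unfold lookup. destruct (j <? 0)%Z; [auto |].
  destruct (nth_error es (Z.to_nat j)) as [e |] eqn:He; [| auto].
  apply nth_error_In in He. eauto.
Qed.

Definition emit : cmd :=
  Op Add 36 22 23 ;; Write 10 36 24 ;; Write 11 36 25 ;; Write 12 36 26 ;; Op Add 23 23 3.

Lemma emit_spec B b off es x y w r : (0 <= b)%Z -> (0 <= off)%Z ->
  (off + Z.of_nat (length es) + 1 <= B)%Z ->
  reg r 3 = 1%Z -> reg r 22 = off -> reg r 23 = Z.of_nat (length es) ->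
  reg r 24 = Z.of_nat x -> reg r 25 = Z.of_nat y -> reg r 26 = w ->
  loaded b off es r ->
  wp B emit 5 (fun r' => loaded b off (es ++ [(x, y, w)]) r' /\
    reg r' 23 = Z.of_nat (length (es ++ [(x, y, w)]))) r.
Proof.
  intros Hb Ho HB E3 E22 E23 E24 E25 E26 HL. unfold emit.
  apply (wp_seq 1 4). apply (wp_op (off + Z.of_nat (length es))%Z);
    [cbn [eval_op]; congruence | lia |].
  apply (wp_seq 1 3). eapply wp_write; [reflexivity | reflexivity |].
  apply (wp_seq 1 2). eapply wp_write; [reflexivity | reflexivity |].
  apply (wp_seq 1 1). eapply wp_write; [reflexivity | reflexivity |].
  apply (wp_op (Z.of_nat (length es) + 1)%Z); [cbn; congruence | lia |].
  split; [| rewrite length_app; cbn; lia].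
  intros a j Hj. specialize (HL a j Hj).
  cbn [reg arr set_reg set_arr Nat.eqb andb] in *. rewrite E24, E25, E26.
  assert (K : (off + j =? off + Z.of_nat (length es))%Z = (j =? Z.of_nat (length es))%Z).
  { destruct (Z.eqb_spec (off + j) (off + Z.of_nat (length es))),
      (Z.eqb_spec j (Z.of_nat (length es))); lia. }
  rewrite K.
  destruct a as [| [| [| a]]]; cbn [Nat.eqb Nat.add andb] in *;
    cbn [init arr edges] in *.
  - transitivity (lookup (fun x => Z.of_nat (fst (fst x))) (es ++ [(x, y, w)]) j); [| reflexivity].
    rewrite lookup_snoc. cbn [fst snd]. now rewrite HL.
  - transitivity (lookup (fun x => Z.of_nat (snd (fst x))) (es ++ [(x, y, w)]) j); [| reflexivity].
    rewrite lookup_snoc. cbn [fst snd]. now rewrite HL.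
  - transitivity (lookup snd (es ++ [(x, y, w)]) j); [| reflexivity].
    rewrite lookup_snoc. cbn [fst snd]. now rewrite HL.
  - exact HL.
Qed.

Fixpoint zero_regs (m : nat) : cmd :=
  match m with 0 => Skip | S m' => Const (48 + m') 0 ;; zero_regs m' end.

Lemma zero_regs_spec B m r : (0 <= B)%Z ->
  wp B (zero_regs m) (S m) (fun r' => arr r' = arr r /\
    (forall x, x < m -> reg r' (48 + x) = 0%Z) /\
    (forall x, x < 48 \/ 48 + m <= x -> reg r' x = reg r x)) r.
Proof.
  intros HB. revert r; induction m as [| m IH]; intros r.
  - apply wp_skip. repeat split; intros; lia.
  - cbn [zero_regs]. apply (wp_seq 1 (S m)). apply wp_const; [cbn; lia |].
    eapply wp_conseq; [apply IH | lia |].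
    intros r' (A1 & A2 & A3). repeat split.
    + exact A1.
    + intros x Hx. destruct (Nat.eq_dec x m) as [-> | Hne]; [| apply A2; lia].
      rewrite A3 by lia. cbn. now rewrite Nat.eqb_refl.
    + intros x Hx. rewrite A3 by lia. cbn [reg set_reg].
      destruct (Nat.eqb_spec x (48 + m)); [lia | reflexivity].
Qed.

(** Registers 48 and 49 are the input registers 0 and 1 of the simulated program; the hub has the
    highest number, so the number of vertices is one more. The [2 +] covers these two registers even
    if [P] never mentions them. *)
Definition pcall (P : cmd) : cmd :=
  zero_regs (2 + nregs P) ;;
  Op Add 48 18 3 ;; Op Add 49 23 2 ;; sim P ;; Op Add 28 28 48 ;; Op Add 22 22 19.

Lemma init_bounded G W a j : simple_digraph G -> weights_le G W ->
  (Z.abs (arr (init G) a j) <= Z.of_nat (order G + W))%Z.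
Proof.
  intros HG HW.
  assert (HL : forall g, (forall e, In e (edges G) -> (Z.abs (g e) <= Z.of_nat (order G + W))%Z) ->
    (Z.abs (lookup g (edges G) j) <= Z.of_nat (order G + W))%Z).
  { intros g Hg. destruct (lookup_cases g (edges G) j) as [-> | (e & He & ->)]; [lia | auto]. }
  destruct HG as [HG _].
  destruct a as [| [| [| a]]]; [apply (HL (fun x => Z.of_nat (fst (fst x))))
    | apply (HL (fun x => Z.of_nat (snd (fst x)))) | apply (HL snd) | cbn; lia];
    intros [[u v] w] He; cbn [fst snd].
  - apply HG in He. lia.
  - apply HG in He. lia.
  - apply HW in He. lia.
Qed.

Lemma nedges_le G : simple_digraph G -> nedges G <= order G * order G.
Proof.
  intros [H ND]. unfold nedges. rewrite <- (length_map fst).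
  replace (order G * order G) with (length (list_prod (seq 0 (order G)) (seq 0 (order G))))
    by now rewrite length_prod, length_seq.
  apply NoDup_incl_length; [exact ND |].
  intros (u, v) Hin. apply in_map_iff in Hin. destruct Hin as (((u', v'), w) & E & Hin).
  cbn in E. injection E as -> ->. apply H in Hin.
  apply in_prod; apply in_seq; lia.
Qed.

Lemma pcall_spec (P : cmd) (B b off : Z) (N' W' t : nat) (s' r : state) es :
  let G := WGraph N' es in
  simple_digraph G -> weights_le G W' ->
  (0 <= off)%Z -> (off + (2 * b + 1) <= B)%Z ->
  (Z.of_nat (N' + W') <= b)%Z -> (Z.of_nat (N' * N') <= b)%Z ->
  exec b P (init G) t s' ->
  (Z.abs (reg r 28) + b <= B)%Z ->
  reg r 2 = 0%Z -> reg r 3 = 1%Z -> (reg r 18 + 1 = Z.of_nat N')%Z ->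
  reg r 19 = (2 * b + 1)%Z -> reg r 22 = off -> reg r 23 = Z.of_nat (length es) ->
  loaded b off es r ->
  wp B (pcall P) (2 * t + nregs P + 7) (fun r' =>
    (reg r' 28 = reg r 28 + reg s' 0)%Z /\ (Z.abs (reg s' 0) <= b)%Z /\
    (reg r' 22 = off + (2 * b + 1))%Z /\ loaded b (off + (2 * b + 1)) [] r') r.
Proof.
  intros G HG HW Ho HB Hb1 Hb2 He H28 E2 E3 E18 E19 E22 E23 HL.
  (* The edge list must end inside the window of the run; as the graph is simple, the bound on
     [N' * N'] ensures this. *)
  pose proof (nedges_le G HG) as HM. cbn in HM. unfold nedges in HM. cbn in HM.
  unfold pcall.
  apply (wp_le ((3 + nregs P) + (1 + (1 + (2 * t + (1 + 1)))))); [| lia].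
  apply wp_seq.
  eapply wp_conseq; [apply zero_regs_spec; lia | lia |].
  intros r1 (A1 & A2 & A3).
  apply wp_seq. apply (wp_op (Z.of_nat N')); [cbn [eval_op]; rewrite !A3 by lia; lia | lia |].
  apply wp_seq. apply (wp_op (Z.of_nat (length es)));
    [cbn [eval_op reg set_reg Nat.eqb]; rewrite !A3 by lia; lia | nia |].
  apply wp_seq.
  set (r2 := set_reg (set_reg r1 48 (Z.of_nat N')) 49 (Z.of_nat (length es))).
  assert (R : simulates b off (2 + nregs P) (init G) r2).
  { constructor.
    - intros x Hx. destruct x as [| [| x]]; [reflexivity | reflexivity |].
      change (reg r1 (48 + S (S x)) = 0%Z). apply A2. lia.
    - intros x Hx. destruct x as [| [| x]]; cbn; unfold nedges; cbn; lia.
    - intros a j Hj. change (arr r1 (10 + a) (off + j)%Z = arr (init G) a j).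
      rewrite A1. apply HL. lia.
    - intros a j. eapply Z.le_trans; [apply init_bounded with (W := W'); assumption | exact Hb1].
    - change (reg r1 22 = off). rewrite A3 by lia. exact E22.
    - intros a j Hj. change (arr r1 (10 + a) j = 0%Z). rewrite A1.
      replace j with (off + (j - off))%Z by lia. rewrite HL by lia.
      destruct a as [| [| [| a]]]; [| | | reflexivity];
        [apply (lookup_beyond (fun x => Z.of_nat (fst (fst x))))
        | apply (lookup_beyond (fun x => Z.of_nat (snd (fst x)))) | apply (lookup_beyond snd)];
        cbn [edges]; lia. }
  destruct (sim_exec b B off (2 + nregs P) P (init G) t s' Ho ltac:(lia) He ltac:(lia) r2 R)
    as (t' & r3 & E' & L' & R').
  pose proof (exec_frame _ _ _ _ _ E') as [F1 _].
  assert (W28 : forall c x, x <> 36 -> x < 48 -> writes (sim c) x = false).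
  { induction c; intros q Hq Hq'; cbn [sim writes]; try reflexivity;
      try (apply Nat.eqb_neq; lia);
      try (rewrite orb_false_iff; split; auto; try (apply Nat.eqb_neq; lia)); auto. }
  assert (F : forall x, x <> 36 -> x < 48 -> reg r3 x = reg r x).
  { intros x Hx1 Hx2. rewrite F1 by (apply W28; lia). unfold r2. cbn [reg set_reg].
    destruct (Nat.eqb_spec x 49); [lia |]. destruct (Nat.eqb_spec x 48); [lia |].
    apply A3. lia. }
  exists t', r3. split; [exact E' |]. split; [exact L' |].
  pose proof (sim_reg _ _ _ _ _ R' 0 ltac:(lia)) as Q0. cbn [Nat.add] in Q0.
  pose proof (sim_reg_le _ _ _ _ _ R' 0 ltac:(lia)) as Q1.
  apply wp_seq. apply (wp_op (reg r 28 + reg s' 0)%Z);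
    [cbn [eval_op]; rewrite (F 28) by lia; lia | lia |].
  apply (wp_op (off + (2 * b + 1))%Z);
    [cbn [eval_op reg set_reg Nat.eqb]; rewrite (F 22), (F 19) by lia; lia | lia |].
  split; [reflexivity |]. split; [exact Q1 |]. split; [reflexivity |].
  intros a j Hj. change (arr r3 (10 + a) (off + (2 * b + 1) + j)%Z = arr (init (WGraph 0 [])) a j).
  rewrite (sim_fresh _ _ _ _ _ R') by lia.
  assert (N : forall (i : nat), nth_error (@nil (nat * nat * Z)) i = None) by (now intros []).
  destruct a as [| [| [| a]]]; cbn; rewrite ?N; destruct (j <? 0)%Z; reflexivity.
Qed.

(** * Symbolic execution and the constants that the subroutines preserve *)

Lemma wp_seq1 t B c1 c2 Q s : wp B c1 1 (wp B c2 t Q) s -> wp B (c1 ;; c2) (S t) Q s.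
Proof. apply (wp_seq 1 t). Qed.

Ltac simpl_state := cbn [reg arr set_reg set_arr Nat.eqb andb eval_op].
Ltac use_regs :=
  simpl_state;
  repeat match goal with H : reg ?s ?r = _ |- context [reg ?s ?r] => rewrite H end.
Ltac op v :=
  first [apply wp_seq1; apply (wp_op v) | apply (wp_op v)];
  [use_regs; try lia | try lia |].
Ltac rd v :=
  first [apply wp_seq1; apply (wp_read v) | apply (wp_read v)]; [use_regs |].
Ltac wr i v :=
  first [apply wp_seq1; apply (wp_write i v) | apply (wp_write i v)];
  [use_regs; try lia | use_regs; try lia |].
Ltac cst := first [apply wp_seq1; apply wp_const | apply wp_const]; [try lia |].

Lemma squares_lt_1 (p q : Z) : (p = 0 /\ q = 0 <-> p * p + q * q < 1)%Z.
Proof. nia. Qed.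

Lemma label_lt_hub k n0 i p : i <= k -> p < n0 -> i * n0 + p < hub k n0.
Proof. unfold hub. nia. Qed.

Lemma div_le_self a b : a / b <= a.
Proof.
  destruct b; [cbn; lia |]. apply Nat.Div0.div_le_upper_bound. nia.
Qed.

(** The constants live in registers 1 to 21 and in arrays up to 7. For concrete code the claim is
    settled by evaluation ([keeps_check]); [pcall] needs an induction because it contains an unknown
    program. *)
Definition keeps (c : cmd) : Prop :=
  (forall r, 1 <= r <= 21 -> writes c r = false) /\
  (forall a, a <= 7 -> writesa c a = false).

Lemma keeps_check c :
  forallb (fun r => negb (writes c r)) (seq 1 21) = true ->
  forallb (fun a => negb (writesa c a)) (seq 0 8) = true -> keeps c.
Proof.
  intros H1 H2. rewrite forallb_forall in H1, H2. split; intros x Hx.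
  - specialize (H1 x ltac:(apply in_seq; lia)). now destruct (writes c x).
  - specialize (H2 x ltac:(apply in_seq; lia)). now destruct (writesa c x).
Qed.

Ltac keep := apply keeps_check; reflexivity.

Lemma keeps_seq c1 c2 : keeps c1 -> keeps c2 -> keeps (c1 ;; c2).
Proof.
  intros [A1 A2] [B1 B2]. split; cbn; intros x Hx; apply orb_false_iff; auto.
Qed.

Lemma keeps_while x y c : keeps c -> keeps (While x y c).
Proof. intros [A1 A2]. split; cbn; auto. Qed.

Lemma keeps_pcall P : keeps (pcall P).
Proof.
  assert (Z1 : forall m, keeps (zero_regs m)).
  { induction m as [| m IH]; [now split |]. apply keeps_seq; [| exact IH].
    split; [intros; apply Nat.eqb_neq; lia | reflexivity]. }
  assert (Z2 : forall c, keeps (sim c)).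
  { induction c; cbn [sim]; auto using keeps_seq, keeps_while.
    - now split.
    - split; [intros; apply Nat.eqb_neq; lia | reflexivity].
    - split; [intros; apply Nat.eqb_neq; lia | reflexivity].
    - split; [| reflexivity].
      intros q Hq. cbn [writes]. apply orb_false_iff. split; apply Nat.eqb_neq; lia.
    - split; intros q Hq; cbn [writes writesa]; [| apply Nat.eqb_neq; lia].
      apply orb_false_iff. split; [apply Nat.eqb_neq; lia | reflexivity].
    - destruct IHc1, IHc2. split; cbn; intros q Hq; apply orb_false_iff; auto. }
  unfold pcall. repeat apply keeps_seq; auto; keep.
Qed.

Lemma writes_pcall P r : r < 48 -> r <> 36 -> r <> 28 -> r <> 22 -> writes (pcall P) r = false.
Proof.
  intros H1 H2 H3 H4.
  assert (Z1 : forall m, writes (zero_regs m) r = false).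
  { induction m as [| m IH]; [reflexivity |]. cbn [zero_regs writes]. rewrite IH.
    apply orb_false_iff. split; [apply Nat.eqb_neq; lia | reflexivity]. }
  assert (Z2 : forall c, writes (sim c) r = false).
  { induction c; cbn [sim writes]; rewrite ?IHc1, ?IHc2, ?orb_false_iff;
      repeat split; try reflexivity; try assumption; apply Nat.eqb_neq; lia. }
  unfold pcall. cbn [writes]. rewrite Z1, Z2, !(proj2 (Nat.eqb_neq _ _)) by lia. reflexivity.
Qed.

(** * Summing the Wiener indices of all gadgets *)

(* Registers 1 to 21 hold the constants listed in [env] below.  The others: 22 array offset of
   the current call, 23 number of edges written, 24-26 the next edge, 27 tau, 28 accumulated
   sum, 29 parameter code j, 30-32 lower end, upper end and length of the search interval,
   33 the sum for the smallest tau, 34 modulus, 35 loop counter, 36-43 scratch.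
   Arrays: 0-2 input, 3-4 relabelled endpoints, 5 labels, 6 vertices by label, 7 powers of lY,
   8 layer (plus one) of a residue, 9 edge residue of a layer. *)
Definition pdecode : cmd :=
  Op Mod 34 29 8 ;; Op Add 34 34 3 ;; Op Mul 34 7 34 ;; Op Div 36 29 8 ;;
  Const 35 0 ;; While 35 9 (Write 8 35 2 ;; Op Add 35 35 3) ;;
  Const 35 0 ;;
  While 35 4 (
    Op Mod 37 36 10 ;; Op Div 36 36 10 ;; Op Mod 38 37 9 ;; Op Div 39 37 9 ;;
    Write 9 35 39 ;; Op Add 35 35 3 ;; Write 8 38 35).

Definition pstar : cmd :=
  Const 23 0 ;; Const 24 0 ;; Op Add 25 18 2 ;; Op Add 26 17 2 ;;
  While 24 18 (emit ;; Op Add 24 24 3).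

Definition pdirect : cmd :=
  Const 24 0 ;; Op Add 26 27 2 ;;
  While 24 12 (Op Add 25 24 20 ;; emit ;; Op Add 24 24 3).

Definition pedge : cmd :=
  Op Div 24 36 34 ;; Op Mul 43 41 12 ;; Op Add 24 43 24 ;;
  Op Div 25 37 34 ;; Op Mul 43 38 12 ;; Op Add 25 43 25 ;;
  Read 26 2 35 ;; Op Add 26 26 6 ;; Op Mul 26 26 14 ;;
  Read 43 7 41 ;; Op Mul 43 36 43 ;; Op Add 26 26 43 ;; Op Add 26 16 26 ;;
  emit.

(* Equalities are tested by comparing a sum of squares with 1. *)
Definition player_body : cmd :=
  Read 36 3 35 ;; Read 37 4 35 ;; Op Mod 38 36 34 ;; Op Mod 39 37 34 ;;
  Read 38 8 38 ;; Read 39 8 39 ;;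
  If 2 38 (
    Op Mod 40 38 4 ;; Op Add 40 40 3 ;; Op Sub 40 39 40 ;; Op Mul 40 40 40 ;;
    Op Sub 41 38 3 ;; Read 42 9 41 ;; Op Mod 43 35 7 ;; Op Sub 42 42 43 ;;
    Op Mul 42 42 42 ;; Op Add 40 40 42 ;;
    If 40 3 pedge Skip) Skip.

Definition player : cmd :=
  Const 35 0 ;; While 35 1 (player_body ;; Op Add 35 35 3).

Definition psum_body (P : cmd) : cmd :=
  pdecode ;; pstar ;; pdirect ;; player ;; pcall P ;; Op Add 29 29 3.

Definition psum (P : cmd) : cmd :=
  Const 28 0 ;; Const 29 0 ;; While 29 11 (psum_body P).

Definition psearch_body (P : cmd) : cmd :=
  Op Add 36 3 3 ;; Op Div 36 32 36 ;; Op Add 27 30 36 ;; psum P ;;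
  Op Sub 36 28 33 ;; Op Sub 37 27 21 ;; Op Mul 37 37 12 ;; Op Mul 37 37 11 ;;
  Op Add 37 37 37 ;;
  If 36 37 (Op Add 31 27 2) (Op Add 30 27 2) ;;
  Op Sub 32 31 30.

Definition psearch (P : cmd) : cmd :=
  Op Add 27 21 2 ;; psum P ;; Op Add 33 28 2 ;; Op Add 30 21 2 ;; Op Add 31 21 15 ;;
  Op Sub 32 31 30 ;; While 3 32 (psearch_body P).

Definition pout : cmd :=
  Op Add 36 21 15 ;;
  If 31 36 (
    Op Sub 36 30 21 ;; Op Mod 36 36 14 ;; Const 35 0 ;;
    While 35 4 (
      Op Mod 37 36 13 ;; Op Div 36 36 13 ;; Read 38 6 37 ;; Write 0 35 38 ;;
      Op Add 35 35 3) ;;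
    Const 0 1)
  (Const 0 0).

Section Sum.
Variables (k c U n : nat) (W0 : Z) (E : list (nat * nat * Z)).
Notation V := (lV c U).
Notation D := (lD c U).
Notation Q := (lQ k c U).
Notation n0 := (ln0 c n).
Notation Y := (lY n).
Notation X := (lX k n).
Notation Z0 := (lZ0 k n W0).
Notation HUB := (hub k n0).
Notation M := (length E).
Variables (P : cmd) (b B : Z).

Record env (s : state) : Prop := {
  env1 : reg s 1 = Z.of_nat M;
  env2 : reg s 2 = 0%Z;
  env3 : reg s 3 = 1%Z;
  env4 : reg s 4 = Z.of_nat k;
  env6 : reg s 6 = W0;
  env7 : reg s 7 = Z.of_nat c;
  env8 : reg s 8 = Z.of_nat U;
  env9 : reg s 9 = Z.of_nat V;
  env10 : reg s 10 = Z.of_nat D;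
  env11 : reg s 11 = Z.of_nat Q;
  env12 : reg s 12 = Z.of_nat n0;
  env13 : reg s 13 = Z.of_nat Y;
  env14 : reg s 14 = X;
  env15 : reg s 15 = Z0;
  env16 : reg s 16 = (2 * Z0)%Z;
  env17 : reg s 17 = (Z.of_nat (k + 1) * Z0)%Z;
  env18 : reg s 18 = Z.of_nat HUB;
  env19 : reg s 19 = (2 * b + 1)%Z;
  env20 : reg s 20 = Z.of_nat (k * n0);
  env21 : reg s 21 = (Z.of_nat k * (2 * Z0))%Z;
  enva : forall e u v w, nth_error E e = Some (u, v, w) ->
    arr s 3 (Z.of_nat e) = Z.of_nat u /\ arr s 4 (Z.of_nat e) = Z.of_nat v /\
    arr s 2 (Z.of_nat e) = w;
  envp : forall i, i < k -> arr s 7 (Z.of_nat i) = Z.of_nat (Y ^ i)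
}.

Lemma env_frame cm s s' : keeps cm -> frame cm s s' -> env s -> env s'.
Proof.
  intros [K1 K2] [F1 F2] H.
  assert (R : forall r, 1 <= r <= 21 -> reg s' r = reg s r) by auto.
  assert (A : forall a, a <= 7 -> forall j, arr s' a j = arr s a j) by auto.
  destruct H. constructor; try (rewrite R by lia; assumption).
  - intros e u v w He. rewrite !A by lia. auto.
  - intros i Hi. rewrite A by lia. auto.
Qed.

Lemma env_set_reg s x v : 21 < x -> env s -> env (set_reg s x v).
Proof.
  intros Hx. apply (env_frame (Const x v)).
  - split; [| reflexivity]. intros r Hr. apply Nat.eqb_neq. lia.
  - split; [| reflexivity]. intros r Hr. cbn in *. now rewrite Hr.
Qed.

Lemma env_set_arr s a i v : 7 < a -> env s -> env (set_arr s a i v).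
Proof.
  intros Ha. apply (env_frame (Write a 0 0)).
  - split; [reflexivity |]. intros a' Ha'. apply Nat.eqb_neq. lia.
  - split; [reflexivity |]. intros a' Ha' j. cbn in *. now rewrite Ha'.
Qed.

Ltac env_tac :=
  repeat first [assumption | apply env_set_reg; [lia |] | apply env_set_arr; [lia |]].

Hypothesis hk : 0 < k.
Hypothesis hc : 0 < c.
Hypothesis hU : 0 < U.
Hypothesis hW0 : (0 <= W0)%Z.
Hypothesis hG : simple_digraph (WGraph n E).
Hypothesis hW : forall a w, In (a, w) E -> (Z.abs w <= W0)%Z.
Hypothesis hb : (0 <= b)%Z.
Hypothesis hB : (Z.of_nat (n + M + Q + D + k + c + HUB + 10)
                 + Z.of_nat (k + 1) * (2 * Z0) + 3 * Z0 + X + 2 * W0 <= B)%Z.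
Hypothesis hB2 : forall x, (Z.abs x <= Z.of_nat (D + k + c + 4) -> 2 * (x * x) <= B)%Z.

Ltac get_env H := destruct H as [? ? ? ? ? ? ? ? ? ? ? ? ? ? ? ? ? ? ? ? ?henva ?henvp].

Lemma kZ_nonneg : (0 <= Z.of_nat (k + 1) * (2 * Z0))%Z.
Proof.
  clear -hk hc hU hW0.
  pose proof (lZ0_pos k c U n W0 hk hc hU hW0). apply Z.mul_nonneg_nonneg; lia.
Qed.

Ltac signs :=
  pose proof (lZ0_pos k c U n W0 hk hc hU hW0) as HZ0;
  pose proof (lX_pos k c U n hk hc hU) as HX;
  pose proof kZ_nonneg as HkZ.

Lemma V_pos : 0 < V.
Proof. unfold lV. nia. Qed.

Lemma V_le_D : V <= D.
Proof. unfold lD. nia. Qed.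

Lemma mu_le j : lmu c U j <= V.
Proof.
  unfold lmu, lV. pose proof (Nat.mod_upper_bound j U ltac:(lia)). nia.
Qed.

(** Array 8 still holds the layers of the previous code, so all [V] residues are cleared first, at
    polylogarithmic cost. Writing the layers in increasing order lets the last one win, exactly as
    in [layf]. *)
Lemma pdecode_spec j s : env s -> j < Q -> reg s 29 = Z.of_nat j ->
  wp B pdecode (3 * V + 8 * k + 8) (fun s' =>
    reg s' 34 = Z.of_nat (lmu c U j) /\
    (forall y, y < V -> arr s' 8 (Z.of_nat y) = Z.of_nat (lay k c U j y)) /\
    (forall i, i < k -> arr s' 9 (Z.of_nat i) = Z.of_nat (hres c U j i))) s.
Proof.
  intros He Hj E29. pose proof V_pos as HV. pose proof V_le_D as HVD. pose proof (mu_le j) as Hmu.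
  pose proof (Nat.mod_upper_bound j U ltac:(lia)) as HjU.
  assert (U <= V) by (unfold lV; nia).
  assert (Hq : j / U <= j) by apply div_le_self.
  signs.
  unfold pdecode.
  apply (wp_le (4 + (1 + ((V * 3 + 1) + (1 + (k * 8 + 1)))))); [| lia].
  pose proof He as He'. get_env He'. cbn [Nat.add].
  op (Z.of_nat (j mod U)); [now rewrite Nat2Z.inj_mod |].
  op (Z.of_nat (j mod U + 1)).
  op (Z.of_nat (lmu c U j)); [unfold lmu; lia |].
  op (Z.of_nat (j / U)); [now rewrite Nat2Z.inj_div |].
  cst.
  apply wp_seq.
  eapply wp_conseq; [apply (wp_for _ _ _ _ 2 V (fun i s' =>
     reg s' 35 = Z.of_nat i /\
     forall y, y < i -> arr s' 8 (Z.of_nat y) = 0%Z)) | lia |].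
  - split; [reflexivity | lia].
  - intros i s1 Hi [I1 I2] F. apply env_frame in F as He1; [| keep | env_tac].
    pose proof He1 as He1'. get_env He1'. split; [lia |].
    wr (Z.of_nat i) 0%Z.
    op (Z.of_nat (S i)).
    split; [reflexivity |]. intros y Hy. cbn.
    destruct (Z.eqb_spec (Z.of_nat y) (Z.of_nat i)); [reflexivity | apply I2; lia].
  - intros s1 [I1 _] F. rewrite I1. rewrite (proj1 F 9 eq_refl). use_regs. lia.
  - intros s1 [[I1 I2] F].
    assert (He1 : env s1).
    { eapply env_frame; [| exact F |]; [keep |].
      env_tac. }
    assert (E36 : reg s1 36 = Z.of_nat (j / U)) by (rewrite (proj1 F 36 eq_refl); reflexivity).
    assert (E34 : reg s1 34 = Z.of_nat (lmu c U j)) by (rewrite (proj1 F 34 eq_refl); reflexivity).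
    clear F. cst.
    eapply wp_conseq; [apply (wp_for _ _ _ _ 7 k (fun i s' =>
      reg s' 35 = Z.of_nat i /\
      reg s' 36 = Z.of_nat (j / U / D ^ i) /\
      (forall y, y < V -> arr s' 8 (Z.of_nat y) = Z.of_nat (layf (res c U j) i y)) /\
      (forall i', i' < i -> arr s' 9 (Z.of_nat i') = Z.of_nat (hres c U j i')))) | lia |].
    + split; [reflexivity |]. split; [cbn [Nat.pow]; rewrite Nat.div_1_r; exact E36 |].
      split; [exact I2 | lia].
    + intros i s2 Hi (J1 & J2 & J3 & J4) F.
      assert (He2 : env s2).
      { eapply env_frame; [| exact F |]; [keep |].
        env_tac. }
      pose proof He2 as He2'. get_env He2'. split; [lia |].
      assert (Hq' : j / U / D ^ i <= j / U)
        by apply div_le_self.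
      assert (Hx : digit c U j i < D) by (apply Nat.mod_upper_bound; lia).
      assert (Hr : res c U j i < V) by (apply Nat.mod_upper_bound; lia).
      assert (Hh : hres c U j i <= digit c U j i)
        by apply div_le_self.
      op (Z.of_nat (digit c U j i)); [unfold digit; now rewrite Nat2Z.inj_mod |].
      assert (Hq2 : j / U / D ^ S i <= j / U)
        by apply div_le_self.
      op (Z.of_nat (j / U / D ^ S i)).
      { now rewrite <- Nat2Z.inj_div, Nat.Div0.div_div, (Nat.mul_comm (D ^ i) D). }
      op (Z.of_nat (res c U j i)); [unfold res; now rewrite Nat2Z.inj_mod |].
      op (Z.of_nat (hres c U j i)); [unfold hres; now rewrite Nat2Z.inj_div |].
      wr (Z.of_nat i) (Z.of_nat (hres c U j i)).
      op (Z.of_nat (S i)).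
      wr (Z.of_nat (res c U j i)) (Z.of_nat (S i)).
      split; [reflexivity |]. split; [reflexivity |]. split.
      * intros y Hy. cbn [arr set_arr set_reg Nat.eqb andb layf].
        destruct (Nat.eqb_spec y (res c U j i)) as [-> | Hne].
        -- now rewrite Z.eqb_refl.
        -- destruct (Z.eqb_spec (Z.of_nat y) (Z.of_nat (res c U j i))); [lia |]. now apply J3.
      * intros i' Hi'. cbn [arr set_arr set_reg Nat.eqb andb].
        destruct (Z.eqb_spec (Z.of_nat i') (Z.of_nat i)) as [Eq | Hne].
        -- now assert (i' = i) as -> by lia.
        -- apply J4. lia.
    + intros s2 (J1 & _) F. rewrite J1. rewrite (proj1 F 4 eq_refl). cbn.
      get_env He1. lia.
    + intros s2 [(J1 & J2 & J3 & J4) F]. repeat split; [| exact J3 | exact J4].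
      rewrite (proj1 F 34 eq_refl). exact E34.
Qed.

Hypothesis hlen : (Z.of_nat (HUB + n0 + k * (M / c + 1)) <= b)%Z.

Lemma pstar_spec off s : env s -> (0 <= off)%Z -> (off + (2 * b + 1) <= B)%Z ->
  reg s 22 = off -> loaded b off [] s ->
  wp B pstar (7 * HUB + 5) (fun s' => loaded b off (star k n0 Z0) s' /\
    reg s' 23 = Z.of_nat (length (star k n0 Z0))) s.
Proof.
  intros He Ho HoB E22 HL.
  signs.
  assert (HkZ' : (Z.of_nat (k + 1) * (2 * Z0) = 2 * (Z.of_nat (k + 1) * Z0))%Z) by lia.
  pose proof He as He'. get_env He'. unfold pstar.
  apply (wp_le (4 + (HUB * 7 + 1))); [| lia].
  cbn [Nat.add]. cst. cst.
  op (Z.of_nat HUB). op (Z.of_nat (k + 1) * Z0)%Z.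
  eapply wp_conseq; [apply (wp_for _ _ _ _ 6 HUB (fun i s' =>
    let es := map (fun x => (x, HUB, Z.of_nat (k + 1) * Z0)%Z) (seq 0 i) in
    reg s' 24 = Z.of_nat i /\ reg s' 25 = Z.of_nat HUB /\
    reg s' 26 = (Z.of_nat (k + 1) * Z0)%Z /\
    loaded b off es s' /\ reg s' 23 = Z.of_nat (length es))) | lia |].
  - cbn zeta. repeat split; try reflexivity. exact HL.
  - intros i s1 Hi (I1 & I2 & I3 & I4 & I5) F.
    assert (He1 : env s1) by (eapply env_frame; [| exact F |]; [keep | env_tac]).
    assert (G22 : reg s1 22 = off) by (rewrite (proj1 F 22 eq_refl); exact E22).
    pose proof (env18 _ He1) as G18. pose proof (env3 _ He1) as G3.
    split; [lia |].
    rewrite length_map, length_seq in I5.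
    apply (wp_seq 5 1). eapply wp_conseq;
      [apply wp_frame, (emit_spec B b off) with (x := i) (y := HUB)
         (w := (Z.of_nat (k + 1) * Z0)%Z) (es := map (fun x => (x, HUB, Z.of_nat (k + 1) * Z0)%Z) (seq 0 i)); eauto
      | lia |].
    + rewrite length_map, length_seq. lia.
    + rewrite length_map, length_seq. exact I5.
    + intros s2 [[J1 J2] F2].
      pose proof (proj1 F2 24 eq_refl) as R24. pose proof (proj1 F2 25 eq_refl) as R25.
      pose proof (proj1 F2 26 eq_refl) as R26. pose proof (proj1 F2 3 eq_refl) as R3.
      rewrite I1 in R24. rewrite I2 in R25. rewrite I3 in R26. rewrite G3 in R3.
      op (Z.of_nat (S i)).
      cbn zeta. rewrite seq_S, map_app. repeat split; try assumption.
  - intros s1 (I1 & _) F. rewrite I1, (proj1 F 18 eq_refl). use_regs. lia.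
  - intros s1 [(I1 & I2 & I3 & I4 & I5) F]. split; assumption.
Qed.

Lemma pdirect_spec off tau es s : env s -> (0 <= off)%Z -> (off + (2 * b + 1) <= B)%Z ->
  (Z.abs tau <= B)%Z -> length es <= HUB ->
  reg s 22 = off -> reg s 27 = tau -> reg s 23 = Z.of_nat (length es) -> loaded b off es s ->
  wp B pdirect (8 * n0 + 3) (fun s' => loaded b off (es ++ direct k n0 tau) s' /\
    reg s' 23 = Z.of_nat (length (es ++ direct k n0 tau))) s.
Proof.
  intros He Ho HoB Htau Hes E22 E27 E23 HL.
  signs.
  pose proof He as He'. get_env He'. unfold pdirect.
  apply (wp_le (2 + (n0 * 8 + 1))); [| lia].
  assert (Hhub : HUB = k * n0 + n0) by (unfold hub; lia).
  cbn [Nat.add]. cst. op tau.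
  eapply wp_conseq; [apply (wp_for _ _ _ _ 7 n0 (fun i s' =>
    let es' := es ++ map (fun v => (v, v + k * n0, tau)) (seq 0 i) in
    reg s' 24 = Z.of_nat i /\ reg s' 26 = tau /\
    loaded b off es' s' /\ reg s' 23 = Z.of_nat (length es'))) | lia |].
  - cbn zeta. cbn [seq map]. rewrite app_nil_r. repeat split; try reflexivity; assumption.
  - intros i s1 Hi (I1 & I3 & I4 & I5) F.
    assert (He1 : env s1) by (eapply env_frame; [| exact F |]; [keep | env_tac]).
    assert (G22 : reg s1 22 = off) by (rewrite (proj1 F 22 eq_refl); exact E22).
    pose proof (env12 _ He1) as G12. pose proof (env3 _ He1) as G3.
    pose proof (env20 _ He1) as G20.
    split; [lia |].
    op (Z.of_nat (i + k * n0)).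
    apply (wp_seq 5 1). eapply wp_conseq;
      [apply wp_frame, (emit_spec B b off) with (x := i) (y := i + k * n0)
         (w := tau) (es := es ++ map (fun v => (v, v + k * n0, tau)) (seq 0 i)); use_regs; eauto
      | lia |].
    + rewrite length_app, length_map, length_seq. lia.
    + intros s2 [[J1 J2] F2].
      pose proof (proj1 F2 24 eq_refl) as R24.
      pose proof (proj1 F2 26 eq_refl) as R26. pose proof (proj1 F2 3 eq_refl) as R3.
      cbn [reg set_reg Nat.eqb] in R24, R26, R3.
      rewrite I1 in R24. rewrite I3 in R26. rewrite G3 in R3.
      op (Z.of_nat (S i)).
      cbn zeta. rewrite seq_S, map_app, app_assoc. repeat split; try assumption.
  - intros s1 (I1 & _) F. rewrite I1, (proj1 F 12 eq_refl). use_regs. lia.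
  - intros s1 [(I1 & I3 & I4 & I5) F]. split; assumption.
Qed.

Section Layer.
Variables (j : nat) (off : Z).
Hypothesis Ho : (0 <= off)%Z.
Hypothesis HoB : (off + (2 * b + 1) <= B)%Z.
Notation mu := (lmu c U j).
Notation layj := (lay k c U j).

Definition ctx (s : state) : Prop :=
  env s /\ reg s 22 = off /\ reg s 34 = Z.of_nat mu /\
  (forall y, y < V -> arr s 8 (Z.of_nat y) = Z.of_nat (layj y)) /\
  (forall i, i < k -> arr s 9 (Z.of_nat i) = Z.of_nat (hres c U j i)).

Lemma hres_le i : hres c U j i <= D.
Proof.
  transitivity (digit c U j i); [apply div_le_self |].
  apply Nat.lt_le_incl, Nat.mod_upper_bound. pose proof V_pos. pose proof V_le_D. lia.
Qed.

Lemma square_bound x : (Z.abs x <= Z.of_nat (D + k + c + 4) -> 0 <= x * x /\ 2 * (x * x) <= B)%Z.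
Proof. intros H. split; [apply Z.square_nonneg | auto]. Qed.

Lemma player_body_spec e u v w es s :
  ctx s -> nth_error E e = Some (u, v, w) -> reg s 35 = Z.of_nat e ->
  (Z.of_nat (length es) <= b)%Z -> reg s 23 = Z.of_nat (length es) -> loaded b off es s ->
  wp B player_body 36 (fun s' => loaded b off (es ++ ledge k c U n W0 E j e) s' /\
    reg s' 23 = Z.of_nat (length (es ++ ledge k c U n W0 E j e))) s.
Proof.
  intros (He & E22 & E34 & A8 & A9) En E35 Hes E23 HL.
  signs.
  pose proof He as He'. get_env He'.
  pose proof (nth_error_In _ _ En) as Hin.
  pose proof (hW _ _ Hin) as Hw. pose proof (edge_lt n E hG _ _ _ Hin) as (Hu & Hv & Huv).
  pose proof (lmu_pos k c U hk hc hU j) as Hmu. pose proof (mu_le j) as HmuV.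
  pose proof V_pos as HV. pose proof V_le_D as HVD.
  destruct (henva e u v w En) as (A3 & A4 & A2).
  assert (He_lt : e < M) by (apply nth_error_Some; congruence).
  pose proof (Nat.mod_upper_bound u mu ltac:(lia)) as Hmu1.
  pose proof (Nat.mod_upper_bound v mu ltac:(lia)) as Hmv1.
  pose proof (lay_le k c U j (u mod mu)) as Hlu. pose proof (lay_le k c U j (v mod mu)) as Hlv.
  unfold player_body.
  rd (Z.of_nat u); [exact A3 |].
  rd (Z.of_nat v); [exact A4 |].
  op (Z.of_nat (u mod mu)); [now rewrite Nat2Z.inj_mod |].
  op (Z.of_nat (v mod mu)); [now rewrite Nat2Z.inj_mod |].
  rd (Z.of_nat (layj (u mod mu))); [apply A8; lia |].
  rd (Z.of_nat (layj (v mod mu))); [apply A8; lia |].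
  unfold ledge. rewrite En.
  destruct (layj (u mod mu)) as [| i] eqn:El.
  { apply wp_if; simpl_state; [lia | intros _]. apply wp_skip. rewrite app_nil_r.
    split; [exact HL | exact E23]. }
  apply wp_if; simpl_state; [intros _ | lia].
  assert (Hi : i < k) by lia.
  pose proof (Nat.mod_upper_bound (S i) k ltac:(lia)) as Hmk.
  pose proof (hres_le i) as Hhr.
  pose proof (Nat.mod_upper_bound e c ltac:(lia)) as Hec.
  set (d1 := (Z.of_nat (layj (v mod mu)) - Z.of_nat (S i mod k + 1))%Z).
  set (d2 := (Z.of_nat (hres c U j i) - Z.of_nat (e mod c))%Z).
  destruct (square_bound d1) as [Hd1 Hd1']; [unfold d1; lia |].
  destruct (square_bound d2) as [Hd2 Hd2']; [unfold d2; lia |].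
  op (Z.of_nat (S i mod k)); [now rewrite Nat2Z.inj_mod |].
  op (Z.of_nat (S i mod k + 1)).
  op d1. op (d1 * d1)%Z.
  op (Z.of_nat i).
  rd (Z.of_nat (hres c U j i)); [now apply A9 |].
  op (Z.of_nat (e mod c)); [now rewrite Nat2Z.inj_mod |].
  op d2. op (d2 * d2)%Z. op (d1 * d1 + d2 * d2)%Z.
  assert (Hcond : ((layj (v mod mu) =? S i mod k + 1) && (hres c U j i =? e mod c))%bool = true
    <-> (d1 * d1 + d2 * d2 < 1)%Z).
  { rewrite andb_true_iff, !Nat.eqb_eq, <- squares_lt_1. unfold d1, d2. lia. }
  apply wp_if; simpl_state; intros Hc.
  - rewrite (proj2 Hcond) by lia.
    pose proof (step_weight_bounds k c U n W0 hk hc hU hW0 u i w Hu Hi Hw) as Hst.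
    pose proof (label_lt k c U n hk hc hU j u Hu) as Lu.
    pose proof (label_lt k c U n hk hc hU j v Hv) as Lv.
    assert (Hx : i * n0 + u / mu < HUB) by (apply label_lt_hub; lia).
    assert (Hy : S i * n0 + v / mu < HUB) by (apply label_lt_hub; lia).
    assert (HwX : (0 <= (w + W0) * X)%Z) by (apply Z.mul_nonneg_nonneg; lia).
    assert (HuY : (0 <= Z.of_nat (u * Y ^ i))%Z) by lia.
    unfold pedge.
    op (Z.of_nat (u / mu)); [now rewrite Nat2Z.inj_div |].
    op (Z.of_nat (i * n0)).
    op (Z.of_nat (i * n0 + u / mu)).
    op (Z.of_nat (v / mu)); [now rewrite Nat2Z.inj_div |].
    op (Z.of_nat (S i * n0)).
    op (Z.of_nat (S i * n0 + v / mu)).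
    rd w; [exact A2 |].
    op (w + W0)%Z.
    op ((w + W0) * X)%Z.
    rd (Z.of_nat (Y ^ i)); [now apply henvp |].
    op (Z.of_nat (u * Y ^ i)).
    op ((w + W0) * X + Z.of_nat (u * Y ^ i))%Z.
    op (2 * Z0 + ((w + W0) * X + Z.of_nat (u * Y ^ i)))%Z.
    eapply wp_conseq; [apply (emit_spec B b off es (i * n0 + u / mu) (S i * n0 + v / mu));
      use_regs; try reflexivity; try assumption; lia | lia |].
    intros s' H'. exact H'.
  - destruct (_ && _)%bool; [exfalso; lia |].
    apply wp_skip. rewrite app_nil_r. split; [exact HL | exact E23].
Qed.

Lemma ctx_frame cm s s' : keeps cm -> frame cm s s' ->
  writes cm 22 = false -> writes cm 34 = false ->
  writesa cm 8 = false -> writesa cm 9 = false -> ctx s -> ctx s'.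
Proof.
  intros K F H1 H2 H3 H4 (A & B1 & B2 & B3 & B4).
  split; [| split; [| split; [| split]]].
  - eapply env_frame; eassumption.
  - rewrite (proj1 F) by assumption. assumption.
  - rewrite (proj1 F) by assumption. assumption.
  - intros y Hy. rewrite (proj2 F) by assumption. auto.
  - intros i Hi. rewrite (proj2 F) by assumption. auto.
Qed.

Lemma player_spec es s : ctx s -> length es <= HUB + n0 ->
  reg s 23 = Z.of_nat (length es) -> loaded b off es s ->
  wp B player (38 * M + 2) (fun s' => loaded b off (es ++ layered k c U n W0 E j M) s' /\
    reg s' 23 = Z.of_nat (length (es ++ layered k c U n W0 E j M))) s.
Proof.
  intros Hctx Hes E23 HL. unfold player.
  apply (wp_le (1 + (M * 38 + 1))); [| lia].
  signs.
  cbn [Nat.add]. cst.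
  eapply wp_conseq; [apply (wp_for _ _ _ _ 37 M (fun i s' =>
    reg s' 35 = Z.of_nat i /\
    loaded b off (es ++ layered k c U n W0 E j i) s' /\
    reg s' 23 = Z.of_nat (length (es ++ layered k c U n W0 E j i)))) | lia |].
  - cbn [layered seq flat_map]. rewrite app_nil_r. repeat split; assumption.
  - intros e s1 Hlt (I1 & I2 & I3) F.
    assert (Hctx1 : ctx s1).
    { eapply ctx_frame; [| exact F | | | | |]; [keep | reflexivity .. |].
      destruct Hctx as (A & B1 & B2 & B3 & B4).
      split; [env_tac | auto]. }
    pose proof (env1 _ (proj1 Hctx1)) as G1. split; [lia |].
    destruct (nth_error E e) as [[[u v] w] |] eqn:En;
      [| apply nth_error_None in En; lia].
    apply (wp_seq 36 1). eapply wp_conseq;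
      [apply wp_frame, (player_body_spec e u v w (es ++ layered k c U n W0 E j e) s1 Hctx1 En I1) | lia |];
      [| exact I3 | exact I2 |].
    + rewrite length_app.
      pose proof (length_layered k c U n W0 E hk hc hU j e).
      pose proof (Nat.Div0.div_le_mono e M c ltac:(lia)).
      assert (k * (e / c + 1) <= k * (M / c + 1)) by (apply Nat.mul_le_mono_l; lia). lia.
    + intros s2 [[J1 J2] F2].
      pose proof (proj1 F2 35 eq_refl) as R35. rewrite I1 in R35.
      pose proof (proj1 F2 3 eq_refl) as R3. rewrite (env3 _ (proj1 Hctx1)) in R3.
      op (Z.of_nat (S e)).
      rewrite layered_S, app_assoc. repeat split; assumption.
  - intros s1 (I1 & _) F. rewrite I1, (proj1 F 1 eq_refl). simpl_state.
    rewrite (env1 _ (proj1 Hctx)). lia.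
  - intros s1 [(I1 & I2 & I3) F]. split; assumption.
Qed.

End Layer.

Notation Hg j := (gadget k n0 Z0 (layered k c U n W0 E j M)).
Notation tau0 := (Z.of_nat k * (2 * Z0))%Z.

Variable T : nat.
Hypothesis hN2 : (Z.of_nat (S HUB * S HUB) <= b)%Z.
Hypothesis hNW : (Z.of_nat (S HUB) + Z.of_nat (k + 1) * (2 * Z0) <= b)%Z.
Hypothesis hP : forall j tau, j < Q ->
  (tau0 <= tau <= Z.of_nat (k + 1) * (2 * Z0))%Z ->
  exists t s', exec b P (init (Hg j tau)) t s' /\ t <= T /\
    is_wiener_index (Hg j tau) (reg s' 0).

Lemma gadget_length j tau : length (edges (Hg j tau)) <= HUB + n0 + k * (M / c + 1).
Proof.
  clear -hk hc hU.
  cbn [gadget edges]. unfold star, direct. rewrite !length_app, !length_map, !length_seq.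
  pose proof (length_layered k c U n W0 E hk hc hU j M). lia.
Qed.

Definition body_time : nat :=
  (3 * V + 8 * k + 8) + ((7 * HUB + 5) + ((8 * n0 + 3) + ((38 * M + 2)
    + ((2 * T + nregs P + 7) + 1)))).

Lemma psum_body_spec j tau off s : env s -> j < Q -> reg s 29 = Z.of_nat j ->
  (tau0 <= tau <= Z.of_nat (k + 1) * (2 * Z0))%Z -> reg s 27 = tau ->
  (0 <= off)%Z -> (off + (2 * b + 1) <= B)%Z -> reg s 22 = off -> loaded b off [] s ->
  (Z.abs (reg s 28) + b <= B)%Z ->
  wp B (psum_body P) body_time (fun s' => exists x, is_wiener_index (Hg j tau) x /\
    (Z.abs x <= b)%Z /\ reg s' 28 = (reg s 28 + x)%Z /\ reg s' 29 = Z.of_nat (S j) /\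
    reg s' 22 = (off + (2 * b + 1))%Z /\ loaded b (off + (2 * b + 1)) [] s') s.
Proof.
  intros He Hj E29 Ht E27 Ho HoB E22 HL H28.
  signs.
  unfold psum_body, body_time.
  apply wp_seq. eapply wp_conseq;
    [apply wp_frame, (pdecode_spec j s He Hj E29) | lia |].
  intros s1 ((A1 & A2 & A3) & F1).
  assert (He1 : env s1) by (eapply env_frame; [| exact F1 | exact He]; keep).
  assert (Hctx1 : ctx j off s1).
  { split; [exact He1 |]. split; [rewrite (proj1 F1 22 eq_refl); exact E22 | auto]. }
  assert (HL1 : loaded b off [] s1).
  { intros a i Hi. rewrite (proj2 F1 (10 + a)) by reflexivity. now apply HL. }
  apply wp_seq. eapply wp_conseq;
    [apply wp_frame, (pstar_spec off s1 He1 Ho HoB (proj1 (proj2 Hctx1)) HL1) | lia |].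
  intros s2 ((B1 & B2) & F2).
  assert (Hctx2 : ctx j off s2) by (eapply ctx_frame; [| exact F2 | reflexivity .. | exact Hctx1]; keep).
  apply wp_seq. eapply wp_conseq;
    [apply wp_frame, (pdirect_spec off tau (star k n0 Z0) s2 (proj1 Hctx2) Ho HoB) | lia |].
  { lia. }
  { unfold star. rewrite length_map, length_seq. lia. }
  { exact (proj1 (proj2 Hctx2)). }
  { rewrite (proj1 F2 27 eq_refl), (proj1 F1 27 eq_refl). exact E27. }
  { exact B2. }
  { exact B1. }
  intros s3 ((C1 & C2) & F3).
  assert (Hctx3 : ctx j off s3) by (eapply ctx_frame; [| exact F3 | reflexivity .. | exact Hctx2]; keep).
  apply wp_seq. eapply wp_conseq;
    [apply wp_frame, (player_spec j off Ho HoB (star k n0 Z0 ++ direct k n0 tau) s3 Hctx3) | lia |].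
  { unfold star, direct. rewrite length_app, !length_map, !length_seq. lia. }
  { exact C2. }
  { exact C1. }
  intros s4 ((D1 & D2) & F4).
  assert (Hctx4 : ctx j off s4) by (eapply ctx_frame; [| exact F4 | reflexivity .. | exact Hctx3]; keep).
  rewrite <- app_assoc in D1, D2.
  destruct (hP j tau Hj Ht) as (t & sP & HeP & HtP & HxP).
  pose proof (gadget_instance k c U n W0 E hk hc hU hW0 hG hW j tau Ht) as [[HsimP _] _].
  assert (G28 : reg s4 28 = reg s 28).
  { rewrite (proj1 F4 28 eq_refl), (proj1 F3 28 eq_refl), (proj1 F2 28 eq_refl),
      (proj1 F1 28 eq_refl). reflexivity. }
  assert (G29 : reg s4 29 = Z.of_nat j).
  { rewrite (proj1 F4 29 eq_refl), (proj1 F3 29 eq_refl), (proj1 F2 29 eq_refl),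
      (proj1 F1 29 eq_refl). exact E29. }
  destruct Hctx4 as (He4 & G22 & _).
  pose proof He4 as He4'. get_env He4'.
  apply wp_seq. eapply wp_conseq;
    [apply wp_frame, (pcall_spec P B b off (S HUB) (Z.to_nat (Z.of_nat (k + 1) * (2 * Z0))) t sP s4
      (star k n0 Z0 ++ direct k n0 tau ++ layered k c U n W0 E j M)) | lia |].
  { exact HsimP. }
  { intros a w Hin. rewrite Z2Nat.id by exact HkZ.
    pose proof (gadget_weights k c U n W0 E hk hc hU hW0 hG hW j tau a w Ht Hin). lia. }
  { exact Ho. }
  { exact HoB. }
  { lia. }
  { exact hN2. }
  { exact HeP. }
  { rewrite G28. exact H28. }
  { assumption. }
  { assumption. }
  { lia. }
  { assumption. }
  { exact G22. }
  { exact D2. }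
  { exact D1. }
  intros s5 ((K1 & K2 & K3 & K4) & F5).
  pose proof (writes_pcall P 29 ltac:(lia) ltac:(lia) ltac:(lia) ltac:(lia)) as W29.
  pose proof (proj1 F5 29 W29) as R29. rewrite G29 in R29.
  pose proof (env_frame _ _ _ (keeps_pcall P) F5 He4) as He5.
  pose proof (env3 _ He5) as R3.
  op (Z.of_nat (S j)).
  exists (reg sP 0). rewrite G28 in K1. repeat split; assumption.
Qed.

Lemma keeps_psum_body : keeps (psum_body P).
Proof.
  unfold psum_body. do 4 (apply keeps_seq; [keep |]).
  apply keeps_seq; [apply keeps_pcall | keep].
Qed.

(** Each of the [Q] runs consumes a window of [2 * b + 1] cells, one for every index from [-b] to
    [b]; the last clause hands an empty region to the next sum. *)
Lemma psum_spec tau off s : env s ->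
  (tau0 <= tau <= Z.of_nat (k + 1) * (2 * Z0))%Z -> reg s 27 = tau ->
  (0 <= off)%Z -> (off + Z.of_nat Q * (2 * b + 1) <= B)%Z -> (Z.of_nat (S Q) * b <= B)%Z ->
  reg s 22 = off -> loaded b off [] s ->
  wp B (psum P) (Q * S body_time + 3) (fun s' => exists wi,
    (forall j, j < Q -> is_wiener_index (Hg j tau) (wi j)) /\
    reg s' 28 = sum_upto wi Q /\ (Z.abs (reg s' 28) <= Z.of_nat Q * b)%Z /\
    reg s' 22 = (off + Z.of_nat Q * (2 * b + 1))%Z /\
    loaded b (off + Z.of_nat Q * (2 * b + 1)) [] s') s.
Proof.
  intros He Ht E27 Ho HoB HQB E22 HL.
  signs.
  unfold psum.
  replace (Q * S body_time + 3) with (S (S (Q * S body_time + 1))) by lia.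
  cst. cst.
  eapply wp_conseq; [apply (wp_for _ _ _ _ body_time Q (fun j s' => exists wi,
    (forall i, i < j -> is_wiener_index (Hg i tau) (wi i)) /\
    reg s' 28 = sum_upto wi j /\ (Z.abs (reg s' 28) <= Z.of_nat j * b)%Z /\
    reg s' 29 = Z.of_nat j /\
    reg s' 27 = tau /\
    reg s' 22 = (off + Z.of_nat j * (2 * b + 1))%Z /\
    loaded b (off + Z.of_nat j * (2 * b + 1)) [] s')) | lia |].
  - exists (fun _ => 0%Z). simpl_state.
    rewrite Z.mul_0_l, Z.add_0_r. repeat split; try assumption; try reflexivity; lia.
  - intros j s1 Hj (wi & I1 & I2 & I3 & I4 & I5 & I6 & I7) F.
    assert (He1 : env s1) by (eapply env_frame; [apply keeps_psum_body | exact F | env_tac]).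
    pose proof (env11 _ He1) as G11. split; [lia |].
    assert (Hmono : (off + Z.of_nat j * (2 * b + 1) + (2 * b + 1) <= B)%Z).
    { assert (Z.of_nat (S j) * (2 * b + 1) <= Z.of_nat Q * (2 * b + 1))%Z
        by (apply Z.mul_le_mono_nonneg_r; lia). lia. }
    assert (Hoff : (0 <= Z.of_nat j * (2 * b + 1))%Z) by (apply Z.mul_nonneg_nonneg; lia).
    assert (Hacc : (Z.of_nat j * b + b <= Z.of_nat (S Q) * b)%Z).
    { assert (Z.of_nat (S j) * b <= Z.of_nat (S Q) * b)%Z
        by (apply Z.mul_le_mono_nonneg_r; lia). lia. }
    eapply wp_conseq;
      [apply wp_frame, (psum_body_spec j tau (off + Z.of_nat j * (2 * b + 1)) s1 He1 Hj I4 Ht I5)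
      | lia |]; [lia | exact Hmono | exact I6 | exact I7 | lia |].
    intros s2 [(x & J1 & J2 & J3 & J4 & J5 & J6) F2].
    exists (fun i => if i =? j then x else wi i).
    replace (off + Z.of_nat (S j) * (2 * b + 1))%Z
      with (off + Z.of_nat j * (2 * b + 1) + (2 * b + 1))%Z by lia.
    repeat split; try assumption.
    + intros i Hi. destruct (Nat.eqb_spec i j) as [-> | Hne]; [exact J1 | apply I1; lia].
    + rewrite sum_upto_S, Nat.eqb_refl, J3, I2. f_equal. apply sum_upto_ext.
      intros i Hi. destruct (Nat.eqb_spec i j); [lia | reflexivity].
    + lia.
    + rewrite (proj1 F2 27); [exact I5 |].
      unfold psum_body. cbn [writes]. rewrite writes_pcall by lia. reflexivity.
  - intros s1 (wi & _ & _ & _ & I4 & _) F.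
    assert (He1 : env s1) by (eapply env_frame; [apply keeps_psum_body | exact F | env_tac]).
    rewrite I4, (env11 _ He1). apply Z.le_refl.
  - intros s1 [(wi & I1 & I2 & I3 & I4 & I5 & I6 & I7) F]. exists wi.
    split; [exact I1 |]. split; [exact I2 |]. split; [exact I3 |]. split; assumption.
Qed.

Lemma keeps_psum : keeps (psum P).
Proof.
  unfold psum. do 2 (apply keeps_seq; [keep |]). apply keeps_while, keeps_psum_body.
Qed.

Lemma writes_psum r : In r [27; 30; 31; 32; 33] -> writes (psum P) r = false.
Proof.
  intros H. repeat (destruct H as [<- | H]; [unfold psum, psum_body; cbn [writes];
    rewrite writes_pcall by lia; reflexivity |]). destruct H.
Qed.

(** * Binary search for the minimum cost and decoding of the cycle *)

Variables (L p : nat).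
Hypothesis hL : n + 1 <= 2 ^ L.
Hypothesis hUL : L * (k * k) + 2 <= U.
Hypothesis hp : (Z0 <= 2 ^ Z.of_nat p)%Z.
Hypothesis hoff : (Z.of_nat (p + 1) * (Z.of_nat Q * (2 * b + 1)) <= B)%Z.
Hypothesis hQb : (2 * (Z.of_nat (S Q) * b) <= B)%Z.
Hypothesis hB3 : (2 * (Z.of_nat Q * (Z.of_nat n0 * Z0)) <= B)%Z.

Notation ctot0 us ws := (ctot k n W0 0 us ws).

(** Equality with [tau0 + Z0] records that the upper end has never been lowered; until then the
    existence of a cycle is open. *)
Definition bracket (lo hi : Z) : Prop :=
  (forall us ws, kcyc k E us ws -> lo <= tau0 + ctot0 us ws)%Z /\
  (hi = tau0 + Z0 \/ exists us ws, kcyc k E us ws /\ tau0 + ctot0 us ws < hi)%Z.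

Definition search_time : nat := Q * S body_time + 3.

Lemma psearch_spec s : env s -> reg s 22 = 0%Z -> loaded b 0 [] s ->
  wp B (psearch P) (p * (search_time + 12) + search_time + 6) (fun s' =>
    env s' /\ exists lo, (tau0 <= lo < tau0 + Z0)%Z /\
    reg s' 30 = lo /\ reg s' 31 = (lo + 1)%Z /\ bracket lo (lo + 1)) s.
Proof.
  intros He E22 HL.
  signs.
  assert (Htau0 : (0 <= tau0)%Z) by (apply Z.mul_nonneg_nonneg; lia).
  assert (HkS : (Z.of_nat (k + 1) * (2 * Z0) = tau0 + 2 * Z0)%Z) by lia.
  assert (HQb0 : (0 <= Z.of_nat Q * b)%Z) by (apply Z.mul_nonneg_nonneg; lia).
  assert (HQs0 : (0 <= Z.of_nat Q * (2 * b + 1))%Z) by (apply Z.mul_nonneg_nonneg; lia).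
  assert (Hoffi : forall i, i <= p + 1 -> (Z.of_nat i * (Z.of_nat Q * (2 * b + 1)) <= B)%Z).
  { intros i Hi. eapply Z.le_trans; [| exact hoff]. apply Z.mul_le_mono_nonneg_r; lia. }
  assert (HQ1 : (Z.of_nat (S Q) * b = Z.of_nat Q * b + b)%Z) by lia.
  unfold psearch, search_time.
  apply (wp_le (1 + ((Q * S body_time + 3) + (4 + (p * S (Q * S body_time + 3 + 11) + 1))))); [| lia].
  pose proof He as He'. get_env He'.
  cbn [Nat.add]. op (Z.of_nat k * (2 * Z0))%Z.
  apply wp_seq. eapply wp_conseq; [apply wp_frame, (psum_spec tau0 0) | apply le_n |].
  { env_tac. } { lia. } { reflexivity. } { lia. } { specialize (Hoffi 1 ltac:(lia)); lia. }
  { lia. } { exact E22. } { exact HL. }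
  intros s1 ((wi0 & Hwi0 & A28 & Ab & A22 & AL) & F).
  assert (He1 : env s1) by (eapply env_frame; [apply keeps_psum | exact F | env_tac]).
  clear dependent s. pose proof He1 as He1'. get_env He1'.
  cbn [Nat.add].
  op (sum_upto wi0 Q).
  op (Z.of_nat k * (2 * Z0))%Z. op (tau0 + Z0)%Z. op (lZ0 k n W0).
  eapply wp_conseq; [apply (wp_while _ _ _ _ (Q * S body_time + 3 + 11) (fun q s => env s /\
    exists lo hi i, reg s 30 = lo /\ reg s 31 = hi /\ reg s 32 = (hi - lo)%Z /\
      reg s 33 = sum_upto wi0 Q /\
      (tau0 <= lo /\ lo < hi /\ hi <= tau0 + Z0 /\ hi - lo <= 2 ^ Z.of_nat q)%Z /\
      i + q = p + 1 /\ reg s 22 = (Z.of_nat i * (Z.of_nat Q * (2 * b + 1)))%Z /\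
      loaded b (Z.of_nat i * (Z.of_nat Q * (2 * b + 1))) [] s /\ bracket lo hi)
    (fun s' => env s' /\ exists lo, (tau0 <= lo < tau0 + Z0)%Z /\
      reg s' 30 = lo /\ reg s' 31 = (lo + 1)%Z /\ bracket lo (lo + 1)) p) | lia |].
  (* [i] counts the sums computed so far. It starts at 1 because the reference sum at [tau0] has
     used the first block of memory. *)
  - split; [env_tac |]. exists tau0, (tau0 + Z0)%Z, 1. simpl_state.
    repeat split; try reflexivity; try lia.
    + replace (Z.of_nat 1 * (Z.of_nat Q * (2 * b + 1)))%Z
        with (0 + Z.of_nat Q * (2 * b + 1))%Z by lia. exact AL.
    + intros us ws Hc.
      destruct (kcyc_total k c U n W0 E hk hc hU hW0 hG hW L hL hUL us ws Hc)
        as (? & _ & _ & H & _). lia.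
  - intros q s Hq (Hes & lo & hi & i & I30 & I31 & I32 & I33 & Hlh & Hi & I22 & IL & Hbr) _.
    pose proof (env3 _ Hes) as R3.
    destruct (Z.lt_ge_cases 1 (hi - lo)) as [Hd | Hd].
    + right. split; [lia |]. destruct q as [| q]; [cbn in Hlh; lia |].
      exists q. split; [reflexivity |].
      pose proof Hes as Hes'. get_env Hes'.
      assert (H2p : (2 ^ Z.of_nat (S q) = 2 * 2 ^ Z.of_nat q)%Z)
        by (rewrite Nat2Z.inj_succ, Z.pow_succ_r; lia).
      unfold psearch_body. set (mid := (lo + (hi - lo) / 2)%Z).
      assert (Hmid : (lo < mid < hi /\ hi - mid <= 2 ^ Z.of_nat q /\ mid - lo <= 2 ^ Z.of_nat q)%Z).
      { unfold mid. pose proof (Z.div_mod (hi - lo) 2 ltac:(lia)).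
        pose proof (Z.mod_pos_bound (hi - lo) 2 ltac:(lia)). lia. }
      replace (Q * S body_time + 3 + 11) with (S (S (S ((Q * S body_time + 3) + 8)))) by lia.
      op 2%Z.
      op ((hi - lo) / 2)%Z.
      op mid.
      apply wp_seq. eapply wp_conseq;
        [apply wp_frame, (psum_spec mid (Z.of_nat i * (Z.of_nat Q * (2 * b + 1)))) | apply le_n |].
      { env_tac. } { lia. } { reflexivity. } { apply Z.mul_nonneg_nonneg; lia. }
      { specialize (Hoffi (S i) ltac:(lia)); lia. }
      { lia. } { exact I22. } { exact IL. }
      intros s2 ((wi & Hwi & B28 & Bb & B22 & BL) & F2).
      assert (He2 : env s2) by (eapply env_frame; [apply keeps_psum | exact F2 | env_tac]).
      pose proof (proj1 F2 27 (writes_psum 27 ltac:(cbn; tauto))) as G27.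
      pose proof (proj1 F2 30 (writes_psum 30 ltac:(cbn; tauto))) as G30.
      pose proof (proj1 F2 31 (writes_psum 31 ltac:(cbn; tauto))) as G31.
      pose proof (proj1 F2 33 (writes_psum 33 ltac:(cbn; tauto))) as G33.
      cbn [reg set_reg Nat.eqb] in G27, G30, G31, G33.
      rewrite I30 in G30. rewrite I31 in G31. rewrite I33 in G33.
      clear F2.
      assert (Htest := threshold_test k c U n W0 E hk hc hU hW0 hG hW L hL hUL mid wi wi0
        ltac:(lia) Hwi Hwi0).
      rewrite B28 in Bb. rewrite A28 in Ab.
      clear dependent s. pose proof He2 as He2'. get_env He2'.
      assert (Hm1 : (0 <= (mid - tau0) * Z.of_nat n0 <= Z.of_nat n0 * Z0)%Z).
      { split; [apply Z.mul_nonneg_nonneg; lia |].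
        rewrite Z.mul_comm. apply Z.mul_le_mono_nonneg_l; lia. }
      assert (Hm2 : (0 <= (mid - tau0) * Z.of_nat n0 * Z.of_nat Q
                     <= Z.of_nat Q * (Z.of_nat n0 * Z0))%Z).
      { split; [apply Z.mul_nonneg_nonneg; lia |].
        rewrite Z.mul_comm. apply Z.mul_le_mono_nonneg_l; lia. }
      assert (HQ0 : (0 < Z.of_nat Q)%Z).
      { pose proof V_pos as HV'. pose proof V_le_D as HVD'.
        assert (Q <> 0); [| lia]. unfold lQ. apply Nat.neq_mul_0.
        split; [lia | apply Nat.pow_nonzero; lia]. }
      assert (Hm3 : (Z.of_nat n0 * Z0 <= Z.of_nat Q * (Z.of_nat n0 * Z0))%Z).
      { rewrite <- (Z.mul_1_l (Z.of_nat n0 * Z0)) at 1.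
        apply Z.mul_le_mono_nonneg_r; [apply Z.mul_nonneg_nonneg; lia | lia]. }
      op (sum_upto wi Q - sum_upto wi0 Q)%Z.
      op (mid - tau0)%Z.
      op ((mid - tau0) * Z.of_nat n0)%Z.
      op ((mid - tau0) * Z.of_nat n0 * Z.of_nat Q)%Z.
      op (2 * ((mid - tau0) * Z.of_nat n0 * Z.of_nat Q))%Z.
      replace (2 * Z.of_nat Q * Z.of_nat n0 * (mid - tau0))%Z
        with (2 * ((mid - tau0) * Z.of_nat n0 * Z.of_nat Q))%Z in Htest by lia.
      destruct Hbr as [Hbr1 Hbr2].
      apply (wp_seq 2 1). apply wp_if; simpl_state; intros Hc.
      * op mid. op (mid - lo)%Z.
        split; [env_tac |]. exists lo, mid, (S i). simpl_state.
        replace (Z.of_nat (S i) * (Z.of_nat Q * (2 * b + 1)))%Z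
          with (Z.of_nat i * (Z.of_nat Q * (2 * b + 1)) + Z.of_nat Q * (2 * b + 1))%Z by lia.
        repeat split; try reflexivity; try assumption; try lia.
        right. now apply Htest.
      * op mid. op (hi - mid)%Z.
        split; [env_tac |]. exists mid, hi, (S i). simpl_state.
        replace (Z.of_nat (S i) * (Z.of_nat Q * (2 * b + 1)))%Z
          with (Z.of_nat i * (Z.of_nat Q * (2 * b + 1)) + Z.of_nat Q * (2 * b + 1))%Z by lia.
        repeat split; try reflexivity; try assumption; try lia.
        intros us ws Hcy. apply Z.nlt_ge. intros Hlt.
        assert (Hex : exists us ws, kcyc k E us ws /\ (tau0 + ctot0 us ws < mid)%Z) by eauto.
        apply Htest in Hex. lia.
    + left. split; [lia |]. split; [exact Hes |].
      exists lo. assert (hi = lo + 1)%Z as -> by lia.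
      repeat split; try assumption; try lia; apply Hbr.
  - intros s [H _]. exact H.
Qed.

(** On an interval of length one the minimum cost is [lo] itself. If the upper end never moved, [lo]
    is [tau0 + Z0 - 1], and the strict bound of [kcyc_total] places every cycle below it, so there
    is none. *)
Lemma pout_spec lo s : env s -> (tau0 <= lo < tau0 + Z0)%Z -> reg s 30 = lo ->
  reg s 31 = (lo + 1)%Z -> bracket lo (lo + 1) ->
  wp B pout (6 * k + 8) (fun s' =>
    (reg s' 0 = 1%Z /\ exists us ws, kcyc k E us ws /\
       (forall us' ws', kcyc k E us' ws' -> sumZ ws <= sumZ ws')%Z /\
       forall i, i < k -> arr s' 0 (Z.of_nat i) = arr s 6 (Z.of_nat (nth i us 0))) \/
    (reg s' 0 = 0%Z /\ ~ exists us ws, kcyc k E us ws)) s.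
Proof.
  clear -hk hc hU hW0 hG hW hB hL hUL.
  intros He Hlo E30 E31 [Hb1 Hb2].
  signs.
  assert (Htau0 : (0 <= tau0)%Z) by (apply Z.mul_nonneg_nonneg; lia).
  assert (HkS : (Z.of_nat (k + 1) * (2 * Z0) = tau0 + 2 * Z0)%Z) by lia.
  assert (Hcyc := kcyc_total k c U n W0 E hk hc hU hW0 hG hW L hL hUL).
  pose proof He as He'. get_env He'. unfold pout.
  replace (6 * k + 8) with (S (S (S (S (S ((k * 6 + 1) + 2)))))) by lia.
  op (tau0 + Z0)%Z.
  apply wp_if; simpl_state; rewrite E31; intros Hlt.
  - assert (K : exists us ws, kcyc k E us ws /\ (tau0 + ctot0 us ws = lo)%Z).
    { destruct Hb2 as [Hb2 | (us & ws & Hc & Hl)]; [lia |].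
      exists us, ws. split; [exact Hc |]. specialize (Hb1 _ _ Hc). lia. }
    destruct K as (us & ws & Hc & Elo).
    destruct (Hcyc us ws Hc) as (bb & Hbb & Et & Hr & Hdig).
    op (lo - tau0)%Z.
    op (Z.of_nat bb).
    { replace (lo - tau0)%Z with (Z.of_nat bb + (sumZ ws + Z.of_nat k * W0) * X)%Z by lia.
      rewrite Z_mod_plus_full. apply Z.mod_small. lia. }
    cst.
    apply wp_seq. eapply wp_conseq; [apply (wp_for _ _ _ _ 5 k (fun i s' =>
      reg s' 35 = Z.of_nat i /\ reg s' 36 = Z.of_nat (bb / Y ^ i) /\
      forall i', i' < i -> arr s' 0 (Z.of_nat i') = arr s 6 (Z.of_nat (nth i' us 0)))) | lia |].
    + split; [reflexivity |]. split; [cbn [Nat.pow]; now rewrite Nat.div_1_r | lia].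
    + intros i s1 Hi (I1 & I2 & I3) F.
      pose proof (proj1 F 4 eq_refl) as R4. pose proof (proj1 F 13 eq_refl) as R13.
      pose proof (proj1 F 3 eq_refl) as R3. pose proof (proj2 F 6 eq_refl) as R6.
      cbn [reg arr set_reg Nat.eqb] in R4, R13, R3, R6.
      assert (Q4 : reg s1 4 = Z.of_nat k) by congruence.
      assert (Q13 : reg s1 13 = Z.of_nat Y) by congruence.
      assert (Q3 : reg s1 3 = 1%Z) by congruence. clear R4 R13 R3.
      split; [lia |].
      assert (Hy : (bb / Y ^ i) mod Y <= bb).
      { etransitivity; [apply Nat.Div0.mod_le | apply div_le_self]. }
      assert (Hy' : bb / Y ^ S i <= bb) by apply div_le_self.
      op (Z.of_nat (nth i us 0)).
      { rewrite <- Nat2Z.inj_mod. now rewrite Hdig. }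
      { rewrite <- Hdig by exact Hi. lia. }
      op (Z.of_nat (bb / Y ^ S i)).
      { now rewrite <- Nat2Z.inj_div, Nat.Div0.div_div, (Nat.mul_comm (Y ^ i)). }
      rd (arr s 6 (Z.of_nat (nth i us 0))); [apply R6 |].
      wr (Z.of_nat i) (arr s 6 (Z.of_nat (nth i us 0))).
      op (Z.of_nat (S i)).
      split; [reflexivity |]. split; [reflexivity |].
      intros i' Hi'. simpl_state.
      destruct (Z.eqb_spec (Z.of_nat i') (Z.of_nat i)) as [Eq | Hne].
      * now assert (i' = i) as -> by lia.
      * apply I3. lia.
    + intros s1 (I1 & _) F. rewrite I1, (proj1 F 4 eq_refl). use_regs. lia.
    + intros s1 [(I1 & I2 & I3) F]. apply wp_const; [lia |].
      left. split; [reflexivity |]. exists us, ws. split; [exact Hc |]. split; [| exact I3].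
      (* Costs were compared but weights are wanted: two codes differ by less than [X], so a weight
         smaller by one would outweigh them. *)
      intros us' ws' Hc'. specialize (Hb1 _ _ Hc').
      destruct (Hcyc us' ws' Hc') as (bb' & Hbb' & Et' & _ & _).
      clear -Hb1 Elo Et Et' Hbb Hbb' HX.
      apply Z.nlt_ge. intros Hlt.
      assert ((sumZ ws' + 1) * X <= sumZ ws * X)%Z by (apply Z.mul_le_mono_nonneg_r; lia).
      lia.
  - apply wp_const; [lia |]. right. split; [reflexivity |].
    intros (us & ws & Hc). destruct (Hcyc us ws Hc) as (bb & Hbb & Et & Hr & Hdig).
    specialize (Hb1 _ _ Hc). assert (lo + 1 = tau0 + Z0)%Z by lia. lia.
Qed.

End Sum.

(** * Preprocessing *)

(** The bound [W] of the specification is not part of the input, so the program works with the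
    largest absolute weight that occurs. *)
Definition pmax : cmd :=
  Const 35 0 ;; Const 6 0 ;;
  While 35 1 (
    Read 36 2 35 ;; If 36 2 (Op Sub 36 2 36) Skip ;; If 6 36 (Op Add 6 36 2) Skip ;;
    Op Add 35 35 3).

Lemma pmax_spec B (E : list (nat * nat * Z)) (W : nat) s :
  reg s 1 = Z.of_nat (length E) -> reg s 2 = 0%Z -> reg s 3 = 1%Z ->
  (forall e a w, nth_error E e = Some (a, w) -> arr s 2 (Z.of_nat e) = w) ->
  (forall a w, In (a, w) E -> (Z.abs w <= Z.of_nat W)%Z) ->
  (Z.of_nat (length E + W + 1) <= B)%Z ->
  wp B pmax (7 * length E + 3) (fun s' => (0 <= reg s' 6 <= Z.of_nat W)%Z /\
    forall a w, In (a, w) E -> (Z.abs w <= reg s' 6)%Z) s.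
Proof.
  intros E1 E2 E3 A2 HW HB. unfold pmax.
  replace (7 * length E + 3) with (S (S (length E * 7 + 1))) by lia.
  cst. cst.
  eapply wp_conseq; [apply (wp_for _ _ _ _ 6 (length E) (fun i s' =>
    reg s' 35 = Z.of_nat i /\ (0 <= reg s' 6 <= Z.of_nat W)%Z /\
    forall e a w, e < i -> nth_error E e = Some (a, w) -> (Z.abs w <= reg s' 6)%Z)) | lia |].
  - split; [reflexivity |]. split; [simpl_state; lia |]. intros; lia.
  - intros i s1 Hi (I1 & I2 & I3) F.
    pose proof (proj1 F 1 eq_refl) as R1. pose proof (proj1 F 2 eq_refl) as R2.
    pose proof (proj1 F 3 eq_refl) as R3. pose proof (proj2 F 2 eq_refl) as RA.
    cbn [reg arr set_reg Nat.eqb] in R1, R2, R3, RA. rewrite E1 in R1. rewrite E2 in R2.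
    rewrite E3 in R3. split; [lia |].
    destruct (nth_error E i) as [[a w] |] eqn:En; [| apply nth_error_None in En; lia].
    pose proof (HW _ _ (nth_error_In _ _ En)) as Hw.
    rd w; [rewrite RA; eapply A2; exact En |].
    apply (wp_seq 2 3). eapply wp_conseq with (t1 := 2)
      (Q1 := fun s' => s' = set_reg s1 36 w /\ (0 <= w)%Z \/
              s' = set_reg (set_reg s1 36 w) 36 (Z.abs w)); [| lia |].
    + apply wp_if; simpl_state; intros Hc.
      * op (Z.abs w). now right.
      * apply wp_skip. left. split; [reflexivity | lia].
    + intros s2 Hs2.
      assert (G36 : reg s2 36 = Z.abs w)
        by (destruct Hs2 as [[-> ?] | ->]; simpl_state; lia).
      assert (G : reg s2 35 = Z.of_nat i /\ reg s2 6 = reg s1 6 /\ reg s2 2 = 0%Z /\ reg s2 3 = 1%Z)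
        by (destruct Hs2 as [[-> ?] | ->]; simpl_state; auto).
      clear Hs2. destruct G as (G35 & G6 & G2 & G3).
      apply (wp_seq 2 1). apply wp_if; intros Hc.
      * op (Z.abs w). op (Z.of_nat (S i)). simpl_state.
        split; [reflexivity |]. split; [lia |].
        intros e a' w' He En'. destruct (Nat.eq_dec e i) as [-> |].
        -- rewrite En in En'. injection En' as <- <-. lia.
        -- specialize (I3 e a' w' ltac:(lia) En'). lia.
      * apply wp_skip. op (Z.of_nat (S i)). simpl_state.
        split; [reflexivity |]. split; [lia |].
        intros e a' w' He En'. destruct (Nat.eq_dec e i) as [-> |].
        -- rewrite En in En'. injection En' as <- <-. lia.
        -- specialize (I3 e a' w' ltac:(lia) En'). lia.
  - intros s1 (I1 & _) F. rewrite I1, (proj1 F 1 eq_refl). use_regs. lia.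
  - intros s1 [(I1 & I2 & I3) F]. split; [exact I2 |].
    intros a w Hin. apply In_nth_error in Hin. destruct Hin as (e & He).
    apply (I3 e a w); [| exact He]. apply nth_error_Some. congruence.
Qed.

Definition prelab (src dst : nat) : cmd :=
  Read 36 src 35 ;; Read 37 5 36 ;;
  If 37 3 (Write 6 5 36 ;; Op Add 5 5 3 ;; Write 5 36 5 ;; Op Add 37 5 2) Skip ;;
  Op Sub 37 37 3 ;; Write dst 35 37.

Definition prelabel : cmd :=
  Const 5 0 ;; Const 35 0 ;;
  While 35 1 (prelab 0 3 ;; prelab 1 4 ;; Op Add 35 35 3).

(* [vs] lists the vertices met so far; array 5 holds their positions plus one (zero meaning
   not met), array 6 the vertices themselves. *)
Record labelled (N : nat) (vs : list nat) (s : state) : Prop := {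
  lab_nodup : NoDup vs;
  lab_lt : forall x, In x vs -> x < N;
  lab_count : reg s 5 = Z.of_nat (length vs);
  lab_pos : forall x, arr s 5 (Z.of_nat x) = 0%Z /\ ~ In x vs \/
    exists i, nth_error vs i = Some x /\ arr s 5 (Z.of_nat x) = Z.of_nat (S i);
  lab_inv : forall i x, nth_error vs i = Some x -> arr s 6 (Z.of_nat i) = Z.of_nat x
}.

Lemma labelled_length N vs s : labelled N vs s -> length vs <= N.
Proof.
  intros H. rewrite <- (length_seq N 0). apply NoDup_incl_length; [apply H |].
  intros x Hx. apply in_seq. apply (lab_lt _ _ _ H) in Hx. lia.
Qed.

Lemma labelled_ext N vs s s' : labelled N vs s -> reg s' 5 = reg s 5 ->
  (forall j, arr s' 5 j = arr s 5 j) -> (forall j, arr s' 6 j = arr s 6 j) ->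
  labelled N vs s'.
Proof.
  intros [H1 H2 H3 H4 H5] R A5 A6. constructor; auto.
  - now rewrite R.
  - intros x. rewrite A5. apply H4.
  - intros i x. rewrite A6. apply H5.
Qed.

Lemma prelab_spec B N src dst vs e u s : src <= 1 -> dst = 3 \/ dst = 4 ->
  (Z.of_nat (N + 1) <= B)%Z -> reg s 2 = 0%Z -> reg s 3 = 1%Z ->
  reg s 35 = Z.of_nat e -> arr s src (Z.of_nat e) = Z.of_nat u -> u < N ->
  labelled N vs s ->
  wp B (prelab src dst) 9 (fun s' => exists tl i, labelled N (vs ++ tl) s' /\
    length tl <= 1 /\ nth_error (vs ++ tl) i = Some u /\
    forall j, arr s' dst j = if (j =? Z.of_nat e)%Z then Z.of_nat i else arr s dst j) s.
Proof.
  intros Hsrc Hdst HB E2 E3 E35 Asrc Hu HL.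
  pose proof (labelled_length _ _ _ HL) as Hlen. pose proof HL as [L1 L2 L3 L4 L5].
  unfold prelab.
  rd (Z.of_nat u); [exact Asrc |].
  destruct (L4 u) as [[P1 P2] | (i & P1 & P2)].
  - rd 0%Z; [exact P1 |].
    apply (wp_seq 5 2). apply wp_if; simpl_state; [intros _ | lia].
    wr (Z.of_nat (length vs)) (Z.of_nat u).
    op (Z.of_nat (S (length vs))).
    wr (Z.of_nat u) (Z.of_nat (S (length vs))).
    op (Z.of_nat (S (length vs))).
    op (Z.of_nat (length vs)).
    wr (Z.of_nat e) (Z.of_nat (length vs)).
    exists [u], (length vs). split; [| split; [cbn; lia | split]].
    + apply (labelled_ext N (vs ++ [u]) (set_arr (set_reg (set_arr s 6
        (Z.of_nat (length vs)) (Z.of_nat u)) 5 (Z.of_nat (S (length vs))))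
        5 (Z.of_nat u) (Z.of_nat (S (length vs)))));
        [| reflexivity | intros j; destruct Hdst as [-> | ->]; reflexivity
         | intros j; destruct Hdst as [-> | ->]; reflexivity].
      constructor.
      * apply NoDup_app; [exact L1 | constructor; [easy | constructor] |].
        intros x Hx [<- | []]. contradiction.
      * intros x Hx. apply in_app_iff in Hx. destruct Hx as [Hx | [<- | []]]; auto.
      * simpl_state. rewrite length_app. cbn. lia.
      * intros x. simpl_state.
        destruct (Z.eqb_spec (Z.of_nat x) (Z.of_nat u)) as [Eq | Hne].
        -- assert (x = u) as -> by lia. right. exists (length vs).
           split; [rewrite nth_error_app2, Nat.sub_diag by lia; reflexivity | reflexivity].
        -- destruct (L4 x) as [[Q1 Q2] | (i & Q1 & Q2)].
           ++ left. split; [exact Q1 |]. rewrite in_app_iff. intros [Hx | [Hx | []]]; [auto | lia].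
           ++ right. exists i. split; [| exact Q2]. rewrite nth_error_app1; [exact Q1 |].
              apply nth_error_Some. congruence.
      * intros i x Hx. simpl_state.
        destruct (Z.eqb_spec (Z.of_nat i) (Z.of_nat (length vs))) as [Eq | Hne].
        -- assert (i = length vs) as -> by lia.
           rewrite nth_error_app2, Nat.sub_diag in Hx by lia. injection Hx as <-. reflexivity.
        -- apply L5. rewrite nth_error_app1 in Hx; [exact Hx |].
           assert (i < length (vs ++ [u])) by (apply nth_error_Some; congruence).
           rewrite length_app in *. cbn in *. lia.
    + rewrite nth_error_app2, Nat.sub_diag by lia. reflexivity.
    + intros j. destruct Hdst as [-> | ->]; reflexivity.
  - rd (Z.of_nat (S i)); [exact P2 |].
    assert (Hi : i < length vs) by (apply nth_error_Some; congruence).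
    apply (wp_seq 5 2). apply wp_if; simpl_state; [lia | intros _].
    apply wp_skip.
    op (Z.of_nat i).
    wr (Z.of_nat e) (Z.of_nat i).
    exists [], i. rewrite app_nil_r. split; [| split; [cbn; lia | split; [exact P1 |]]].
    + apply (labelled_ext N vs s); [exact HL | reflexivity | |];
        intros j; destruct Hdst as [-> | ->]; reflexivity.
    + intros j. destruct Hdst as [-> | ->]; reflexivity.
Qed.

(** Only endpoints of edges receive labels, at most two per edge, so later costs are linear in the
    number of edges. Arrays are initially zero, which saves a pass over all vertices. *)
Lemma prelabel_spec B G s : simple_digraph G ->
  reg s 1 = Z.of_nat (nedges G) -> reg s 2 = 0%Z -> reg s 3 = 1%Z ->
  (forall e u v w, nth_error (edges G) e = Some (u, v, w) ->
     arr s 0 (Z.of_nat e) = Z.of_nat u /\ arr s 1 (Z.of_nat e) = Z.of_nat v) ->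
  (forall j, arr s 5 j = 0%Z) ->
  (Z.of_nat (order G + nedges G + 1) <= B)%Z ->
  wp B prelabel (20 * nedges G + 3) (fun s' => exists vs,
    labelled (order G) vs s' /\ length vs <= 2 * nedges G /\
    forall e u v w, nth_error (edges G) e = Some (u, v, w) ->
      exists i i', nth_error vs i = Some u /\ nth_error vs i' = Some v /\
        arr s' 3 (Z.of_nat e) = Z.of_nat i /\ arr s' 4 (Z.of_nat e) = Z.of_nat i') s.
Proof.
  intros HG E1 E2 E3 A01 A5 HB. unfold prelabel.
  replace (20 * nedges G + 3) with (S (S (nedges G * 20 + 1))) by lia.
  cst. cst.
  eapply wp_conseq; [apply (wp_for _ _ _ _ 19 (nedges G) (fun m s' =>
    reg s' 35 = Z.of_nat m /\ exists vs,
    labelled (order G) vs s' /\ length vs <= 2 * m /\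
    forall e u v w, e < m -> nth_error (edges G) e = Some (u, v, w) ->
      exists i i', nth_error vs i = Some u /\ nth_error vs i' = Some v /\
        arr s' 3 (Z.of_nat e) = Z.of_nat i /\ arr s' 4 (Z.of_nat e) = Z.of_nat i')) | lia |].
  - split; [reflexivity |]. exists []. split; [| split; [cbn; lia | intros; lia]].
    constructor; [constructor | intros x [] | reflexivity | |].
    + intros x. left. split; [apply A5 | easy].
    + intros [| i] x Hx; discriminate Hx.
  - intros m s1 Hm (I1 & vs & I2 & I3 & I4) F.
    pose proof (proj1 F 1 eq_refl) as R1. pose proof (proj1 F 2 eq_refl) as R2.
    pose proof (proj1 F 3 eq_refl) as R3. pose proof (proj2 F 0 eq_refl) as RA.
    pose proof (proj2 F 1 eq_refl) as RB.
    cbn [reg arr set_reg Nat.eqb] in R1, R2, R3, RA, RB. rewrite E1 in R1. rewrite E2 in R2.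
    rewrite E3 in R3. split; [lia |].
    destruct (nth_error (edges G) m) as [[[u v] w] |] eqn:En;
      [| apply nth_error_None in En; unfold nedges in *; lia].
    destruct (A01 m u v w En) as [Au Av].
    pose proof (proj1 HG u v w (nth_error_In _ _ En)) as (Hu & Hv & _).
    apply (wp_seq 9 10). eapply wp_conseq;
      [apply wp_frame, (prelab_spec B (order G) 0 3 vs m u s1); auto; try lia | lia |].
    { now rewrite RA. }
    intros s2 [(tl1 & i1 & J1 & J2 & J3 & J4) F2].
    apply (wp_seq 9 1). eapply wp_conseq;
      [apply wp_frame, (prelab_spec B (order G) 1 4 (vs ++ tl1) m v s2); auto; try lia | lia |].
    { rewrite (proj1 F2 2 eq_refl). exact R2. }
    { rewrite (proj1 F2 3 eq_refl). exact R3. }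
    { rewrite (proj1 F2 35 eq_refl). exact I1. }
    { rewrite (proj2 F2 1 eq_refl), RB. exact Av. }
    intros s3 [(tl2 & i2 & K1 & K2 & K3 & K4) F3].
    assert (G35 : reg s3 35 = Z.of_nat m)
      by (rewrite (proj1 F3 35 eq_refl), (proj1 F2 35 eq_refl); exact I1).
    assert (G3 : reg s3 3 = 1%Z)
      by (rewrite (proj1 F3 3 eq_refl), (proj1 F2 3 eq_refl); exact R3).
    op (Z.of_nat (S m)).
    split; [reflexivity |]. exists ((vs ++ tl1) ++ tl2). split; [| split].
    + apply (labelled_ext _ _ s3); [exact K1 | reflexivity | reflexivity | reflexivity].
    + rewrite !length_app. lia.
    + assert (Hext : forall l l' i x, nth_error l i = Some x -> @nth_error nat (l ++ l') i = Some x).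
      { intros l l' i x Hx. rewrite nth_error_app1; [exact Hx |]. apply nth_error_Some. congruence. }
      intros e u' v' w' He En'. simpl_state.
      rewrite K4, (proj2 F3 3 eq_refl), (proj2 F2 4 eq_refl), J4.
      destruct (Z.eqb_spec (Z.of_nat e) (Z.of_nat m)) as [Eq | Hne].
      * assert (e = m) as -> by lia. rewrite En in En'. injection En' as <- <- <-.
        exists i1, i2. repeat split; auto.
      * destruct (I4 e u' v' w' ltac:(lia) En') as (i & i' & Q1 & Q2 & Q3 & Q4).
        exists i, i'. repeat split; auto.
  - intros s1 (I1 & _) F. rewrite I1, (proj1 F 1 eq_refl). use_regs. lia.
  - intros s1 [(I1 & vs & I2 & I3 & I4) F]. exists vs. split; [exact I2 |]. split; [exact I3 |].
    intros e u v w En. apply (I4 e u v w); [| exact En]. apply nth_error_Some. congruence.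
Qed.

(** * Relabelling the vertices *)

Fixpoint pos (vs : list nat) (x : nat) : nat :=
  match vs with [] => 0 | y :: vs' => if x =? y then 0 else S (pos vs' x) end.

Lemma pos_nth vs x : In x vs -> nth_error vs (pos vs x) = Some x.
Proof.
  induction vs as [| y vs IH]; cbn; [easy |].
  destruct (Nat.eqb_spec x y) as [-> | Hne]; [reflexivity |].
  intros [Hx | Hx]; [congruence | auto].
Qed.

Lemma pos_unique vs i x : NoDup vs -> nth_error vs i = Some x -> pos vs x = i.
Proof.
  intros ND H. pose proof (nth_error_In _ _ H) as Hin. apply pos_nth in Hin.
  apply (proj1 (NoDup_nth_error vs) ND); [apply nth_error_Some; congruence | congruence].
Qed.

Lemma pos_lt vs x : In x vs -> pos vs x < length vs.
Proof. intros H. apply nth_error_Some. rewrite pos_nth; [easy | exact H]. Qed.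

Definition relabel (vs : list nat) (E : list (nat * nat * Z)) : list (nat * nat * Z) :=
  map (fun e => (pos vs (fst (fst e)), pos vs (snd (fst e)), snd e)) E.

Lemma Forall2_map_l {A B C} (R : B -> C -> Prop) (f : A -> B) l l' :
  Forall2 R (map f l) l' <-> Forall2 (fun a => R (f a)) l l'.
Proof.
  revert l'; induction l as [| a l IH]; intros l'; cbn.
  - split; intros H; inversion H; constructor.
  - split; intros H; inversion H; subst; constructor; auto; now apply IH.
Qed.

Lemma arcs_map f c : arcs (map f c) = map (fun a => (f (fst a), f (snd a))) (arcs c).
Proof.
  unfold arcs. replace (tl (map f c)) with (map f (tl c)) by (destruct c; reflexivity).
  rewrite firstn_map, <- map_app.
  generalize (tl c ++ firstn 1 c). induction c as [| x c IH]; intros [| y l]; cbn; [reflexivity .. |].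
  now rewrite IH.
Qed.

Lemma arcs_src (E : list (nat * nat * Z)) c ws u : Forall2 (fun a x => In (a, x) E) (arcs c) ws -> In u c ->
  exists v w, In (u, v, w) E.
Proof.
  intros H Hu. assert (Hl : length (tl c ++ firstn 1 c) = length c).
  { destruct c; [reflexivity |]. cbn. rewrite length_app. cbn. lia. }
  assert (Hv : exists v, In (u, v) (arcs c)).
  { unfold arcs. generalize dependent (tl c ++ firstn 1 c). clear H.
    induction c as [| x c IH]; intros [| y l] Hl; cbn in *; try easy.
    destruct Hu as [-> | Hu]; [eauto |]. injection Hl as Hl.
    destruct (IH Hu l Hl) as (v & Hv). eauto. }
  destruct Hv as (v & Hv). exists v.
  induction H as [| a w l ws Ha _ IH]; [easy |].
  destruct Hv as [-> | Hv]; [eauto | auto].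
Qed.

Section Relabel.
Variables (G : wgraph) (vs : list nat).
Hypothesis hG : simple_digraph G.
Hypothesis hvs : NoDup vs.
Hypothesis hends : forall u v w, In (u, v, w) (edges G) -> In u vs /\ In v vs.
Notation E := (edges G).
Notation E' := (relabel vs E).

Lemma in_relabel u v w : In (u, v, w) E -> In (pos vs u, pos vs v, w) E'.
Proof. intros H. unfold relabel. apply in_map_iff. exists (u, v, w). auto. Qed.

Lemma in_relabel_inv u' v' w : In (u', v', w) E' ->
  exists u v, In (u, v, w) E /\ u' = pos vs u /\ v' = pos vs v.
Proof.
  intros H. apply in_map_iff in H. destruct H as (((u, v), w') & H & Hin).
  cbn in H. injection H as <- <- <-. eauto.
Qed.

Lemma pos_inj x y : In x vs -> In y vs -> pos vs x = pos vs y -> x = y.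
Proof. intros Hx Hy H. apply pos_nth in Hx, Hy. congruence. Qed.

Lemma relabel_simple : simple_digraph (WGraph (length vs) E').
Proof.
  split; cbn.
  - intros u' v' w H. apply in_relabel_inv in H. destruct H as (u & v & H & -> & ->).
    destruct (hends _ _ _ H) as [Hu Hv]. apply (proj1 hG) in H.
    repeat split; try (apply pos_lt; assumption).
    intros Eq. apply pos_inj in Eq; tauto.
  - unfold relabel. rewrite map_map. cbn.
    replace (map (fun x => (pos vs (fst (fst x)), pos vs (snd (fst x)))) E)
      with (map (fun a => (pos vs (fst a), pos vs (snd a))) (map fst E))
      by now rewrite map_map.
    apply NoDup_map_NoDup_ForallPairs; [| apply hG].
    intros (u, v) (u', v') H1 H2 Eq. cbn in Eq. injection Eq as Eq1 Eq2.
    apply in_map_iff in H1, H2. destruct H1 as (((a, b), w) & Q1 & H1).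
    destruct H2 as (((a', b'), w') & Q2 & H2). cbn in Q1, Q2.
    injection Q1 as -> ->. injection Q2 as -> ->.
    apply hends in H1, H2. f_equal; apply pos_inj; tauto.
Qed.

Lemma kcyc_unlabel k us ws : kcyc k E' us ws ->
  is_kcycle G k (map (fun i => nth i vs 0) us) (sumZ ws).
Proof.
  intros (Hl & Hnd & Hf).
  assert (Hnth : forall x, In x vs -> nth (pos vs x) vs 0 = x).
  { intros x Hx. apply nth_error_nth, pos_nth, Hx. }
  split; [now rewrite length_map |]. split.
  - apply NoDup_map_NoDup_ForallPairs; [| exact Hnd].
    intros x y Hx Hy Eq.
    destruct (arcs_src _ _ _ _ Hf Hx) as (v & w & H1).
    destruct (arcs_src _ _ _ _ Hf Hy) as (v' & w' & H2).
    apply in_relabel_inv in H1, H2. destruct H1 as (a & a1 & H1 & -> & ->).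
    destruct H2 as (a' & a1' & H2 & -> & ->).
    apply hends in H1, H2. rewrite !Hnth in Eq by tauto. now subst.
  - exists ws. split; [| reflexivity]. rewrite arcs_map, Forall2_map_l.
    eapply Forall2_impl; [| exact Hf]. intros (u', v') w H.
    apply in_relabel_inv in H. destruct H as (u & v & H & -> & ->).
    destruct (hends _ _ _ H). cbn. now rewrite !Hnth.
Qed.

Lemma kcyc_label k c w : is_kcycle G k c w ->
  exists ws, w = sumZ ws /\ kcyc k E' (map (pos vs) c) ws.
Proof.
  intros (Hl & Hnd & ws & Hf & ->). exists ws. split; [reflexivity |].
  split; [now rewrite length_map |]. split.
  - apply NoDup_map_NoDup_ForallPairs; [| exact Hnd].
    intros x y Hx Hy Eq.
    destruct (arcs_src _ _ _ _ Hf Hx) as (v & z & H1).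
    destruct (arcs_src _ _ _ _ Hf Hy) as (v' & z' & H2).
    apply hends in H1, H2. apply pos_inj; tauto.
  - rewrite arcs_map, Forall2_map_l. eapply Forall2_impl; [| exact Hf].
    intros (u, v) z H. now apply in_relabel.
Qed.

End Relabel.

(** * Constants *)

Definition plog : cmd :=
  Op Add 13 5 3 ;; Const 36 1 ;; Const 8 0 ;;
  While 36 13 (Op Add 36 36 36 ;; Op Add 8 8 3).

Definition ppow : cmd :=
  Op Add 11 8 2 ;; Const 14 1 ;; Const 35 0 ;;
  While 35 4 (Write 7 35 14 ;; Op Mul 14 14 13 ;; Op Mul 11 11 10 ;; Op Add 35 35 3).

Definition pparams : cmd :=
  Op Mul 8 8 4 ;; Op Mul 8 8 4 ;; Op Add 8 8 3 ;; Op Add 8 8 3 ;;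
  Op Mul 9 7 8 ;; Op Mul 10 9 7.

Definition pweights : cmd :=
  Op Div 12 5 7 ;; Op Add 12 12 3 ;;
  Op Add 36 4 4 ;; Op Mul 36 36 6 ;; Op Add 36 36 3 ;; Op Mul 15 36 14 ;;
  Op Add 16 15 15 ;; Op Add 36 4 3 ;; Op Mul 17 36 15 ;; Op Mul 18 36 12 ;;
  Op Mul 20 4 12 ;; Op Mul 21 4 16 ;;
  Op Mul 37 36 16 ;; Op Add 37 37 18 ;; Op Add 37 37 3 ;; Op Add 37 37 3 ;; Op Add 37 37 3.

Definition pbound (a : nat) : cmd :=
  Const 19 1 ;; Const 38 (Z.of_nat a) ;; Const 35 0 ;;
  While 35 38 (Op Mul 19 19 37 ;; Op Add 35 35 3) ;;
  Op Add 19 19 19 ;; Op Add 19 19 3.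

Definition pconsts (a : nat) : cmd := plog ;; pparams ;; ppow ;; pweights ;; pbound a.

Section Consts.
Variables (k c n a : nat) (W0 : Z) (E : list (nat * nat * Z)) (B : Z).
Definition cL : nat := Nat.log2_up (n + 1).
(** This is the bound on the modulus in [separating_modulus], for [k] vertices of [cL] bits each. *)
Definition cU : nat := cL * (k * k) + 2.
Notation V := (lV c cU).
Notation D := (lD c cU).
Notation Q := (lQ k c cU).
Notation n0 := (ln0 c n).
Notation Y := (lY n).
Notation X := (lX k n).
Notation Z0 := (lZ0 k n W0).
Notation HUB := (hub k n0).
(** For a gadget this is the base of the word bound in [solves]: [HUB + 1] vertices, weights up to
    [(k + 1) * (2 * Z0)], and the constant 2. *)
Definition cbase : Z := (Z.of_nat HUB + Z.of_nat (k + 1) * (2 * Z0) + 3)%Z.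
Definition cb : Z := (cbase ^ Z.of_nat a)%Z.

Hypothesis hk : 0 < k.
Hypothesis hc : 0 < c.
Hypothesis hW0 : (0 <= W0)%Z.
Hypothesis hB : (Z.of_nat (2 * (n + 1) + length E + cU + V + D + Q + k + c + n0 + HUB + a + 1)
  + 2 * Z0 + Z.of_nat (k + 1) * (2 * Z0) + X + (cbase + 2 * cb) + 1 <= B)%Z.

Let hU : 0 < cU.
Proof. unfold cU. lia. Qed.
Let HZ0 := lZ0_pos k c cU n W0 hk hc hU hW0.
Let HX := lX_pos k c cU n hk hc hU.

Let HkZ : (0 <= Z.of_nat (k + 1) * (2 * Z0))%Z.
Proof. apply Z.mul_nonneg_nonneg; lia. Qed.

Let Hcbase : (1 <= cbase)%Z.
Proof. unfold cbase. lia. Qed.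

Let Hcb : (1 <= cb)%Z.
Proof. unfold cb. pose proof (Z.pow_pos_nonneg cbase (Z.of_nat a)). lia. Qed.

Lemma plog_spec s : reg s 3 = 1%Z -> reg s 5 = Z.of_nat n ->
  wp B plog (3 * cL + 4) (fun s' => reg s' 8 = Z.of_nat cL /\ reg s' 13 = Z.of_nat Y) s.
Proof.
  intros E3 E5. unfold plog.
  replace (3 * cL + 4) with (S (S (S (cL * 3 + 1)))) by lia.
  op (Z.of_nat (n + 1)). cst. cst.
  eapply wp_conseq; [apply (wp_for _ _ _ _ 2 cL (fun i s' =>
    reg s' 36 = Z.of_nat (2 ^ i) /\ reg s' 8 = Z.of_nat i)) | lia |].
  - split; reflexivity.
  - intros i s1 Hi (I1 & I2) F.
    pose proof (proj1 F 13 eq_refl) as R13. pose proof (proj1 F 3 eq_refl) as R3.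
    cbn [reg set_reg Nat.eqb] in R13, R3. rewrite E3 in R3.
    assert (Hlt : 2 ^ i < n + 1) by (apply Nat.log2_up_lt_pow2; [lia | exact Hi]).
    assert (Hi' : i < 2 ^ i) by (apply Nat.pow_gt_lin_r; lia).
    split; [lia |].
    op (Z.of_nat (2 ^ S i)); [cbn [Nat.pow]; lia | cbn [Nat.pow]; lia |].
    op (Z.of_nat (S i)). split; reflexivity.
  - intros s1 (I1 & I2) F. rewrite I1, (proj1 F 13 eq_refl). simpl_state.
    apply inj_le. apply Nat.log2_log2_up_spec. lia.
  - intros s1 [(I1 & I2) F]. split; [exact I2 |]. rewrite (proj1 F 13 eq_refl).
    unfold lY. simpl_state. lia.
Qed.

Lemma ppow_spec s : reg s 2 = 0%Z -> reg s 3 = 1%Z -> reg s 4 = Z.of_nat k ->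
  reg s 8 = Z.of_nat cU -> reg s 10 = Z.of_nat D -> reg s 13 = Z.of_nat Y ->
  wp B ppow (5 * k + 4) (fun s' => reg s' 11 = Z.of_nat Q /\ reg s' 14 = X /\
    forall i, i < k -> arr s' 7 (Z.of_nat i) = Z.of_nat (Y ^ i)) s.
Proof.
  intros E2 E3 E4 E8 E10 E13. unfold ppow.
  replace (5 * k + 4) with (S (S (S (k * 5 + 1)))) by lia.
  assert (HD : 0 < D) by (unfold lD, lV; nia).
  op (Z.of_nat cU). cst. cst.
  eapply wp_conseq; [apply (wp_for _ _ _ _ 4 k (fun i s' =>
    reg s' 35 = Z.of_nat i /\ reg s' 14 = Z.of_nat (Y ^ i) /\
    reg s' 11 = Z.of_nat (cU * D ^ i) /\
    forall i', i' < i -> arr s' 7 (Z.of_nat i') = Z.of_nat (Y ^ i'))) | lia |].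
  - simpl_state. cbn [Nat.pow]. repeat split; try lia.
  - intros i s1 Hi (I1 & I2 & I3 & I4) F.
    pose proof (proj1 F 13 eq_refl) as R13. pose proof (proj1 F 3 eq_refl) as R3.
    pose proof (proj1 F 4 eq_refl) as R4. pose proof (proj1 F 10 eq_refl) as R10.
    cbn [reg set_reg Nat.eqb] in R13, R3, R4, R10.
    rewrite E13 in R13. rewrite E3 in R3. rewrite E4 in R4. rewrite E10 in R10.
    assert (H1 : Y ^ S i <= Y ^ k) by (apply Nat.pow_le_mono_r; unfold lY; lia).
    assert (H2 : cU * D ^ S i <= Q)
      by (unfold lQ; apply Nat.mul_le_mono_l, Nat.pow_le_mono_r; lia).
    assert (H3 : X = Z.of_nat (Y ^ k)) by reflexivity.
    split; [lia |].
    wr (Z.of_nat i) (Z.of_nat (Y ^ i)).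
    op (Z.of_nat (Y ^ S i)); [cbn [Nat.pow]; lia |].
    op (Z.of_nat (cU * D ^ S i)); [cbn [Nat.pow]; lia |].
    op (Z.of_nat (S i)).
    simpl_state. repeat split.
    intros i' Hi'. destruct (Z.eqb_spec (Z.of_nat i') (Z.of_nat i)) as [Eq | Hne].
    + now assert (i' = i) as -> by lia.
    + apply I4. lia.
  - intros s1 (I1 & _) F. rewrite I1, (proj1 F 4 eq_refl). use_regs. lia.
  - intros s1 [(I1 & I2 & I3 & I4) F]. repeat split; assumption.
Qed.

Lemma pparams_spec s : reg s 3 = 1%Z -> reg s 4 = Z.of_nat k -> reg s 7 = Z.of_nat c ->
  reg s 8 = Z.of_nat cL ->
  wp B pparams 6 (fun s' => reg s' 8 = Z.of_nat cU /\ reg s' 9 = Z.of_nat V /\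
    reg s' 10 = Z.of_nat D) s.
Proof.
  intros E3 E4 E7 E8. unfold pparams.
  assert (H1 : cL * k <= cU) by (unfold cU; nia).
  assert (H2 : cL * k * k <= cU) by (unfold cU; nia).
  assert (H3 : cL * k * k + 2 = cU) by (unfold cU; nia).
  op (Z.of_nat (cL * k)). op (Z.of_nat (cL * k * k)).
  op (Z.of_nat (cL * k * k + 1)). op (Z.of_nat cU).
  op (Z.of_nat V); [unfold lV; lia |].
  op (Z.of_nat D); [unfold lD; lia |].
  repeat split.
Qed.

Lemma pweights_spec s : reg s 2 = 0%Z -> reg s 3 = 1%Z -> reg s 4 = Z.of_nat k ->
  reg s 5 = Z.of_nat n -> reg s 6 = W0 -> reg s 7 = Z.of_nat c -> reg s 14 = X ->
  wp B pweights 17 (fun s' => reg s' 12 = Z.of_nat n0 /\ reg s' 15 = Z0 /\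
    reg s' 16 = (2 * Z0)%Z /\ reg s' 17 = (Z.of_nat (k + 1) * Z0)%Z /\
    reg s' 18 = Z.of_nat HUB /\ reg s' 20 = Z.of_nat (k * n0) /\
    reg s' 21 = (Z.of_nat k * (2 * Z0))%Z /\ reg s' 37 = cbase) s.
Proof.
  intros E2 E3 E4 E5 E6 E7 E14. unfold pweights.
  assert (H1 : (0 <= Z.of_nat k * W0)%Z) by (apply Z.mul_nonneg_nonneg; lia).
  assert (H2 : (2 * Z.of_nat k * W0 + 1 <= Z0)%Z).
  { unfold lZ0. rewrite <- (Z.mul_1_r (2 * Z.of_nat k * W0 + 1)) at 1.
    apply Z.mul_le_mono_nonneg_l; lia. }
  assert (H3 : n / c + 1 = n0) by reflexivity.
  assert (H4 : (k + 1) * n0 = HUB) by reflexivity.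
  assert (H5 : (Z.of_nat (k + 1) * (2 * Z0) = 2 * (Z.of_nat k * Z0) + 2 * Z0)%Z) by lia.
  assert (H6 : (0 <= Z.of_nat k * Z0)%Z) by (apply Z.mul_nonneg_nonneg; lia).
  assert (H7 : cbase = (Z.of_nat HUB + Z.of_nat (k + 1) * (2 * Z0) + 3)%Z) by reflexivity.
  op (Z.of_nat (n / c)); [now rewrite Nat2Z.inj_div |].
  op (Z.of_nat n0).
  op (2 * Z.of_nat k)%Z.
  op (2 * Z.of_nat k * W0)%Z.
  op (2 * Z.of_nat k * W0 + 1)%Z.
  op (lZ0 k n W0); [reflexivity |].
  op (2 * Z0)%Z.
  op (Z.of_nat (k + 1)).
  op (Z.of_nat (k + 1) * Z0)%Z.
  op (Z.of_nat HUB).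
  op (Z.of_nat (k * n0)).
  op (Z.of_nat k * (2 * Z0))%Z.
  op (Z.of_nat (k + 1) * (2 * Z0))%Z.
  op (Z.of_nat HUB + Z.of_nat (k + 1) * (2 * Z0))%Z.
  op (Z.of_nat HUB + Z.of_nat (k + 1) * (2 * Z0) + 1)%Z.
  op (Z.of_nat HUB + Z.of_nat (k + 1) * (2 * Z0) + 2)%Z.
  op cbase. simpl_state. repeat split; reflexivity.
Qed.

Lemma pbound_spec s : reg s 3 = 1%Z -> reg s 37 = cbase ->
  wp B (pbound a) (3 * a + 6) (fun s' => reg s' 19 = (2 * cb + 1)%Z) s.
Proof.
  intros E3 E37. unfold pbound.
  replace (3 * a + 6) with (S (S (S ((a * 3 + 1) + 2)))) by lia.
  cst. cst. cst. apply wp_seq.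
  eapply wp_conseq; [apply (wp_for _ _ _ _ 2 a (fun i s' =>
    reg s' 35 = Z.of_nat i /\ reg s' 19 = (cbase ^ Z.of_nat i)%Z)) | lia |].
  - split; reflexivity.
  - intros i s1 Hi (I1 & I2) F.
    pose proof (proj1 F 38 eq_refl) as R38. pose proof (proj1 F 3 eq_refl) as R3.
    pose proof (proj1 F 37 eq_refl) as R37.
    cbn [reg set_reg Nat.eqb] in R38, R3, R37. rewrite E3 in R3. rewrite E37 in R37.
    split; [lia |].
    assert (H1 : (cbase ^ Z.of_nat (S i) <= cb)%Z) by (apply Z.pow_le_mono_r; lia).
    pose proof (Z.pow_pos_nonneg cbase (Z.of_nat (S i)) ltac:(lia) ltac:(lia)) as H2.
    op (cbase ^ Z.of_nat (S i))%Z.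
    { rewrite Nat2Z.inj_succ, Z.pow_succ_r by lia. ring. }
    op (Z.of_nat (S i)). split; reflexivity.
  - intros s1 (I1 & _) F. rewrite I1, (proj1 F 38 eq_refl). simpl_state. lia.
  - intros s1 [(I1 & I2) F].
    pose proof (proj1 F 3 eq_refl) as R3. cbn [reg set_reg Nat.eqb] in R3. rewrite E3 in R3.
    change (cbase ^ Z.of_nat a)%Z with cb in I2.
    op (2 * cb)%Z. op (2 * cb + 1)%Z. reflexivity.
Qed.

Lemma pconsts_spec s : reg s 1 = Z.of_nat (length E) -> reg s 2 = 0%Z -> reg s 3 = 1%Z ->
  reg s 4 = Z.of_nat k -> reg s 5 = Z.of_nat n -> reg s 6 = W0 -> reg s 7 = Z.of_nat c ->
  (forall e u v w, nth_error E e = Some (u, v, w) ->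
    arr s 3 (Z.of_nat e) = Z.of_nat u /\ arr s 4 (Z.of_nat e) = Z.of_nat v /\
    arr s 2 (Z.of_nat e) = w) ->
  wp B (pconsts a) (3 * cL + 5 * k + 3 * a + 37) (env k c cU n W0 E cb) s.
Proof.
  intros E1 E2 E3 E4 E5 E6 E7 HA. unfold pconsts.
  replace (3 * cL + 5 * k + 3 * a + 37)
    with ((3 * cL + 4) + (6 + ((5 * k + 4) + (17 + (3 * a + 6))))) by lia.
  apply wp_seq. eapply wp_conseq; [apply wp_frame, plog_spec; assumption | lia |].
  intros s1 ((A8 & A13) & F1).
  apply wp_seq. eapply wp_conseq; [apply wp_frame, pparams_spec | lia |];
    [rewrite (proj1 F1) by reflexivity; assumption .. | exact A8 |].
  intros s2 ((B8 & B9 & B10) & F2).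
  assert (R2 : forall r, writes plog r = false -> writes pparams r = false -> reg s2 r = reg s r)
    by (intros r H1 H2; rewrite (proj1 F2), (proj1 F1); auto).
  apply wp_seq. eapply wp_conseq; [apply wp_frame, ppow_spec | lia |];
    [rewrite R2 by reflexivity; assumption .. | exact B8 | exact B10 | |].
  { rewrite (proj1 F2) by reflexivity. exact A13. }
  intros s3 ((C11 & C14 & CA) & F3).
  assert (R3 : forall r, writes plog r = false -> writes pparams r = false ->
     writes ppow r = false -> reg s3 r = reg s r)
    by (intros r H1 H2 H3; rewrite (proj1 F3), R2; auto).
  apply wp_seq. eapply wp_conseq; [apply wp_frame, pweights_spec | lia |];
    [rewrite R3 by reflexivity; assumption .. | exact C14 |].
  intros s4 ((D12 & D15 & D16 & D17 & D18 & D20 & D21 & D37) & F4).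
  assert (R4 : forall r, writes plog r = false -> writes pparams r = false ->
     writes ppow r = false -> writes pweights r = false -> reg s4 r = reg s r)
    by (intros r H1 H2 H3 H4; rewrite (proj1 F4), R3; auto).
  eapply wp_conseq; [apply wp_frame, pbound_spec | lia |];
    [rewrite R4 by reflexivity; assumption | exact D37 |].
  intros s5 (E19 & F5).
  assert (R5 : forall r, writes plog r = false -> writes pparams r = false ->
     writes ppow r = false -> writes pweights r = false -> writes (pbound a) r = false ->
     reg s5 r = reg s r)
    by (intros r H1 H2 H3 H4 H5; rewrite (proj1 F5), R4; auto).
  assert (AA : forall x, x <> 7 -> forall i, arr s5 x i = arr s x i).
  { intros x Hx i.
    rewrite (proj2 F5), (proj2 F4), (proj2 F3), (proj2 F2), (proj2 F1);
      try reflexivity; cbn [ppow writesa]; rewrite ?orb_false_r; now apply Nat.eqb_neq. }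
  assert (A7 : forall i, arr s5 7 i = arr s3 7 i).
  { intros i. rewrite (proj2 F5), (proj2 F4) by reflexivity. reflexivity. }
  constructor; try (rewrite R5 by reflexivity; assumption);
    try (rewrite (proj1 F5) by reflexivity; assumption);
    try (rewrite (proj1 F5), (proj1 F4) by reflexivity; assumption).
  - rewrite (proj1 F5), (proj1 F4), (proj1 F3) by reflexivity. exact B8.
  - rewrite (proj1 F5), (proj1 F4), (proj1 F3) by reflexivity. exact B9.
  - rewrite (proj1 F5), (proj1 F4), (proj1 F3) by reflexivity. exact B10.
  - rewrite (proj1 F5), (proj1 F4), (proj1 F3), (proj1 F2) by reflexivity. exact A13.
  - exact E19.
  - intros e u v w He. rewrite !AA by lia. auto.
  - intros i Hi. rewrite A7. auto.
Qed.

End Consts.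

(** * The whole program *)

Definition pkcycle (k c a : nat) (P : cmd) : cmd :=
  Const 2 0 ;; Const 3 1 ;; Const 4 (Z.of_nat k) ;; Const 7 (Z.of_nat c) ;;
  pmax ;; prelabel ;; pconsts a ;; psearch P ;; pout.

(** Copies of [lZ0] and [cbase] in [nat], where the growth estimates are carried out. *)
Definition zn (k n w : nat) : nat := (2 * k * w + 1) * (n + 1) ^ k.
Definition basen (k c n w : nat) : nat :=
  hub k (ln0 c n) + (k + 1) * (2 * zn k n w) + 3.

Lemma lZ0_nat k n w : lZ0 k n (Z.of_nat w) = Z.of_nat (zn k n w).
Proof. unfold lZ0, lX, lY, zn. lia. Qed.

Lemma cbase_nat k c n w : cbase k c n (Z.of_nat w) = Z.of_nat (basen k c n w).
Proof. unfold cbase, basen. rewrite lZ0_nat. lia. Qed.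

Lemma cb_nat k c n a w : cb k c n a (Z.of_nat w) = Z.of_nat (basen k c n w ^ a).
Proof. unfold cb. now rewrite cbase_nat, Nat2Z.inj_pow. Qed.

Section Program.
Variables (k c a N M W : nat).
Notation U n := (cU k n).
Notation Q n := (lQ k c (U n)).
Notation n0 n := (ln0 c n).
Notation HUB n := (hub k (n0 n)).

(** A crude sum that dominates every word-size condition met on the way; only its polynomial growth
    matters. *)
Definition word_need (n w : nat) : nat :=
  let z := zn k n w in
  let b := basen k c n w ^ a in
  let q := Q n in
  let d := lD c (U n) in
  (N + M + W + 2 * (n + 1) + U n + lV c (U n) + d + q + k + c + n0 n + HUB n + a + 20)
  + (7 * z + (k + 1) * (2 * z) + (n + 1) ^ k + basen k c n w + 2 * b + 2 * w)
  + 2 * ((d + k + c + 4) * (d + k + c + 4))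
  + (z + 1) * (q * (2 * b + 1)) + 2 * (S q * b) + 2 * (q * (n0 n * z)).

Definition body_need (pr T n : nat) : nat :=
  (3 * lV c (U n) + 8 * k + 8) + ((7 * HUB n + 5) + ((8 * n0 n + 3) + ((38 * M + 2)
    + ((2 * T + pr + 7) + 1)))).

Definition time_need (pr T n w : nat) : nat :=
  let st := Q n * S (body_need pr T n) + 3 in
  4 + ((7 * M + 3) + ((20 * M + 3) + ((3 * cL n + 5 * k + 3 * a + 37) +
  ((Nat.log2_up (zn k n w) * (st + 12) + st + 6) + (6 * k + 8))))).

End Program.

Lemma init_arr G e u v w : nth_error (edges G) e = Some (u, v, w) ->
  arr (init G) 0 (Z.of_nat e) = Z.of_nat u /\ arr (init G) 1 (Z.of_nat e) = Z.of_nat v /\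
  arr (init G) 2 (Z.of_nat e) = w.
Proof.
  intros H. cbn. rewrite Nat2Z.id, H.
  destruct (Z.ltb_spec (Z.of_nat e) 0); [lia | auto].
Qed.

(** This is why the exponent of the Wiener program is raised by 2: the square of the base already
    exceeds the number of edges of a gadget and the square of its number of vertices. The bound on
    edges rests on [n + 1 <= zn k n w]. *)
Lemma hlen_aux (k c n m w : nat) : 0 < k -> 0 < c -> m <= n * n ->
  hub k (ln0 c n) + ln0 c n + k * (m / c + 1) <= basen k c n w ^ 2 /\
  S (hub k (ln0 c n)) * S (hub k (ln0 c n)) <= basen k c n w ^ 2.
Proof.
  intros Hk Hc Hm. unfold basen.
  assert (Hz : n + 1 <= zn k n w).
  { unfold zn. assert (n + 1 <= (n + 1) ^ k).
    { rewrite <- (Nat.pow_1_r (n + 1)) at 1. apply Nat.pow_le_mono_r; lia. }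
    nia. }
  assert (Hd : m / c <= m) by apply div_le_self.
  assert (Hh : ln0 c n <= hub k (ln0 c n)) by (unfold hub; nia).
  set (h := hub k (ln0 c n)) in *. set (z := zn k n w) in *.
  assert (Az : (n + 1) * (n + 1) <= z * z) by (apply Nat.mul_le_mono; exact Hz).
  assert (A : k * (m / c + 1) <= (k + 1) * (z * z)) by (apply Nat.mul_le_mono; nia).
  assert (A' : (k + 1) * (z * z) <= ((k + 1) * (2 * z)) * ((k + 1) * (2 * z))).
  { replace (((k + 1) * (2 * z)) * ((k + 1) * (2 * z)))
      with ((k + 1) * (z * z) * (4 * (k + 1))) by lia. nia. }
  set (y := (k + 1) * (2 * z)) in *. cbn [Nat.pow]. rewrite Nat.mul_1_r.
  clearbody h z y. split; nia.
Qed.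

(** * Correctness and running time of the assembled program *)

Section Correct.
Variables (k c aP : nat) (f : nat -> nat -> nat) (P : cmd).
Hypothesis hk : 0 < k.
Hypothesis hc : 0 < c.
Hypothesis hP : forall G W, wiener_instance G -> weights_le G W ->
  exists t s', exec (Z.of_nat ((order G + W + 2) ^ aP)) P (init G) t s' /\
    t <= f (order G) (nedges G) /\ wiener_output G s'.
Hypothesis hf : monotone2 f.
Variables (G : wgraph) (W : nat) (B : Z) (T Tmax : nat).
Hypothesis hG : simple_digraph G.
Hypothesis hW : weights_le G W.
Notation a := (aP + 2).
Notation N := (order G).
Notation M := (nedges G).
Hypothesis hB : forall n w, n <= N -> n <= 2 * M -> w <= W ->
  (Z.of_nat (word_need k c a N M W n w) <= B)%Z.
Hypothesis hT : forall n, n <= N -> n <= 2 * M ->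
  f (S (hub k (ln0 c n))) (hub k (ln0 c n) + ln0 c n + k * (M / c + 1)) <= T.
Hypothesis hTmax : forall n w, n <= N -> n <= 2 * M -> w <= W ->
  time_need k c a M (nregs P) T n w <= Tmax.

(** The hypotheses range over all [n] and [w] because the number of non-isolated vertices and the
    largest weight only become known during the preprocessing. *)
Lemma pkcycle_correct : wp B (pkcycle k c a P) Tmax (kcycle_output k G) (init G).
Proof.
  assert (HB0 : (Z.of_nat (N + M + W + k + c + 20) <= B)%Z).
  (* The instance 0, 0 serves only to extract the summands that do not depend on [n] and [w]. *)
  { specialize (hB 0 0 ltac:(lia) ltac:(lia) ltac:(lia)). unfold word_need in hB. lia. }
  assert (Hpre : wp B (pmax ;; prelabel) ((7 * M + 3) + (20 * M + 3)) (fun s =>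
    exists w vs, w <= W /\ reg s 6 = Z.of_nat w /\
      (forall a0 z, In (a0, z) (edges G) -> (Z.abs z <= Z.of_nat w)%Z) /\
      labelled N vs s /\ length vs <= 2 * M /\
      forall e u v z, nth_error (edges G) e = Some (u, v, z) ->
      exists i i', nth_error vs i = Some u /\ nth_error vs i' = Some v /\
        arr s 3 (Z.of_nat e) = Z.of_nat i /\ arr s 4 (Z.of_nat e) = Z.of_nat i')
    (set_reg (set_reg (set_reg (set_reg (init G) 2 0) 3 1) 4 (Z.of_nat k)) 7 (Z.of_nat c))).
  { apply wp_seq. eapply wp_conseq;
      [apply wp_frame, (pmax_spec B (edges G) W); try reflexivity | apply le_n |].
    - intros e (u, v) z He. now apply init_arr in He.
    - exact hW.
    - unfold nedges in *. lia.
    - intros s1 [[A1 A2] F1].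
      eapply wp_conseq; [apply wp_frame, (prelabel_spec B G s1 hG) | lia |].
      + now rewrite (proj1 F1 1 eq_refl).
      + now rewrite (proj1 F1 2 eq_refl).
      + now rewrite (proj1 F1 3 eq_refl).
      + intros e u v z He. rewrite (proj2 F1 0 eq_refl), (proj2 F1 1 eq_refl).
        apply init_arr in He. split; apply He.
      + intros j. rewrite (proj2 F1 5 eq_refl). reflexivity.
      + lia.
      + intros s2 [(vs & B1 & B2 & B3) F2].
        exists (Z.to_nat (reg s1 6)), vs.
        rewrite (proj1 F2 6 eq_refl), Z2Nat.id by lia.
        split; [lia |]. split; [reflexivity |]. auto. }
  apply wp_frame in Hpre. destruct Hpre as (t0 & s & Hex & Ht0 & (w & vs & Hw & E6 & HwG & HL & Hvs & Hends) & F).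
  set (n := length vs).
  assert (HnN : n <= N) by (eapply labelled_length; exact HL).
  specialize (hB n w HnN Hvs Hw). specialize (hTmax n w HnN Hvs Hw). specialize (hT n HnN Hvs).
  assert (Hin : forall u v z, In (u, v, z) (edges G) -> In u vs /\ In v vs).
  { intros u v z H. apply In_nth_error in H. destruct H as (e & He).
    destruct (Hends e u v z He) as (i & i' & H1 & H2 & _).
    split; eapply nth_error_In; eassumption. }
  pose proof (lab_nodup _ _ _ HL) as Hnd.
  set (E := relabel vs (edges G)).
  pose proof (relabel_simple G vs hG Hin) as HE. fold n in HE. fold E in HE.
  assert (HEl : length E = M) by (unfold E, relabel; now rewrite length_map).
  assert (HMn : M <= n * n).
  { rewrite <- HEl. exact (nedges_le _ HE). }
  assert (HwE : forall a0 z, In (a0, z) E -> (Z.abs z <= Z.of_nat w)%Z).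
  { intros (u', v') z H. apply in_relabel_inv in H.
    destruct H as (u & v & H & _). eapply HwG; exact H. }
  assert (HW0 : (0 <= Z.of_nat w)%Z) by lia.
  unfold word_need in hB. unfold time_need in hTmax. cbv zeta in hB, hTmax.
  pose proof (lZ0_nat k n w) as EZ. pose proof (cbase_nat k c n w) as Ebase.
  pose proof (cb_nat k c n a w) as Eb.
  assert (EX : lX k n = Z.of_nat ((n + 1) ^ k)) by reflexivity.
  set (b := cb k c n a (Z.of_nat w)) in *.
  set (bn := basen k c n w ^ a) in *.
  destruct (hlen_aux k c n M w hk hc HMn) as [HL1 HL2].
  assert (Hb2 : basen k c n w ^ 2 <= bn) by (apply Nat.pow_le_mono_r; unfold basen; lia).
  assert (Hb1 : basen k c n w <= bn).
  { etransitivity; [| exact Hb2]. rewrite <- (Nat.pow_1_r (basen k c n w)) at 1.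
    apply Nat.pow_le_mono_r; unfold basen; lia. }
  assert (HbaseP : basen k c n w ^ aP <= bn) by (apply Nat.pow_le_mono_r; unfold basen; lia).
  assert (HU : 0 < cU k n) by (unfold cU; lia).
  assert (HLp : n + 1 <= 2 ^ cL n) by (apply Nat.log2_log2_up_spec; lia).
  assert (HUL : cL n * (k * k) + 2 <= cU k n) by (unfold cU; lia).
  set (p := Nat.log2_up (zn k n w)) in *.
  assert (Hzpos : 0 < zn k n w).
  { pose proof (lZ0_pos k c (cU k n) n (Z.of_nat w) hk hc HU HW0). lia. }
  assert (Hp : zn k n w <= 2 ^ p) by (apply Nat.log2_log2_up_spec; exact Hzpos).
  assert (Hpz : p + 1 <= zn k n w + 1).
  { enough (p <= zn k n w) by lia. unfold p. apply Nat.log2_up_le_lin. lia. }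
  set (q := lQ k c (cU k n)) in *.
  set (hubn := hub k (ln0 c n)) in *.
  assert (Hoff : (p + 1) * (q * (2 * bn + 1)) <= (zn k n w + 1) * (q * (2 * bn + 1)))
    by (apply Nat.mul_le_mono_r; exact Hpz).
  assert (HbnB : (b = Z.of_nat bn)%Z) by exact Eb.
  assert (Hsq : forall x, (Z.abs x <= Z.of_nat (lD c (cU k n) + k + c + 4) -> 2 * (x * x) <= B)%Z).
  { intros x Hx. set (m := lD c (cU k n) + k + c + 4) in *.
    assert (x * x <= Z.of_nat m * Z.of_nat m)%Z by (clear -Hx; nia).
    assert (Z.of_nat (m * m) = Z.of_nat m * Z.of_nat m)%Z by lia. lia. }
  assert (Hcall : forall j tau, j < q ->
    (Z.of_nat k * (2 * lZ0 k n (Z.of_nat w)) <= tau <= Z.of_nat (k + 1) * (2 * lZ0 k n (Z.of_nat w)))%Z ->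
    exists t s', exec b P (init (gadget k (ln0 c n) (lZ0 k n (Z.of_nat w))
        (layered k c (cU k n) n (Z.of_nat w) E j (length E)) tau)) t s' /\ t <= T /\
      is_wiener_index (gadget k (ln0 c n) (lZ0 k n (Z.of_nat w))
        (layered k c (cU k n) n (Z.of_nat w) E j (length E)) tau) (reg s' 0)).
  { intros j tau Hj Ht.
    pose proof (gadget_instance k c (cU k n) n (Z.of_nat w) E hk hc HU HW0 HE HwE j tau Ht) as Hi.
    destruct (hP _ ((k + 1) * (2 * zn k n w)) Hi) as (t & s' & He & Htt & Ho).
    { intros a0 z Hz. pose proof (gadget_weights k c (cU k n) n (Z.of_nat w) E hk hc HU HW0 HE HwE
        j tau a0 z Ht Hz). lia. }
    exists t, s'. split; [| split; [| exact Ho]].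
    - eapply exec_le; [| exact He]. cbn [gadget order]. fold hubn.
      replace (S hubn + (k + 1) * (2 * zn k n w) + 2) with (basen k c n w)
        by (unfold basen; fold hubn; lia). lia.
    - etransitivity; [exact Htt |]. etransitivity; [| exact hT].
      apply hf; [apply le_n |].
      pose proof (gadget_length k c (cU k n) n (Z.of_nat w) E hk hc HU j tau) as Hgl.
      rewrite HEl in *. exact Hgl. }
  assert (Hfresh : forall r x, frame r
    (set_reg (set_reg (set_reg (set_reg (init G) 2 0) 3 1) 4 (Z.of_nat k)) 7 (Z.of_nat c)) x ->
    (forall a0, writesa r (10 + a0) = false) -> loaded b 0 [] x).
  { intros r x Fx Hx a0 j Hj. rewrite (proj2 Fx) by apply Hx. cbn.
    assert (Hn : forall (i : nat), nth_error (@nil (nat * nat * Z)) i = None) by (now intros []).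
    destruct a0 as [| [| [| a0]]]; cbn; rewrite ?Hn; destruct (j <? 0)%Z; reflexivity. }
  pose proof (proj1 F) as FR.
  assert (Hcons : wp B (pconsts a) (3 * cL n + 5 * k + 3 * a + 37)
    (env k c (cU k n) n (Z.of_nat w) E b) s).
  { apply (pconsts_spec k c n a (Z.of_nat w) E B hk hc HW0).
    - rewrite Ebase, EZ, EX. fold b. rewrite HbnB, HEl. fold q hubn. lia.
    - rewrite FR by reflexivity. rewrite HEl. reflexivity.
    - rewrite FR by reflexivity. reflexivity.
    - rewrite FR by reflexivity. reflexivity.
    - rewrite FR by reflexivity. reflexivity.
    - apply (lab_count _ _ _ HL).
    - exact E6.
    - rewrite FR by reflexivity. reflexivity.
    - intros e u' v' z He. unfold E, relabel in He. rewrite nth_error_map in He.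
      destruct (nth_error (edges G) e) as [[[u v] z'] |] eqn:En; [| discriminate He].
      cbn in He. injection He as <- <- <-.
      destruct (Hends e u v z' En) as (i & i' & H1 & H2 & H3 & H4).
      rewrite (pos_unique vs i u Hnd H1), (pos_unique vs i' v Hnd H2).
      split; [exact H3 |]. split; [exact H4 |].
      rewrite (proj2 F 2 eq_refl). now apply init_arr in En. }
  assert (Hrest : wp B (pconsts a ;; psearch P ;; pout)
    ((3 * cL n + 5 * k + 3 * a + 37) +
     ((p * ((q * S (body_need k c M (nregs P) T n) + 3) + 12)
        + (q * S (body_need k c M (nregs P) T n) + 3) + 6) + (6 * k + 8)))
    (kcycle_output k G) s).
  { apply wp_seq. eapply wp_conseq; [apply wp_frame, Hcons | apply le_n |].
    intros s1 [He1 F1]. apply wp_seq.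
    assert (Hbt : body_time k c (cU k n) n E P T = body_need k c M (nregs P) T n).
    { unfold body_time, body_need. now rewrite HEl. }
    eapply wp_conseq; [apply wp_frame, (psearch_spec k c (cU k n) n (Z.of_nat w) E P b B
      hk hc HU HW0 HE HwE) with (T := T) (L := cL n) (p := p) | |];
      try assumption; fold q; fold hubn.
    - lia.
    - rewrite EZ, EX, HEl. lia.
    - rewrite HEl. lia.
    - lia.
    - rewrite EZ. unfold basen in Hb1. fold hubn in Hb1. lia.
    - rewrite EZ. change 2%Z with (Z.of_nat 2). rewrite <- Nat2Z.inj_pow. lia.
    - rewrite HbnB. lia.
    - rewrite HbnB. lia.
    - rewrite EZ. lia.
    - rewrite (proj1 F1) by reflexivity. rewrite FR by reflexivity. reflexivity.
    (* This composite is never run in that order; it merely stands for the union of the write sets,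
       which avoids all arrays from 10 on. *)
    - apply (Hfresh (pconsts a ;; pmax ;; prelabel)); [| reflexivity].
      split; cbn [writes writesa]; intros r Hr.
      + apply orb_false_iff in Hr. destruct Hr as [Hr1 Hr2].
        rewrite (proj1 F1) by exact Hr1. apply FR. exact Hr2.
      + apply orb_false_iff in Hr. destruct Hr as [Hr1 Hr2]. intros j.
        rewrite (proj2 F1) by exact Hr1. apply (proj2 F). exact Hr2.
    - unfold search_time. rewrite Hbt. fold q. lia.
    - intros s2 [(He2 & lo & Hlo & G30 & G31 & Hbr) F2].
      assert (A6 : forall j, arr s2 6 j = arr s 6 j).
      { intros j. rewrite (proj2 F2), (proj2 F1) by
          (try reflexivity; unfold psearch, psearch_body, psum, psum_body; cbn [writesa];
           rewrite (proj2 (keeps_pcall P)) by lia; reflexivity). reflexivity. }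
      eapply wp_conseq; [apply (pout_spec k c (cU k n) n (Z.of_nat w) E b B
        hk hc HU HW0 HE HwE) with (L := cL n) (lo := lo) | apply le_n |]; try assumption.
      + rewrite EZ, EX, HEl. fold q hubn. lia.
      + intros s3 [[G0 (us & ws & Hcy & Hmin & Hout)] | [G0 Hno]].
        * left. split; [exact G0 |].
          exists (map (fun i => nth i vs 0) us).
          assert (Hlt : forall u, In u us -> u < length vs).
          { intros u Hu. destruct (arcs_src _ _ _ _ (proj2 (proj2 Hcy)) Hu) as (v & z & Hz).
            exact (proj1 (proj1 HE u v z Hz)). }
          split.
          -- exists (sumZ ws). split; [now apply kcyc_unlabel |].
             intros c' w' Hc'. destruct (kcyc_label G vs Hin k c' w' Hc') as (ws' & -> & Hcy').
             exact (Hmin _ _ Hcy').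
          -- intros i Hi. rewrite Hout by exact Hi. rewrite A6.
             assert (Hui : nth i us 0 < length vs).
             { apply Hlt, nth_In. rewrite (proj1 Hcy). exact Hi. }
             rewrite (lab_inv _ _ _ HL (nth i us 0) (nth (nth i us 0) vs 0))
               by (apply nth_error_nth'; exact Hui).
             rewrite (nth_indep (map (fun j => nth j vs 0) us) 0 ((fun j => nth j vs 0) 0))
               by (rewrite length_map, (proj1 Hcy); exact Hi).
             now rewrite (map_nth (fun j => nth j vs 0)).
        * right. split; [exact G0 |]. intros (c' & w' & Hc').
          destruct (kcyc_label G vs Hin k c' w' Hc') as (ws' & _ & Hcy').
          apply Hno. eauto. }
  unfold pkcycle.
  eapply wp_conseq with (t1 := S (S (S (S ((7 * M + 3) + ((20 * M + 3) + ((3 * cL n + 5 * k + 3 * a + 37) +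
     ((p * ((q * S (body_need k c M (nregs P) T n) + 3) + 12)
        + (q * S (body_need k c M (nregs P) T n) + 3) + 6) + (6 * k + 8))))))))); [| lia | intros s' H'; exact H'].
  cst. cst. cst. cst.
  destruct Hrest as (t1 & s' & Hex1 & Ht1 & Hout).
  (* [Hex] runs [pmax ;; prelabel] as one block while the program nests to the right; the runs are
     split and reassembled. *)
  inversion Hex; subst. inversion Hex1; subst.
  eexists _, s'. split; [eapply exec_seq; [eassumption |]; eapply exec_seq; [eassumption |];
    eapply exec_seq; eassumption |]. split; [lia | exact Hout].
Qed.

End Correct.

(** * Growth rates *)

(* [dn] and [dw] are the number of non-isolated vertices and the largest absolute weight. *)
Record size := Size { dN : nat; dM : nat; dW : nat; dn : nat; dw : nat }.

Definition admissible (x : size) : Prop :=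
  dn x <= dN x /\ dn x <= 2 * dM x /\ dM x <= dN x * dN x /\ dw x <= dW x.

(** This is the base of the word bound in [solves], so a [poly] bound supplies the exponent required
    there. The summand 2 lets a constant be bounded by a power. *)
Definition scale (x : size) : nat := dN x + dW x + 2.

Definition poly (q : size -> nat) : Prop :=
  exists e, forall x, admissible x -> q x <= scale x ^ e.

Lemma pow_mono_scale x e e' : e <= e' -> scale x ^ e <= scale x ^ e'.
Proof. intros H. apply Nat.pow_le_mono_r; [unfold scale; lia | exact H]. Qed.

Lemma poly_const m : poly (fun _ => m).
Proof.
  exists m. intros x _. transitivity (2 ^ m).
  - pose proof (Nat.pow_gt_lin_r 2 m). lia.
  - apply Nat.pow_le_mono_l. unfold scale. lia.
Qed.

Lemma poly_le q q' : poly q' -> (forall x, admissible x -> q x <= q' x) -> poly q.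
Proof. intros [e H] Hle. exists e. intros x Hx. exact (Nat.le_trans _ _ _ (Hle x Hx) (H x Hx)). Qed.

Lemma poly_scale : poly scale.
Proof. exists 1. intros. rewrite Nat.pow_1_r. lia. Qed.

Lemma poly_add q q' : poly q -> poly q' -> poly (fun x => q x + q' x).
Proof.
  intros [e H] [e' H']. exists (S (e + e')). intros x Hx. cbn [Nat.pow].
  specialize (H x Hx). specialize (H' x Hx).
  pose proof (pow_mono_scale x e (e + e') ltac:(lia)).
  pose proof (pow_mono_scale x e' (e + e') ltac:(lia)).
  assert (2 <= scale x) by (unfold scale; lia). nia.
Qed.

Lemma poly_mul q q' : poly q -> poly q' -> poly (fun x => q x * q' x).
Proof.
  intros [e H] [e' H']. exists (e + e'). intros x Hx. rewrite Nat.pow_add_r.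
  apply Nat.mul_le_mono; auto.
Qed.

Lemma poly_pow q m : poly q -> poly (fun x => q x ^ m).
Proof.
  intros [e H]. exists (e * m). intros x Hx. rewrite Nat.pow_mul_r.
  apply Nat.pow_le_mono_l; auto.
Qed.

Lemma poly_S q : poly q -> poly (fun x => S (q x)).
Proof.
  intros H. apply (poly_le _ (fun x => q x + 1)); [| intros; lia].
  apply poly_add; [exact H | apply poly_const].
Qed.

Lemma poly_N : poly dN.
Proof. apply (poly_le _ scale poly_scale). unfold scale. lia. Qed.

Lemma poly_W : poly dW.
Proof. apply (poly_le _ scale poly_scale). unfold scale. lia. Qed.

Lemma poly_n : poly dn.
Proof. apply (poly_le _ dN poly_N). intros x H. apply H. Qed.

Lemma poly_w : poly dw.
Proof. apply (poly_le _ dW poly_W). intros x H. apply H. Qed.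

Lemma poly_M : poly dM.
Proof.
  apply (poly_le _ (fun x => dN x * dN x)); [apply poly_mul; apply poly_N |].
  intros x H. apply H.
Qed.

Lemma poly_cL : poly (fun x => cL (dn x)).
Proof.
  apply (poly_le _ (fun x => dn x + 1)); [apply poly_add; [apply poly_n | apply poly_const] |].
  intros x _. apply Nat.log2_up_le_lin. lia.
Qed.

Lemma poly_div c : poly (fun x => dn x / c).
Proof. apply (poly_le _ dn poly_n). intros. apply div_le_self. Qed.

Ltac poly :=
  repeat first
    [ apply poly_const | apply poly_N | apply poly_W | apply poly_n | apply poly_w
    | apply poly_M | apply poly_cL | apply poly_div
    | apply poly_add | apply poly_mul | apply poly_pow | apply poly_S ].

Lemma poly_zn k : poly (fun x => zn k (dn x) (dw x)).
Proof. unfold zn. poly. Qed.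

Lemma poly_word_need k c a :
  poly (fun x => word_need k c a (dN x) (dM x) (dW x) (dn x) (dw x)).
Proof.
  unfold word_need, basen, zn, lQ, lD, lV, cU, hub, ln0. cbv zeta. poly.
Qed.

Definition lg (x : size) : nat := Nat.log2 (scale x).

Lemma lg_pos x : 1 <= lg x.
Proof. unfold lg. apply Nat.log2_le_pow2; unfold scale; [lia | cbn; lia]. Qed.

Definition softO (h q : size -> nat) : Prop :=
  exists C d, forall x, admissible x -> q x <= C * h x * lg x ^ d.

Notation polylog := (softO (fun _ => 1)).

Lemma lg_mono x d d' : d <= d' -> lg x ^ d <= lg x ^ d'.
Proof. intros H. pose proof (lg_pos x). apply Nat.pow_le_mono_r; lia. Qed.

Lemma softO_le h q q' : softO h q' -> (forall x, admissible x -> q x <= q' x) -> softO h q.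
Proof. intros (C & d & H) Hle. exists C, d. intros x Hx. exact (Nat.le_trans _ _ _ (Hle x Hx) (H x Hx)). Qed.

Lemma softO_add h q q' : softO h q -> softO h q' -> softO h (fun x => q x + q' x).
Proof.
  intros (C & d & H) (C' & d' & H'). exists (C + C'), (d + d'). intros x Hx.
  specialize (H x Hx). specialize (H' x Hx).
  pose proof (lg_mono x d (d + d') ltac:(lia)). pose proof (lg_mono x d' (d + d') ltac:(lia)).
  assert (C * h x * lg x ^ d <= C * h x * lg x ^ (d + d')) by (apply Nat.mul_le_mono_l; assumption).
  assert (C' * h x * lg x ^ d' <= C' * h x * lg x ^ (d + d')) by (apply Nat.mul_le_mono_l; assumption).
  lia.
Qed.

Lemma softO_mul h q q' : polylog q -> softO h q' -> softO h (fun x => q x * q' x).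
Proof.
  intros (C & d & H) (C' & d' & H'). exists (C * C'), (d + d'). intros x Hx.
  specialize (H x Hx). specialize (H' x Hx). rewrite Nat.mul_1_r in H.
  rewrite Nat.pow_add_r.
  replace (C * C' * h x * (lg x ^ d * lg x ^ d'))
    with ((C * lg x ^ d) * (C' * h x * lg x ^ d')) by lia.
  apply Nat.mul_le_mono; assumption.
Qed.

Lemma softO_const h m : (forall x, 1 <= h x) -> softO h (fun _ => m).
Proof.
  intros Hh. exists m, 0. intros x _. specialize (Hh x). cbn [Nat.pow]. nia.
Qed.

Lemma softO_self h : softO h h.
Proof. exists 1, 0. intros. cbn [Nat.pow]. lia. Qed.

Lemma softO_polylog h q : (forall x, 1 <= h x) -> polylog q -> softO h q.
Proof.
  intros Hh (C & d & H). exists C, d. intros x Hx. etransitivity; [apply H, Hx |].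
  specialize (Hh x). apply Nat.mul_le_mono_r, Nat.mul_le_mono_l. exact Hh.
Qed.

Lemma polylog_const m : polylog (fun _ => m).
Proof. now apply softO_const. Qed.

Lemma polylog_pow q m : polylog q -> polylog (fun x => q x ^ m).
Proof.
  intros H. induction m as [| m IH]; cbn [Nat.pow]; [apply polylog_const |].
  now apply softO_mul.
Qed.

Lemma polylog_log2_up q : poly q -> polylog (fun x => Nat.log2_up (q x)).
Proof.
  intros (e & H). exists (2 * e), 1. intros x Hx.
  rewrite Nat.pow_1_r, Nat.mul_1_r.
  transitivity (Nat.log2_up (scale x ^ e)); [apply Nat.log2_up_le_mono; auto |].
  transitivity (e * Nat.log2_up (scale x)).
  { assert (Hs : 0 < scale x) by (unfold scale; lia).
    apply Nat.log2_up_le_pow2; [pose proof (Nat.pow_nonzero (scale x) e); lia |].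
    rewrite Nat.mul_comm, Nat.pow_mul_r. apply Nat.pow_le_mono_l.
    now apply Nat.log2_log2_up_spec. }
  pose proof (Nat.le_log2_up_succ_log2 (scale x)). pose proof (lg_pos x).
  fold (lg x) in *. nia.
Qed.

Lemma polylog_cL : polylog (fun x => cL (dn x)).
Proof.
  unfold cL. apply (polylog_log2_up (fun x => dn x + 1)). poly.
Qed.

Ltac plog :=
  repeat first
    [ apply polylog_const | apply polylog_cL
    | apply softO_add | apply softO_mul | apply polylog_pow ].

Lemma polylog_V k c : polylog (fun x => lV c (cU k (dn x))).
Proof. unfold lV, cU. plog. Qed.

Lemma polylog_Q k c : polylog (fun x => lQ k c (cU k (dn x))).
Proof. unfold lQ, lD, lV, cU. plog. Qed.

(** The number of codes and the number of search rounds are polylogarithmic. Within one round per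
    code everything is linear in [n], hence in [M], or is a call of cost [f N M] plus a constant. *)
Lemma softO_time k c a pr (f : nat -> nat -> nat) C0 :
  (forall N M, 1 <= f N M) ->
  softO (fun x => f (dN x) (dM x) + dM x)
    (fun x => time_need k c a (dM x) pr (f (dN x) (dM x) + C0) (dn x) (dw x)).
Proof.
  intros Hf. set (h := fun x => f (dN x) (dM x) + dM x).
  assert (Hh : forall x, 1 <= h x) by (intros x; specialize (Hf (dN x) (dM x)); unfold h; lia).
  assert (HM : softO h dM) by (apply (softO_le _ _ h (softO_self h)); unfold h; lia).
  assert (HT : softO h (fun x => f (dN x) (dM x)))
    by (apply (softO_le _ _ h (softO_self h)); unfold h; lia).
  assert (Hn : softO h dn).
  { apply (softO_le _ _ (fun x => 2 * dM x)).
    - apply softO_mul; [apply polylog_const | exact HM].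
    - intros x Hx. apply Hx. }
  assert (Hn0 : softO h (fun x => ln0 c (dn x))).
  { apply (softO_le _ _ (fun x => dn x + 1)).
    - apply softO_add; [exact Hn | now apply softO_const].
    - intros x _. unfold ln0. pose proof (div_le_self (dn x) c). lia. }
  assert (Hhub : softO h (fun x => hub k (ln0 c (dn x)))).
  { unfold hub. apply softO_mul; [apply polylog_const | exact Hn0]. }
  assert (HV : softO h (fun x => lV c (cU k (dn x))))
    by (apply softO_polylog; [exact Hh | apply polylog_V]).
  assert (HL : softO h (fun x => cL (dn x)))
    by (apply softO_polylog; [exact Hh | apply polylog_cL]).
  assert (Hc : forall m, softO h (fun _ => m)) by (intros; now apply softO_const).
  assert (Hm : forall m q, softO h q -> softO h (fun x => m * q x))
    by (intros; apply softO_mul; [apply polylog_const | assumption]).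
  assert (HS : forall q, softO h q -> softO h (fun x => S (q x))).
  { intros q Hq. apply (softO_le _ _ (fun x => q x + 1)); [apply softO_add; auto | intros; lia]. }
  assert (Hbody : softO h (fun x => body_need k c (dM x) pr (f (dN x) (dM x) + C0) (dn x))).
  { unfold body_need.
    repeat first [apply Hc | exact HV | exact Hhub | exact Hn0 | exact HM | exact HT
                 | apply Hm | apply softO_add]. }
  assert (Hst : softO h (fun x => lQ k c (cU k (dn x)) *
    S (body_need k c (dM x) pr (f (dN x) (dM x) + C0) (dn x)) + 3)).
  { apply softO_add; [| apply Hc]. apply softO_mul; [apply polylog_Q | now apply HS]. }
  unfold time_need. cbv zeta.
  repeat first [exact Hst | apply Hc | exact HM | exact HL | apply Hm | apply softO_add].
  apply softO_mul; [apply polylog_log2_up, poly_zn |].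
  repeat first [exact Hst | apply Hc | apply softO_add].
Qed.

Lemma exec_time_pos B c s t s' : exec B c s t s' -> 1 <= t.
Proof. induction 1; lia. Qed.

(* Large instances are split finely enough for the gadgets to be no larger than the input;
   for small ones the cost of a gadget is bounded by a constant. *)
Lemma gadget_cost k (f : nat -> nat -> nat) : monotone2 f ->
  exists C0, forall N M n, n <= N -> n <= 2 * M -> M <= N * N ->
    let c := 8 * (k + 2) in
    f (S (hub k (ln0 c n))) (hub k (ln0 c n) + ln0 c n + k * (M / c + 1)) <= f N M + C0.
Proof.
  intros Hf. set (M0 := 8 * (k + 2) * (k + 2)).
  (* For [M < M0] the quotients by [c] are at most [n <= 2 * M0] and [M <= M0], and monotonicity
     bounds the call by this single value. *)
  exists (f (S ((k + 1) * (2 * M0 + 1))) ((k + 2) * (2 * M0 + 1) + k * (M0 + 1))).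
  intros N M n H1 H2 H3 c.
  assert (Hc : c = 8 * (k + 2)) by reflexivity. clearbody c.
  pose proof (Nat.Div0.mul_div_le n c) as Dn. pose proof (Nat.Div0.mul_div_le M c) as DM.
  unfold hub, ln0. set (x := n / c) in *. set (y := M / c) in *.
  assert (Hx : x <= n) by apply div_le_self. assert (Hy : y <= M) by apply div_le_self.
  clearbody x y. subst c.
  destruct (Nat.le_gt_cases M0 M) as [HM | HM].
  - etransitivity; [apply (Hf _ N _ M) | lia].
    (* From [M0 <= M <= N * N]. The additive part [k + 2] of the vertex count is then at most half
       of [N], and the part proportional to [n / c] is at most an eighth of it. *)
    + assert (2 * (k + 2) <= N) by (unfold M0 in HM; nia). nia.
    + unfold M0 in HM. nia.
  - etransitivity; [apply Hf with (N' := S ((k + 1) * (2 * M0 + 1)))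
      (M' := (k + 2) * (2 * M0 + 1) + k * (M0 + 1)) | lia]; clearbody M0.
    + nia.
    + nia.
Qed.

Theorem theoremB5 (k : nat) (hk : 0 < k)
    (f : nat -> nat -> nat) (hf : monotone2 f)
    (hW : wiener_computable_in f) :
  min_kcycle_solvable_in_softO k (fun N M => f N M + M).
Proof.
  destruct hW as (P & aP & hP).
  (* Halting takes at least one step, even on the empty graph, and [f] is monotone. Without this
     lower bound constants could not be absorbed into [f N M + M]. *)
  assert (Hf1 : forall N M, 1 <= f N M).
  { intros N M. destruct (hP (WGraph 0 []) 0) as (t & s' & He & Ht & _).
    - repeat split; cbn; try easy. constructor.
    - intros ? ? [].
    - apply exec_time_pos in He. cbn in Ht.
      etransitivity; [exact He |]. etransitivity; [exact Ht |]. apply hf; lia. }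
  destruct (gadget_cost k f hf) as (C0 & HC0).
  set (c := 8 * (k + 2)) in *.
  destruct (poly_word_need k c (aP + 2)) as (e & He).
  destruct (softO_time k c (aP + 2) (nregs P) f C0 Hf1) as (C & d & Ht).
  exists (pkcycle k c (aP + 2) P), C, d. exists e.
  intros G W HG HW.
  pose proof (nedges_le G HG) as HM.
  apply (pkcycle_correct k c aP f P hk ltac:(unfold c; lia) hP hf G W _
    (f (order G) (nedges G) + C0) _ HG HW).
  - intros n w H1 H2 H3. apply inj_le.
    apply (He (Size (order G) (nedges G) W n w)). repeat split; assumption.
  - intros n H1 H2. apply (HC0 _ _ n H1 H2 HM).
  - intros n w H1 H2 H3.
    apply (Ht (Size (order G) (nedges G) W n w)). repeat split; assumption.
Qed.
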